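(* Let $H\le F$ be a subgroup of Thompson's group $F$. Then $H$ contains the derived subgroup $[F,F]$ of $F$ if and only if the following conditions hold. (1) $[F,F]\subseteq \mathrm{Cl}(H)$. (2) There is a function $h\in H$ which fixes a finite dyadic fraction $\alpha\in\mathcal D=\mathbb{Z}[\frac12]\cap(0,1)$ such that the slope $h'(\alpha^-)=1$ and the slope $h'(\alpha^+)=2$.
   Context: Thompson's group $F$ is the group of all piecewise-linear increasing homeomorphisms of $[0,1]$ with finitely many breakpoints, all in $\mathbb{Z}[\frac12]\cap(0,1)$, and all slopes integer powers of $2$. Diagrams. For a finite binary word $u$, $[u]$ is the dyadic interval $[.u,.u1^{\mathbb N}]$ (binary expansions). Each $f\in F$ has a unique reduced pair $(T_+,T_-)$ of finite rooted full binary trees with the same number $n$ of leaves such that, if $u_1,\dots,u_n$ and $v_1,\dots,v_n$ are the leaf addresses ($0$ = left, $1$ = right) from left to right of $T_+$ and $T_-$, then $f$ maps $[u_i]$ linearly onto $[v_i]$ for all $i$ (reduced: for no $i$ are leaves $i,i+1$ the two children of one node in both trees). The reduced diagram $\Delta$ of $f$ is the following directed $2$-complex. Its edges are the nodes of $T_+$ and of $T_-$, the $i$-th leaf of $T_+$ being identified with the $i$-th leaf of $T_-$. It has vertices $0,\dots,n$, and a node whose descendant leaves are the $i$-th through $j$-th is an edge directed from vertex $i-1$ to vertex $j$. For each non-leaf node $e$ of either tree there is a positive cell with top edge $e$, left bottom edge the left child of $e$ and right bottom edge the right child of $e$ (together with its formal inverse, a negative cell). The top edge of $\Delta$ is the root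 of $T_+$, the bottom edge of $\Delta$ is the root of $T_-$. (For the identity, $\Delta$ is a single edge.) Core. Let $H\le F$ be generated by elements with reduced diagrams $\Delta_i$, $i\in\mathcal I$. Identify all top edges and all bottom edges of all $\Delta_i$ into one distinguished edge $p$ (with corresponding identification of endpoints). Then apply foldings as long as possible: whenever two positive cells have the same top edge, identify their left bottom edges, their right bottom edges and the cells; whenever two positive cells have the same left bottom edge and the same right bottom edge, identify their top edges and the cells (identifying edges also identifies their initial vertices and their terminal vertices). The resulting complex (a limit if infinitely many foldings are needed) with distinguished edge $p$ is the core $\mathcal L(H)$; it does not depend on the generating set or on the order of foldings. Closure. $\mathcal L(H)$ accepts a diagram $\Delta$ if there is a map from $\Delta$ to $\mathcal L(H)$ taking vertices to vertices, edges to edges, positive cells to positive cells, preserving initial and terminal vertices of edges and top, left bottom and right bottom edges of cells, and sending both the top and the bottom edge of $\Delta$ to $p$. The closure $\mathrm{Cl}(H)$ is the subgroup of all $f\in F$ whose reduced diagram is accepted by $\mathcal L(H)$. *)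

(* Defs.v *)
From HB Require Import structures.
From mathcomp Require Import all_boot all_order all_algebra.
From mathcomp Require Import generic_quotient.
From mathcomp Require Import all_classical all_reals all_analysis.
From mathcomp Require Import lra ring.

Set Implicit Arguments.
Unset Strict Implicit.
Unset Printing Implicit Defensive.

Import Order.TTheory GRing.Theory Num.Theory.
Import numFieldNormedType.Exports.

Local Open Scope classical_set_scope.
Local Open Scope ring_scope.

Definition dyadic (R : realType) (x : R) : Prop :=
  exists (k : int) (n : nat), x = k%:~R / 2 ^+ n.

Definition dyadic01 (R : realType) (x : R) : Prop := dyadic x /\ 0 < x < 1.

(* Homeomorphisms of [0, 1] are represented by functions R -> R equal to the  *)
(* identity off [0, 1]. An increasing surjection of [0, 1] onto itself is     *)
(* automatically a homeomorphism. The sequence B contains the breakpoints.    *)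
Definition is_thompson (R : realType) (f : R -> R) : Prop :=
  [/\ forall x, ~ (0 <= x <= 1) -> f x = x,
      forall x y, 0 <= x -> x < y -> y <= 1 -> f x < f y,
      f @` `[0, 1]%classic = `[0, 1]%classic
    & exists2 B : seq R, (forall c, c \in B -> dyadic01 c) &
        forall a b, 0 <= a -> a < b -> b <= 1 ->
          (forall c, c \in B -> ~ (a < c < b)) ->
          exists m : int, forall x, a <= x <= b -> f x = f a + 2 ^ m * (x - a)].

Definition thompsonF (R : realType) : Type :=
  {f : R -> R | `[< is_thompson f >]}.

HB.instance Definition _ (R : realType) := Choice.on (thompsonF R).

Definition thompson_fun (R : realType) (f : thompsonF R) : R -> R := val f.
Coercion thompson_fun : thompsonF >-> Funclass.

Section ThompsonGroup.
Variable R : realType.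
Implicit Types (f g : R -> R) (x y z c : R).

Lemma dyadicD x y : dyadic x -> dyadic y -> dyadic (x + y).
Proof.
move=> [k [n ->]] [l [p ->]]; exists (k * 2 ^+ p + l * 2 ^+ n), (n + p)%N.
rewrite exprD rmorphD /= !rmorphM /= !rmorphXn /=.
by field; rewrite !expf_neq0.
Qed.

Lemma dyadicN x : dyadic x -> dyadic (- x).
Proof.
by move=> [k [n ->]]; exists (- k), n; rewrite rmorphN mulNr.
Qed.

Lemma dyadicZ (m : int) x : dyadic x -> dyadic (2 ^ m * x).
Proof.
move=> [k [n ->]]; case: m => p.
  exists (k * 2 ^+ p), n; rewrite rmorphM /= rmorphXn /= -exprnP.
  by field; rewrite !expf_neq0.
exists k, (n + p.+1)%N; rewrite NegzE exprD -exprnN.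
by field; rewrite !expf_neq0.
Qed.

Lemma is_thompson_in01 f x :
  is_thompson f -> 0 <= x <= 1 -> 0 <= f x <= 1.
Proof.
case=> _ _ fim _ x01.
have : (f @` `[0, 1]%classic) (f x) by exists x => //=; rewrite in_itv.
by rewrite fim /= in_itv.
Qed.

Lemma is_thompson_pre f y :
  is_thompson f -> 0 <= y <= 1 -> exists2 x, 0 <= x <= 1 & f x = y.
Proof.
case=> _ _ fim _ y01.
have : `[0, 1]%classic y by rewrite /= in_itv.
by rewrite -fim => -[x /=]; rewrite in_itv /= => x01 <-; exists x.
Qed.

Lemma is_thompson_inj f : is_thompson f -> injective f.
Proof.
move=> ft x y fxy; case: (ft) => fid finc _ _.
have wlog_inj u v : f u = f v -> u < v -> False.
  move=> fuv uv.
  have [u01|/negP u01] := boolP (0 <= u <= 1);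
  have [v01|/negP v01] := boolP (0 <= v <= 1).
  - have /andP[u0 _] := u01; have /andP[_ v1] := v01.
    by have := finc u v u0 uv v1; rewrite fuv ltxx.
  - have := is_thompson_in01 ft u01; rewrite fuv (fid v v01).
    by move=> /(v01).
  - have := is_thompson_in01 ft v01; rewrite -fuv (fid u u01).
    by move=> /(u01).
  - by move: fuv; rewrite (fid u u01) (fid v v01) => uv'; move: uv; rewrite uv' ltxx.
case: (ltgtP x y) => // [/(wlog_inj _ _ fxy)//|].
by move/(wlog_inj _ _ (esym fxy)).
Qed.

Lemma is_thompson_surj f y : is_thompson f -> exists x, f x = y.
Proof.
move=> ft; have [y01|/negP y01] := boolP (0 <= y <= 1).
  by have [x _ <-] := is_thompson_pre ft y01; exists x.
by exists y; case: ft => ->.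
Qed.

Lemma is_thompson_le f x y : is_thompson f ->
  0 <= x -> x <= y -> y <= 1 -> f x <= f y.
Proof.
case=> _ finc _ _ x0; rewrite le_eqVlt => /predU1P[-> //|xy] y1.
by rewrite ltW// finc.
Qed.

Lemma is_thompson_lt f x y : is_thompson f ->
  0 <= x <= 1 -> 0 <= y <= 1 -> f x < f y -> x < y.
Proof.
move=> ft /andP[x0 x1] /andP[y0 y1]; rewrite !ltNge; apply: contra => yx.
exact: is_thompson_le.
Qed.

Lemma is_thompson0 f : is_thompson f -> f 0 = 0.
Proof.
move=> ft; have [x /andP[x0 x1] fx] : exists2 x, 0 <= x <= 1 & f x = 0.
  by apply: is_thompson_pre => //; rewrite lexx ler01.
have f0 : f 0 <= f x by exact: is_thompson_le.
apply/eqP; rewrite eq_le -{2}fx f0 /=.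
by have /andP[] : 0 <= f 0 <= 1 by apply: is_thompson_in01; rewrite // lexx ler01.
Qed.

Lemma is_thompson1 f : is_thompson f -> f 1 = 1.
Proof.
move=> ft; have [x /andP[x0 x1] fx] : exists2 x, 0 <= x <= 1 & f x = 1.
  by apply: is_thompson_pre => //; rewrite lexx ler01.
have f1 : f x <= f 1 by exact: is_thompson_le.
apply/eqP; rewrite eq_le -{3}fx f1 andbT.
by have /andP[] : 0 <= f 1 <= 1 by apply: is_thompson_in01; rewrite // lexx ler01.
Qed.

Lemma is_thompson_affine f x : is_thompson f -> 0 <= x <= 1 ->
  exists (m : int) (d : R), dyadic d /\ f x = 2 ^ m * x + d.
Proof.
move=> ft; case: (ft) => _ _ _ [B Bd Baff].
have [n] := ubnP (count (fun c => c < x) B); elim: n x => // n IHn x le_n.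
move=> /andP[x0 x1].
have d0 : dyadic (0 : R) by exists 0, 0%N; rewrite mul0r.
have [->|xN0] := eqVneq x 0.
  by exists 0, 0; rewrite mulr0 addr0 is_thompson0.
have x_gt0 : 0 < x by rewrite lt_neqAle eq_sym xN0.
have step b : 0 <= b -> b < x -> dyadic b -> dyadic (f b) ->
    (forall c, c \in B -> ~ (b < c < x)) ->
    exists (m : int) (d : R), dyadic d /\ f x = 2 ^ m * x + d.
  move=> b0 bx db dfb noB; have [m fm] := Baff b x b0 bx x1 noB.
  exists m, (f b - 2 ^ m * b); split; first exact/dyadicD/dyadicN/dyadicZ.
  by rewrite fm ?lexx ?ltW//; ring.
have [noB|] := pselect (forall c, c \in B -> ~ (0 < c < x)).
  by apply: (step 0) => //; rewrite is_thompson0.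
move=> /existsNP[c0 /not_implyP[c0B /contrapT /andP[c00 c0x]]].
pose C := [seq c <- B | c < x].
have c0C : c0 \in C by rewrite mem_filter c0x.
have [b bC bmax] : exists2 b, b \in C & forall c, c \in C -> c <= b.
  clear -c0C; elim: C c0 c0C => // a [|a' s] IHs c0 _.
    by exists a => [|c]; rewrite inE // => /eqP->.
  have [b bs bmax] := IHs a' (mem_head _ _).
  case: (leP a b) => ab.
    by exists b => [|c]; rewrite inE ?bs ?orbT // => /predU1P[->|/bmax].
  exists a => [|c]; rewrite inE ?eqxx // => /predU1P[->|/bmax cb] //.
  by rewrite (le_trans cb)// ltW.
move: (bC); rewrite mem_filter => /andP[bx bB].
have [db /andP[b0 b1]] := Bd _ bB.
apply: (step b) => //; first exact: ltW.
  have [|/=|m [d [dd ->]]] := IHn b.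
  - rewrite ltnS in le_n; apply: leq_trans le_n; rewrite -!size_filter -/C.
    have -> : [seq c <- B | c < b] = [seq c <- C | c < b].
      rewrite -filter_predI; apply: eq_filter => c /=.
      by case: ltP => //= /lt_trans/(_ bx)->.
    rewrite size_filter -(count_predC (fun c => c < b) C) -addn1 leq_add2l.
    by rewrite -has_count; apply/hasP; exists b; rewrite //= ltxx.
  - by rewrite !ltW.
  - exact/dyadicD/dd/dyadicZ.
move=> c cB /andP[bc cx].
by have := bmax c; rewrite mem_filter cx cB leNgt bc => /(_ isT).
Qed.

Lemma dyadic_fun f x : is_thompson f -> 0 <= x <= 1 -> dyadic x -> dyadic (f x).
Proof.
move=> ft x01 dx; have [m [d [dd ->]]] := is_thompson_affine ft x01.
exact/dyadicD/dd/dyadicZ.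
Qed.

Lemma dyadic_fun_inv f x : is_thompson f -> 0 <= x <= 1 -> dyadic (f x) ->
  dyadic x.
Proof.
move=> ft x01; have [m [d [dd ->]]] := is_thompson_affine ft x01 => dfx.
have -> : x = 2 ^ (- m) * ((2 ^ m * x + d) + - d).
  by rewrite addrK mulrA -expfzDr// addNr mul1r.
exact/dyadicZ/dyadicD/dyadicN.
Qed.

Lemma dyadic01_fun f x : is_thompson f -> dyadic01 x -> dyadic01 (f x).
Proof.
move=> ft [dx /andP[x0 x1]]; split; first by apply: dyadic_fun; rewrite // !ltW.
rewrite -{1}(is_thompson0 ft) -(is_thompson1 ft).
by case: ft => _ finc _ _; apply/andP; split; apply: finc => //; exact: ltW.
Qed.

Lemma dyadic01_fun_inv f x : is_thompson f -> 0 <= x <= 1 -> dyadic01 (f x) ->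
  dyadic01 x.
Proof.
move=> ft x01 [dfx /andP[fx0 fx1]]; split; first exact: dyadic_fun_inv dfx.
have /andP[x0 x1] := x01; rewrite !lt_neqAle x0 x1 !andbT.
apply/andP; split; apply/eqP => xE.
  by move: fx0; rewrite -xE is_thompson0 ?ltxx.
by move: fx1; rewrite xE is_thompson1 ?ltxx.
Qed.

Lemma is_thompson_id : is_thompson (@id R).
Proof.
split=> //; first by rewrite image_id.
by exists [::] => // a b _ _ _ _; exists 0 => x _; rewrite mul1r; ring.
Qed.

Lemma is_thompson_comp f g :
  is_thompson f -> is_thompson g -> is_thompson (f \o g).
Proof.
move=> ft gt; case: (ft) => fid finc fim [B Bd Baff].
case: (gt) => gid ginc gim [C Cd Caff]; split.
- by move=> x x01 /=; rewrite gid // fid.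
- move=> x y x0 xy y1 /=.
  have /andP[gx0 _] : 0 <= g x <= 1.
    by apply: is_thompson_in01; rewrite // x0 (le_trans (ltW xy)).
  have /andP[_ gy1] : 0 <= g y <= 1.
    by apply: is_thompson_in01; rewrite // y1 (le_trans x0)// ltW.
  by apply: finc => //; exact: ginc.
- by rewrite -image_comp gim fim.
have /choice[h hP] : forall c, exists x, c \in B -> 0 <= x <= 1 /\ g x = c.
  move=> c; have [cB|] := boolP (c \in B); last by exists 0.
  have [_ /andP[c0 c1]] := Bd _ cB.
  have [|x x01 gx] := @is_thompson_pre g c gt; first by rewrite !ltW.
  by exists x.
exists (C ++ map h B) => [c|a b a0 ab b1 noCB].
  rewrite mem_cat => /orP[/Cd//|/mapP[y yB ->]].
  have [x01 gx] := hP _ yB; apply: (dyadic01_fun_inv gt) => //.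
  by rewrite gx; exact: Bd.
have ga0 : 0 <= g a.
  by rewrite -(is_thompson0 gt) is_thompson_le// (le_trans (ltW ab)).
have gb1 : g b <= 1.
  by rewrite -(is_thompson1 gt) is_thompson_le// (le_trans a0)// ltW.
have [|m gm] := Caff a b a0 ab b1.
  by move=> c cC; apply: noCB; rewrite mem_cat cC.
have [|k fk] := Baff (g a) (g b) ga0 (ginc _ _ a0 ab b1) gb1.
  move=> c cB /andP[ac cb]; have [h01 gh] := hP _ cB.
  apply: (noCB (h c)); first by rewrite mem_cat map_f ?orbT.
  apply/andP; split; apply: (is_thompson_lt gt); rewrite ?gh //.
    by rewrite a0 (le_trans (ltW ab)).
  by rewrite b1 (le_trans a0 (ltW ab)).
exists (k + m) => x /andP[ax xb] /=.
rewrite fk; first by rewrite (gm x) ?ax// expfzDr//; ring.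
apply/andP; split; apply: (is_thompson_le gt) => //.
  exact: le_trans b1.
exact: le_trans ax.
Qed.

Lemma is_thompson_inv f g :
  is_thompson f -> cancel f g -> cancel g f -> is_thompson g.
Proof.
move=> ft fK gK; case: (ft) => fid finc fim [B Bd Baff].
have g01 y : 0 <= y <= 1 -> 0 <= g y <= 1.
  by move=> /(is_thompson_pre ft)[x x01 <-]; rewrite fK.
split.
- by move=> x x01; rewrite -{1}(fid x x01) fK.
- move=> x y x0 xy y1; apply: (is_thompson_lt ft); rewrite ?gK//; apply: g01.
    by rewrite x0 (le_trans (ltW xy)).
  by rewrite y1 (le_trans x0)// ltW.
- apply/seteqP; split => [_ [x /= + <-]|x /=].
    by rewrite !in_itv; exact: g01.
  rewrite in_itv /= => x01; exists (f x); last exact: fK.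
  by rewrite /= in_itv /=; exact: is_thompson_in01.
exists (map f B) => [_ /mapP[c /Bd dc ->]|a b a0 ab b1 noB].
  exact: dyadic01_fun.
have a01 : 0 <= a <= 1 by rewrite a0 (le_trans (ltW ab)).
have b01 : 0 <= b <= 1 by rewrite b1 (le_trans a0)// ltW.
have gab : g a < g b by apply: (is_thompson_lt ft); rewrite ?gK ?g01.
have /andP[ga0 ga1] := g01 _ a01; have /andP[gb0 gb1] := g01 _ b01.
have [|m fm] := Baff (g a) (g b) ga0 gab gb1.
  move=> c cB /andP[ac cb]; have [_ /andP[c0 c1]] := Bd _ cB.
  apply: (noB (f c)); first exact: map_f.
  by rewrite -{1}(gK a) -(gK b) !finc// ltW.
exists (- m) => x /andP[ax xb].
have x01 : 0 <= x <= 1 by rewrite (le_trans a0)//= (le_trans xb).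
have xE : x = a + 2 ^ m * (g x - g a).
  rewrite -{1}(gK x) -{1}(gK a); apply: fm; apply/andP; split; rewrite leNgt.
    have /andP[gx0 _] := g01 _ x01; apply/negP.
    by move=> /(finc _ _ gx0)/(_ ga1); rewrite !gK ltNge ax.
  have /andP[_ gx1] := g01 _ x01; apply/negP.
  by move=> /(finc _ _ gb0)/(_ gx1); rewrite !gK ltNge xb.
rewrite {2}xE addrAC subrr add0r mulrA -expfzDr// addNr mul1r.
by rewrite addrC subrK.
Qed.

Lemma thompsonP (f : thompsonF R) : is_thompson f.
Proof. exact: asboolW (valP f). Qed.

Definition thompson_of f (ft : is_thompson f) : thompsonF R :=
  exist _ f (asboolT ft).

Definition inv_fun f y : R := xget (0 : R) [set x | f x = y].

Lemma inv_funK f : is_thompson f -> cancel f (inv_fun f) /\ cancel (inv_fun f) f.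
Proof.
move=> ft; have fK : cancel (inv_fun f) f.
  move=> y; have [x fx] := is_thompson_surj y ft.
  exact: (@xgetI R (0 : R) [set z | f z = y] x fx).
by split=> // x; apply: (is_thompson_inj ft); rewrite fK.
Qed.

Lemma is_thompson_inv_fun f : is_thompson f -> is_thompson (inv_fun f).
Proof. by move=> ft; have [? ?] := inv_funK ft; exact: is_thompson_inv ft _ _. Qed.

Definition thompson_one : thompsonF R := thompson_of is_thompson_id.
Definition thompson_mul (f g : thompsonF R) : thompsonF R :=
  thompson_of (is_thompson_comp (thompsonP f) (thompsonP g)).
Definition thompson_inv (f : thompsonF R) : thompsonF R :=
  thompson_of (is_thompson_inv_fun (thompsonP f)).

Lemma thompson_mulA : associative thompson_mul.
Proof. by move=> f g h; apply: val_inj. Qed.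

Lemma thompson_mul1g : left_id thompson_one thompson_mul.
Proof. by move=> f; apply: val_inj. Qed.

Lemma thompson_mulg1 : right_id thompson_one thompson_mul.
Proof. by move=> f; apply: val_inj. Qed.

Lemma thompson_mulVg : left_inverse thompson_one thompson_inv thompson_mul.
Proof.
move=> f; apply: val_inj; apply/funext => x /=.
exact: (inv_funK (thompsonP f)).1.
Qed.

Lemma thompson_mulgV : right_inverse thompson_one thompson_inv thompson_mul.
Proof.
move=> f; apply: val_inj; apply/funext => x /=.
exact: (inv_funK (thompsonP f)).2.
Qed.

End ThompsonGroup.

HB.instance Definition _ (R : realType) := isGroup.Build (thompsonF R)
  (@thompson_mulA R) (@thompson_mul1g R) (@thompson_mulg1 R)
  (@thompson_mulVg R) (@thompson_mulgV R).

Lemma thompson_mulE (R : realType) (f g : thompsonF R) :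
  thompson_fun (f * g)%g = f \o g.
Proof. by []. Qed.

Definition is_subgroup (G : groupType) (H : set G) : Prop :=
  group_closed (mem H).

Definition derived_subgroup (G : groupType) : set G :=
  smallest (@is_subgroup G) [set z | exists x y : G, z = [~ x, y]%g].

(* Nodes are given by their addresses: false = left, true = right. *)

Inductive btree : Type := BLeaf | BNode of btree & btree.

Fixpoint btree_encode (t : btree) : GenTree.tree unit :=
  if t is BNode l r then GenTree.Node 0 [:: btree_encode l; btree_encode r]
  else GenTree.Leaf tt.

Fixpoint btree_decode (t : GenTree.tree unit) : btree :=
  if t is GenTree.Node _ [:: l; r] then BNode (btree_decode l) (btree_decode r)
  else BLeaf.

Lemma btree_encodeK : cancel btree_encode btree_decode.
Proof. by elim=> //= l -> r ->. Qed.

HB.instance Definition _ := Choice.copy btree (can_type btree_encodeK).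

Fixpoint leaves (t : btree) : seq (seq bool) :=
  if t is BNode l r then
    map (cons false) (leaves l) ++ map (cons true) (leaves r)
  else [:: [::]].

Fixpoint inner_nodes (t : btree) : seq (seq bool) :=
  if t is BNode l r then
    [::] :: map (cons false) (inner_nodes l) ++ map (cons true) (inner_nodes r)
  else [::].

(* The pair (T_+, T_-); side true is T_+ and side false is T_-. *)
Definition tree_pair : Type := (btree * btree)%type.

Definition side (d : tree_pair) (s : bool) : btree := if s then d.1 else d.2.

Definition reduced (d : tree_pair) : Prop :=
  ~ exists (i : nat) (u v : seq bool),
    [/\ (i.+1 < size (leaves d.1))%N, (i.+1 < size (leaves d.2))%N,
        nth [::] (leaves d.1) i = rcons u false /\
        nth [::] (leaves d.1) i.+1 = rcons u true
      & nth [::] (leaves d.2) i = rcons v false /\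
        nth [::] (leaves d.2) i.+1 = rcons v true].

(* The number .u; the dyadic interval [u] is [.u, .u + 2 ^ -|u|] *)
Definition word_val (R : realType) (u : seq bool) : R :=
  foldr (fun (b : bool) x => (b%:R + x) / 2) 0 u.

Definition dyadic_itv (R : realType) (u : seq bool) : set R :=
  [set x | word_val R u <= x <= word_val R u + 2 ^- size u].

(* f maps [u] linearly onto [v]; f being increasing, this leaves one formula *)
Definition maps_linearly (R : realType) (f : R -> R) (u v : seq bool) : Prop :=
  forall x, dyadic_itv u x ->
    f x = word_val R v + 2 ^+ size u / 2 ^+ size v * (x - word_val R u).

Definition represents (R : realType) (d : tree_pair) (f : R -> R) : Prop :=
  size (leaves d.1) = size (leaves d.2) /\
  forall i, (i < size (leaves d.1))%N ->
    maps_linearly f (nth [::] (leaves d.1) i) (nth [::] (leaves d.2) i).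

Definition is_reduced_pair (R : realType) (d : tree_pair) (f : R -> R) : Prop :=
  reduced d /\ represents d f.

(* Directed 2-complexes all of whose positive cells have a top path of length *)
(* one and a bottom path of length two; cell is the type of positive cells.   *)
Record complex : Type := Complex {
  vertex : choiceType;
  edge : choiceType;
  cell : choiceType;
  init : edge -> vertex;
  term : edge -> vertex;
  top : cell -> edge;
  lbot : cell -> edge;
  rbot : cell -> edge }.

Record morphism (K L : complex) : Type := Morphism {
  mor_vertex : vertex K -> vertex L;
  mor_edge : edge K -> edge L;
  mor_cell : cell K -> cell L;
  mor_init : forall e, mor_vertex (init e) = init (mor_edge e);
  mor_term : forall e, mor_vertex (term e) = term (mor_edge e);
  mor_top : forall c, mor_edge (top c) = top (mor_cell c);
  mor_lbot : forall c, mor_edge (lbot c) = lbot (mor_cell c);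
  mor_rbot : forall c, mor_edge (rbot c) = rbot (mor_cell c) }.

(* The diagram of a tree pair whose two trees have the same number n of       *)
(* leaves. The leaf edges are indexed by 'I_n, with n written as a successor, *)
(* which is legitimate since trees have at least one leaf.                    *)
Section Diagram.
Variable d : tree_pair.

Definition nleaves : nat := (size (leaves d.1)).-1.+1.

Definition diag_vertex : Type := 'I_nleaves.+1.
HB.instance Definition _ := Choice.on diag_vertex.

Definition diag_cell : Type :=
  {x : bool * seq bool | x.2 \in inner_nodes (side d x.1)}.
HB.instance Definition _ := Choice.on diag_cell.

Definition diag_edge : Type := ('I_nleaves + diag_cell)%type.
HB.instance Definition _ := Choice.on diag_edge.

(* The edge given by the node u of side d s; meaningful only for nodes. *)
Definition node_edge (s : bool) (u : seq bool) : diag_edge :=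
  if insub (s, u) is Some c then inr c
  else inl (inord (index u (leaves (side d s)))).

(* The leaves below a node are consecutive, so the first one and their number *)
(* determine the endpoints.                                                   *)
Definition diag_init (e : diag_edge) : diag_vertex :=
  match e with
  | inl i => inord i
  | inr c => let: (s, u) := val c in inord (find (prefix u) (leaves (side d s)))
  end.

Definition diag_term (e : diag_edge) : diag_vertex :=
  match e with
  | inl i => inord i.+1
  | inr c => let: (s, u) := val c in
      inord (find (prefix u) (leaves (side d s)) +
             count (prefix u) (leaves (side d s)))
  end.

Definition diag_top (c : diag_cell) : diag_edge := inr c.

Definition diag_lbot (c : diag_cell) : diag_edge :=
  let: (s, u) := val c in node_edge s (rcons u false).

Definition diag_rbot (c : diag_cell) : diag_edge :=
  let: (s, u) := val c in node_edge s (rcons u true).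

Definition diagram : complex :=
  Complex diag_init diag_term diag_top diag_lbot diag_rbot.

Definition top_edge : edge diagram := node_edge true [::].
Definition bottom_edge : edge diagram := node_edge false [::].

End Diagram.

Section DisjointUnion.
Variables (I : choiceType) (K : I -> complex).

Definition union_vertex : Type := {i : I & vertex (K i)}.
HB.instance Definition _ := Choice.on union_vertex.
Definition union_edge : Type := {i : I & edge (K i)}.
HB.instance Definition _ := Choice.on union_edge.
Definition union_cell : Type := {i : I & cell (K i)}.
HB.instance Definition _ := Choice.on union_cell.

Definition union : complex := @Complex union_vertex union_edge union_cell
  (fun e => existT _ (tag e) (init (tagged e)))
  (fun e => existT _ (tag e) (term (tagged e)))
  (fun c => existT _ (tag c) (top (tagged c)))
  (fun c => existT _ (tag c) (lbot (tagged c)))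
  (fun c => existT _ (tag c) (rbot (tagged c))).

Definition in_union (i : I) (e : edge (K i)) : edge union :=
  existT (fun j => edge (K j) : Type) i e.

End DisjointUnion.

(* The complex obtained from K by identifying all the edges in base and then  *)
(* folding as long as possible: the quotient by the least equivalence         *)
(* relations that identify the edges in base and are closed under foldings.   *)
Section Folding.
Variables (K : complex) (base : set (edge K)).

Inductive edge_eqv : edge K -> edge K -> Prop :=
| edge_refl e : edge_eqv e e
| edge_sym e e' : edge_eqv e e' -> edge_eqv e' e
| edge_trans e e' e'' : edge_eqv e e' -> edge_eqv e' e'' -> edge_eqv e e''
| edge_base e e' : base e -> base e' -> edge_eqv e e'
| edge_fold_lbot c c' :
    edge_eqv (top c) (top c') -> edge_eqv (lbot c) (lbot c')
| edge_fold_rbot c c' :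
    edge_eqv (top c) (top c') -> edge_eqv (rbot c) (rbot c')
| edge_fold_top c c' :
    edge_eqv (lbot c) (lbot c') -> edge_eqv (rbot c) (rbot c') ->
    edge_eqv (top c) (top c').

Inductive vertex_eqv : vertex K -> vertex K -> Prop :=
| vertex_refl v : vertex_eqv v v
| vertex_sym v v' : vertex_eqv v v' -> vertex_eqv v' v
| vertex_trans v v' v'' :
    vertex_eqv v v' -> vertex_eqv v' v'' -> vertex_eqv v v''
| vertex_init e e' : edge_eqv e e' -> vertex_eqv (init e) (init e')
| vertex_term e e' : edge_eqv e e' -> vertex_eqv (term e) (term e').

Inductive cell_eqv : cell K -> cell K -> Prop :=
| cell_refl c : cell_eqv c c
| cell_sym c c' : cell_eqv c c' -> cell_eqv c' c
| cell_trans c c' c'' : cell_eqv c c' -> cell_eqv c' c'' -> cell_eqv c c''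
| cell_fold_bot c c' : edge_eqv (top c) (top c') -> cell_eqv c c'
| cell_fold_top c c' :
    edge_eqv (lbot c) (lbot c') -> edge_eqv (rbot c) (rbot c') -> cell_eqv c c'.

Definition edge_rel : rel (edge K) := fun e e' => `[< edge_eqv e e' >].
Definition vertex_rel : rel (vertex K) := fun v v' => `[< vertex_eqv v v' >].
Definition cell_rel : rel (cell K) := fun c c' => `[< cell_eqv c c' >].

Lemma edge_rel_equiv : equiv_class_of edge_rel.
Proof.
split=> [e|e e'|e e' e'']; first exact/asboolP/edge_refl.
  by apply: asbool_equiv_eq; split; exact: edge_sym.
by move=> /asboolP h /asboolP h'; apply/asboolP; exact: edge_trans h h'.
Qed.

Lemma vertex_rel_equiv : equiv_class_of vertex_rel.
Proof.
split=> [v|v v'|v v' v'']; first exact/asboolP/vertex_refl.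
  by apply: asbool_equiv_eq; split; exact: vertex_sym.
by move=> /asboolP h /asboolP h'; apply/asboolP; exact: vertex_trans h h'.
Qed.

Lemma cell_rel_equiv : equiv_class_of cell_rel.
Proof.
split=> [c|c c'|c c' c'']; first exact/asboolP/cell_refl.
  by apply: asbool_equiv_eq; split; exact: cell_sym.
by move=> /asboolP h /asboolP h'; apply/asboolP; exact: cell_trans h h'.
Qed.

Canonical edge_equiv_rel := EquivRelPack edge_rel_equiv.
Canonical vertex_equiv_rel := EquivRelPack vertex_rel_equiv.
Canonical cell_equiv_rel := EquivRelPack cell_rel_equiv.

Local Open Scope quotient_scope.

Definition fold_vertex : Type := {eq_quot vertex_equiv_rel}.
HB.instance Definition _ := Choice.on fold_vertex.
Definition fold_edge : Type := {eq_quot edge_equiv_rel}.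
HB.instance Definition _ := Choice.on fold_edge.
Definition fold_cell : Type := {eq_quot cell_equiv_rel}.
HB.instance Definition _ := Choice.on fold_cell.

Definition vertex_class (v : vertex K) : fold_vertex :=
  \pi_{eq_quot vertex_equiv_rel} v.
Definition edge_class (e : edge K) : fold_edge :=
  \pi_{eq_quot edge_equiv_rel} e.
Definition cell_class (c : cell K) : fold_cell :=
  \pi_{eq_quot cell_equiv_rel} c.

Definition folding : complex := @Complex fold_vertex fold_edge fold_cell
  (fun e => vertex_class (init (repr e)))
  (fun e => vertex_class (term (repr e)))
  (fun c => edge_class (top (repr c)))
  (fun c => edge_class (lbot (repr c)))
  (fun c => edge_class (rbot (repr c))).

Lemma vertex_classP v v' :
  vertex_class v = vertex_class v' <-> vertex_eqv v v'.
Proof. by split=> [/eqmodP/asboolP//|?]; apply/eqmodP/asboolP. Qed.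

Lemma edge_classP e e' : edge_class e = edge_class e' <-> edge_eqv e e'.
Proof. by split=> [/eqmodP/asboolP//|?]; apply/eqmodP/asboolP. Qed.

Lemma cell_classP c c' : cell_class c = cell_class c' <-> cell_eqv c c'.
Proof. by split=> [/eqmodP/asboolP//|?]; apply/eqmodP/asboolP. Qed.

Lemma cell_eqv_edge c c' : cell_eqv c c' ->
  [/\ edge_eqv (top c) (top c'), edge_eqv (lbot c) (lbot c')
    & edge_eqv (rbot c) (rbot c')].
Proof.
elim=> {c c'} [c|c c' _ [? ? ?]|c c' c'' _ [? ? ?] _ [? ? ?]|c c' ?|c c' ? ?].
- by split; exact: edge_refl.
- by split; exact: edge_sym.
- by split; apply: edge_trans; eassumption.
- by split=> //; [exact: edge_fold_lbot | exact: edge_fold_rbot].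
- by split=> //; exact: edge_fold_top.
Qed.

Definition fold_morphism : morphism K folding.
Proof.
apply: (@Morphism K folding vertex_class edge_class cell_class).
- move=> e; apply/vertex_classP/vertex_init/edge_classP.
  by rewrite /edge_class reprK.
- move=> e; apply/vertex_classP/vertex_term/edge_classP.
  by rewrite /edge_class reprK.
- move=> c; apply/edge_classP.
  have /cell_eqv_edge[] // : cell_eqv c (repr (cell_class c)).
  by apply/cell_classP; rewrite /cell_class reprK.
- move=> c; apply/edge_classP.
  have /cell_eqv_edge[] // : cell_eqv c (repr (cell_class c)).
  by apply/cell_classP; rewrite /cell_class reprK.
- move=> c; apply/edge_classP.
  have /cell_eqv_edge[] // : cell_eqv c (repr (cell_class c)).
  by apply/cell_classP; rewrite /cell_class reprK.
Defined.

End Folding.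

(* The core of a set D of tree pairs. The diagram of (BLeaf, BLeaf), a single *)
(* edge that is both its top and its bottom edge, is added so that there is a *)
(* distinguished edge even if D is empty.                                     *)
Section Core.
Variable D : set tree_pair.

Definition generators : set tree_pair := (BLeaf, BLeaf) |` D.

Definition gen_diagram (d : set_type generators) : complex := diagram (val d).

Definition core_base : set (edge (union gen_diagram)) :=
  [set e | exists d : set_type generators,
     e = @in_union _ gen_diagram d (top_edge (val d)) \/
     e = @in_union _ gen_diagram d (bottom_edge (val d))].

Definition core : complex := folding core_base.

Lemma trivial_generator : (BLeaf, BLeaf) \in generators.
Proof. by apply/mem_set; left. Qed.

Definition core_edge : edge core :=
  edge_class core_base
    (@in_union _ gen_diagram (exist (fun d => d \in generators) _ trivial_generator)
       (top_edge (BLeaf, BLeaf))).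

End Core.

Definition accepts (K : complex) (p : edge K) (d : tree_pair) : Prop :=
  exists phi : morphism (diagram d) K,
    mor_edge phi (top_edge d) = p /\ mor_edge phi (bottom_edge d) = p.

(* The core of a subgroup H does not depend on the generating set used to     *)
(* build it; the generating set used here is H itself.                        *)
Definition reduced_pairs (R : realType) (S : set (thompsonF R)) :
    set tree_pair :=
  [set d | exists2 f, S f & is_reduced_pair d f].

Definition Cl (R : realType) (H : set (thompsonF R)) : set (thompsonF R) :=
  [set f | exists2 d, is_reduced_pair d f &
     accepts (core_edge (reduced_pairs H)) d].

Definition left_slope (R : realType) (f : R -> R) (a m : R) : Prop :=
  (f x - f a) / (x - a) @[x --> a^'-] --> m.

Definition right_slope (R : realType) (f : R -> R) (a m : R) : Prop :=
  (f x - f a) / (x - a) @[x --> a^'+] --> m.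

(* Main.v *)
Require Import Defs.
From mathcomp Require Import all_boot all_order all_algebra.
From mathcomp Require Import all_classical all_reals all_analysis.
From mathcomp Require Import lra ring zify.

Set Implicit Arguments.
Unset Strict Implicit.
Unset Printing Implicit Defensive.

Import Order.TTheory GRing.Theory Num.Theory.
Import numFieldNormedType.Exports.

Local Open Scope classical_set_scope.
Local Open Scope ring_scope.

(** Words stand for dyadic intervals, called cells; a word is inner if its cell
    does not contain 0 or 1.

    The core of H only knows which cells H can match. Give each edge of the
    diagrams the address of its node. Edges with addresses u and v get
    identified only if, for all long enough w, some element of H maps [uw]
    linearly onto [vw] ([label_eqv]): foldings of top edges are the joining of
    two halves. So if an element of [Cl H] maps [u] linearly onto [v], then H
    does the same up to such a refinement ([Cl_deep_same]). As [F, F] maps any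
    inner cell to any other one ([inner_cells_derived]), condition (1) makes
    the germs of H as transitive as those of F ([Cl_cell_transitive]).
    Condition (2) gives, at one dyadic point and by transitivity at all of
    them, an element of H that is the identity on the left and has slope 2 on
    the right ([right_germ_everywhere]). These two facts imply [F, F] <= H
    ([contains_derived]), as follows.

    Small elements. A commutator of elements of H is trivial near 0 and 1, and
    the germs yield a non-trivial one; its last linear piece attracts points,
    which shows that H compresses any compact subinterval of ]0, 1[ into any
    inner cell ([compress]). Hence every inner cell supports a non-trivial
    element of H ([small_element]).

    Self-similarity. There is an inner word rho such that H maps [rho w]
    linearly onto [rho] for all w, with no refinement ([self_similar_cell]).
    At first this only holds for cells that agree in their last N letters. If N
    cannot be lowered, then H never maps a left half to a right half below rho;
    so an element k of H supported in [rho] maps two halves to two cells that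
    are adjacent and end with 0 and 1, which must be the two halves of one cell.
    Merging the linear pieces of k in this way makes k linear on [rho], thus
    trivial, a contradiction.

    Scales. The same argument applied to the position of cells in the sequence
    shrinking to a dyadic point c from the right shows that H can rescale the
    right side of c at will, without control on the left ([bond_all]).
    With a small element, this gives elements that are the identity on the left
    of c and contract the whole right half ([right_contraction]), and their
    mirror images ([left_contraction]). The latter push [rho] into a
    neighbourhood of c where the germ of condition (2) is the identity
    ([gather_left]); conjugating, one gets elements of H that fix the part of
    [rho] on the left of c and rescale the part on its right by any power
    of 2 ([right_shift]).

    Gluing. An element f of F supported in [rho] then coincides on [rho] with an
    element of H, built from left to right, one linear piece at a time ([glue]).
    Take q in H supported in [rho] which moves a cell z off itself. For f and f'
    supported in z, [f, q] only depends on f on [rho], so that it lies in H, and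
    so does [[f, q], f'] = [f, f'] ([small_commutators]). Compressing, H contains
    all the commutators of elements with support in ]0, 1[, and these generate
    [F, F] ([derived_compact]).

    Conversely, H <= [Cl H] since the diagrams of the elements of H map to the
    core ([sub_Cl]), and [F, F] contains an element with the slopes of
    condition (2) at 1/2 ([derived_right_germ]). *)

(** * Dyadic words and their intervals *)

Section Words.
Variable R : realType.
Implicit Types (u v w x y p q : seq bool).

Notation wv := (word_val R).

Definition wr u : R := word_val R u + 2 ^- size u.

Definition wmid u : R := word_val R (rcons u true).

Definition inner u := (false \in u) && (true \in u).

Lemma wv_cons (b : bool) u : wv (b :: u) = (b%:R + wv u) / 2.
Proof. by []. Qed.

Lemma wr_cons (b : bool) u : wr (b :: u) = (b%:R + wr u) / 2.
Proof. by rewrite /wr wv_cons /= exprS; field; rewrite expf_neq0. Qed.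

Lemma wv_cat u w : wv (u ++ w) = wv u + 2 ^- size u * wv w.
Proof.
elim: u => [|b u IHu]; first by rewrite expr0 invr1 mul1r /= add0r.
by rewrite cat_cons !wv_cons IHu /= exprS; field; rewrite expf_neq0.
Qed.

Lemma wr_cat u w : wr (u ++ w) = wv u + 2 ^- size u * wr w.
Proof.
by rewrite /wr wv_cat size_cat exprD; field; rewrite !expf_neq0.
Qed.

Lemma wv_rcons0 u : wv (rcons u false) = wv u.
Proof. by rewrite -cats1 wv_cat /= addr0 mul0r mulr0 addr0. Qed.

Lemma wmidE u : wmid u = wv u + 2 ^- size u / 2.
Proof. by rewrite /wmid -cats1 wv_cat /= addr0 mul1r. Qed.

Lemma wr_rcons0 u : wr (rcons u false) = wmid u.
Proof. by rewrite /wr wmidE size_rcons exprS wv_rcons0; field; rewrite expf_neq0. Qed.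

Lemma wr_rcons1 u : wr (rcons u true) = wr u.
Proof. by rewrite /wr -/(wmid u) wmidE size_rcons exprS; field; rewrite expf_neq0. Qed.

Lemma wmid_cons (b : bool) u : wmid (b :: u) = (b%:R + wmid u) / 2.
Proof. by rewrite /wmid rcons_cons. Qed.

Lemma wlen_gt0 n : 0 < (2 ^- n : R).
Proof. by rewrite invr_gt0 exprn_gt0. Qed.

Lemma wv_ge0 u : 0 <= wv u.
Proof. by elim: u => // b u IHu; rewrite wv_cons; case: b => /=; lra. Qed.

Lemma wr_le1 u : wr u <= 1.
Proof.
elim: u => [|b u IHu]; first by rewrite /wr /= expr0 invr1 add0r.
by rewrite wr_cons; case: b => /=; lra.
Qed.

Lemma wv_lt_wr u : wv u < wr u.
Proof. by rewrite /wr ltrDl wlen_gt0. Qed.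

Lemma wv_lt_wmid u : wv u < wmid u.
Proof. by rewrite wmidE ltrDl divr_gt0 ?wlen_gt0. Qed.

Lemma wmid_lt_wr u : wmid u < wr u.
Proof. by have := wlen_gt0 (size u); rewrite wmidE /wr; lra. Qed.

Lemma wmid_in01 u : 0 < wmid u < 1.
Proof.
by rewrite (le_lt_trans (wv_ge0 u) (wv_lt_wmid u)) (lt_le_trans (wmid_lt_wr u))// wr_le1.
Qed.

Lemma dyadic_itvE u (t : R) : Defs.dyadic_itv u t <-> wv u <= t <= wr u.
Proof. by []. Qed.

Lemma wv_cat_ge u w : wv u <= wv (u ++ w).
Proof. by rewrite wv_cat lerDl mulr_ge0 ?wv_ge0 // ltW ?wlen_gt0. Qed.

Lemma wr_cat_le u w : wr (u ++ w) <= wr u.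
Proof.
by rewrite wr_cat /wr lerD2l ler_piMr ?wr_le1 // ltW ?wlen_gt0.
Qed.

Lemma wmid_inj u v : wmid u = wmid v -> u = v.
Proof.
have wmid0 : wmid [::] = 1 / 2 by rewrite /wmid /= addr0.
elim: u v => [|a u IHu] [|b v] //.
- rewrite wmid0 wmid_cons => E; have := wmid_in01 v.
  by case: b E => /= E h; exfalso; lra.
- rewrite wmid0 wmid_cons => E; have := wmid_in01 u.
  by case: a E => /= E h; exfalso; lra.
rewrite !wmid_cons => E; have := wmid_in01 u; have := wmid_in01 v.
have [ab|] := eqVneq a b.
  by rewrite ab in E * => _ _; rewrite (IHu v) //; lra.
by case: a b E => -[] //= E _ h h'; exfalso; lra.
Qed.

Lemma wv_inj u v : size u = size v -> wv u = wv v -> u = v.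
Proof.
move=> suv E; apply: wmid_inj; by rewrite !wmidE suv E.
Qed.

Lemma cell_inj u v : wv u = wv v -> wr u = wr v -> u = v.
Proof.
by move=> Ev Er; apply: wmid_inj; move: Er; rewrite !wmidE /wr Ev => /addrI ->.
Qed.

(** Either the left end of a cell is 0, or it is the midpoint of a unique cell
    y; this is how a dyadic point is attached to a word. *)
Lemma word_left_cases u :
  u = nseq (size u) false \/ exists y n, u = y ++ true :: nseq n false.
Proof.
elim/last_ind: u => [|u b [IHu|[y [n IHu]]]]; first by left.
  case: b; first by right; exists u, 0%N; rewrite cats1.
  left; rewrite size_rcons -addn1 nseqD -IHu cats1 //.
right; case: b; first by exists u, 0%N; rewrite cats1.
exists y, n.+1; rewrite IHu -cats1 -catA cat_cons; congr (_ ++ _ :: _).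
by rewrite -addn1 nseqD.
Qed.

Lemma word_right_cases u :
  u = nseq (size u) true \/ exists y n, u = y ++ false :: nseq n true.
Proof.
elim/last_ind: u => [|u b [IHu|[y [n IHu]]]]; first by left.
  case: b; last by right; exists u, 0%N; rewrite cats1.
  left; rewrite size_rcons -addn1 nseqD -IHu cats1 //.
right; case: b; last by exists u, 0%N; rewrite cats1.
exists y, n.+1; rewrite IHu -cats1 -catA cat_cons; congr (_ ++ _ :: _).
by rewrite -addn1 nseqD.
Qed.

Lemma wv_nseq0 n : wv (nseq n false) = 0.
Proof. by elim: n => //= n ->; lra. Qed.

Lemma wr_nseq1 n : wr (nseq n true) = 1.
Proof.
elim: n => [|n IHn]; first by rewrite /wr /= expr0 invr1 add0r.
have -> : nseq n.+1 true = true :: nseq n true by [].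
by rewrite wr_cons IHn /=; lra.
Qed.

Lemma wv_left y n : wv (y ++ true :: nseq n false) = wmid y.
Proof. by rewrite /wmid -cats1 !wv_cat !wv_cons wv_nseq0. Qed.

Lemma wr_right y n : wr (y ++ false :: nseq n true) = wmid y.
Proof. by rewrite wmidE wr_cat wr_cons wr_nseq1 /=; lra. Qed.

Lemma wv_left_inv y v : wv v = wmid y -> exists n, v = y ++ true :: nseq n false.
Proof.
have [->|[z [n ->]]] := word_left_cases v.
  by rewrite wv_nseq0 => E; have := wmid_in01 y; rewrite -E ltxx.
by rewrite wv_left => /wmid_inj ->; exists n.
Qed.

Lemma wr_right_inv y v : wr v = wmid y -> exists n, v = y ++ false :: nseq n true.
Proof.
have [->|[z [n ->]]] := word_right_cases v.
  by rewrite wr_nseq1 => E; have := wmid_in01 y; rewrite -E ltxx andbF.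
by rewrite wr_right => /wmid_inj ->; exists n.
Qed.

Lemma wv0_inv v : wv v = 0 -> v = nseq (size v) false.
Proof.
have [//|[y [n ->]]] := word_left_cases v.
by rewrite wv_left => E; have := wmid_in01 y; rewrite E ltxx.
Qed.

Lemma wr1_inv v : wr v = 1 -> v = nseq (size v) true.
Proof.
have [//|[y [n ->]]] := word_right_cases v.
by rewrite wr_right => E; have := wmid_in01 y; rewrite E ltxx andbF.
Qed.

(** Cells are nested or have disjoint interiors. *)
Lemma sub_cell u v : wv u <= wv v -> wr v <= wr u -> exists w, v = u ++ w.
Proof.
elim: u v => [|a u IHu] v; first by exists v.
case: v => [|b v].
  have -> : wr [::] = 1 by rewrite /wr /= expr0 invr1 add0r.
  move=> Ev Er; have Er1 := wr_le1 (a :: u); have Ev0 := wv_ge0 (a :: u).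
  have : wv (a :: u) = 0 by move: Ev => /=; move: Ev0 => /=; lra.
  have : wr (a :: u) = 1 by lra.
  rewrite wr_cons wv_cons; have := wv_lt_wr u; have := wr_le1 u; have := wv_ge0 u.
  by case: a {Ev Er Er1 Ev0} => /= *; exfalso; lra.
rewrite !wv_cons !wr_cons => Ev Er.
have [ab|ab] := eqVneq a b.
  rewrite ab in Ev Er *; have [||w ->] := IHu v; [lra|lra|by exists w].
have := wv_lt_wr u; have := wv_lt_wr v; have := wr_le1 u; have := wv_ge0 u.
have := wr_le1 v; have := wv_ge0 v.
by case: a b ab Ev Er => -[] //= _ *; exfalso; lra.
Qed.

Lemma inner_cat u w : inner u -> inner (u ++ w).
Proof. by rewrite /inner !mem_cat => /andP[-> ->]. Qed.

Lemma inner_catr u w : inner w -> inner (u ++ w).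
Proof. by rewrite /inner !mem_cat => /andP[-> ->]; rewrite !orbT. Qed.

Lemma inner_of u : 0 < wv u -> wr u < 1 -> inner u.
Proof.
move=> u0 u1; apply/andP; split; apply/negPn/negP => b_u.
  have E : u = nseq (size u) true.
    by apply/all_pred1P/allP => -[] //= bu; move: b_u; rewrite bu.
  by move: u1; rewrite E wr_nseq1 ltxx.
have E : u = nseq (size u) false.
  by apply/all_pred1P/allP => -[] //= bu; move: b_u; rewrite bu.
by move: u0; rewrite E wv_nseq0 ltxx.
Qed.

Lemma word_of_nat s (k : nat) : (k < 2 ^ s)%N ->
  exists2 v, size v = s & wv v = k%:R / 2 ^+ s.
Proof.
elim: s k => [|s IHs] k; first by rewrite expn0 ltnS leqn0 => /eqP->; exists [::]; rewrite ?mul0r.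
move=> ks; have [ks'|ks'] := ltnP k (2 ^ s).
  have [v sv Ev] := IHs k ks'; exists (false :: v); first by rewrite /= sv.
  by rewrite wv_cons Ev exprS /=; field; rewrite expf_neq0.
have [|v sv Ev] := IHs (k - 2 ^ s)%N; first by move: ks; rewrite expnS; lia.
exists (true :: v); first by rewrite /= sv.
by rewrite wv_cons Ev exprS natrB // natrX /=; field; rewrite expf_neq0.
Qed.

Definition deep (P : seq bool -> Prop) u :=
  exists N, forall w, (N <= size w)%N -> P (u ++ w).

Lemma deep_split P u : deep P (rcons u false) -> deep P (rcons u true) -> deep P u.
Proof.
move=> [N PN] [M PM]; exists (maxn N M).+1 => -[|b w] //.
rewrite /= ltnS geq_max => /andP[Nw Mw].
by rewrite -cat_rcons; case: b; [apply: PM|apply: PN].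
Qed.

(** Subdivide until P holds, then merge halves back: since elements of F are
    linear on all long words, this is how they are treated below. *)
Lemma deep_ind (P : seq bool -> Prop) u : deep P u ->
  (forall w, P (rcons (u ++ w) false) -> P (rcons (u ++ w) true) -> P (u ++ w)) ->
  P u.
Proof.
move=> [N PN] step; rewrite -[u]cats0.
have [n] := ubnP (N - size (Nil bool)).
elim: n [::] => // n IHn w le_n.
have [/PN//|ltN] := leqP N (size w).
apply: step; rewrite rcons_cat; apply: IHn; rewrite size_rcons; lia.
Qed.

End Words.
Arguments wr {R}.
Arguments wmid {R}.


(** * Linear pieces of elements of F *)

Section Linear.
Variable R : realType.
Implicit Types (u v w y p q : seq bool) (f g h : thompsonF R) (x t : R).

Notation wv := (word_val R).
Notation L f u v := (maps_linearly (thompson_fun f) u v).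
Notation F := (thompsonF R).

Lemma thompson_mulEx f g x : thompson_fun (f * g)%g x = f (g x).
Proof. by []. Qed.

Lemma thompson_invK f x : thompson_fun f^-1%g (f x) = x.
Proof. by rewrite -thompson_mulEx mulVg. Qed.

Lemma thompson_invVK f x : f (thompson_fun f^-1%g x) = x.
Proof. by rewrite -thompson_mulEx mulgV. Qed.

Lemma thompson_eqP f g : (forall x, f x = g x) -> f = g.
Proof. by move=> fg; apply: val_inj; apply/funext. Qed.

Lemma thompson_out f x : x <= 0 \/ 1 <= x -> f x = x.
Proof.
have [x01|/negP x01] := boolP (0 <= x <= 1).
  move=> [x0|x1].
    have -> : x = 0 by move: x01; lra.
    exact: is_thompson0 (thompsonP f).
  have -> : x = 1 by move: x01; lra.
  exact: is_thompson1 (thompsonP f).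
by move=> _; case: (thompsonP f) => ->.
Qed.

Lemma thompson_homo f : {homo f : x y / x < y}.
Proof.
move=> a b ab; have ft := thompsonP f; case: (ft) => fid finc _ _.
have [a0|a0] := leP a 0; last first.
  have [b1|b1] := leP b 1; first by apply: finc => //; exact: ltW.
  rewrite (thompson_out f (x := b)); last by right; exact: ltW.
  have [a1|a1] := leP a 1; last by rewrite (thompson_out f (x := a)) //; right; exact: ltW.
  have /andP[_ fa] : 0 <= f a <= 1 by apply: is_thompson_in01; rewrite // a1 ltW.
  exact: le_lt_trans b1.
rewrite (thompson_out f (x := a)); last by left.
have [b0|b0] := leP b 0; first by rewrite (thompson_out f (x := b)) //; left.
have [b1|b1] := leP b 1; last by rewrite (thompson_out f (x := b)) //; right; exact: ltW.
by apply: le_lt_trans a0 _; rewrite -[X in X < _](is_thompson0 ft) finc.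
Qed.

Lemma thompson_le f : {mono f : x y / x <= y}.
Proof. exact/le_mono/thompson_homo. Qed.

Lemma thompson_lt f : {mono f : x y / x < y}.
Proof. exact/leW_mono/thompson_le. Qed.

Lemma thompson_inv_le f x t : (thompson_fun f^-1%g x <= t) = (x <= f t).
Proof. by rewrite -(thompson_le f) thompson_invVK. Qed.

Lemma thompson_inv_ge f x t : (x <= thompson_fun f^-1%g t) = (f x <= t).
Proof. by rewrite -(thompson_le f) thompson_invVK. Qed.

Lemma thompson_inv_lt f x t : (thompson_fun f^-1%g x < t) = (x < f t).
Proof. by rewrite -(thompson_lt f) thompson_invVK. Qed.

Lemma thompson_inv_gt f x t : (x < thompson_fun f^-1%g t) = (f x < t).
Proof. by rewrite -(thompson_lt f) thompson_invVK. Qed.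

Lemma thompson_inj f : injective f.
Proof. exact: is_thompson_inj (thompsonP f). Qed.

Lemma expr2_neq0 n : 2 ^+ n != 0 :> R.
Proof. by rewrite expf_neq0. Qed.

Lemma L_wv f u v : L f u v -> f (wv u) = wv v.
Proof.
move=> fuv; rewrite fuv ?subrr ?mulr0 ?addr0 //.
by apply/dyadic_itvE; rewrite lexx ltW ?wv_lt_wr.
Qed.

Lemma L_wr f u v : L f u v -> f (wr u) = wr v.
Proof.
move=> fuv; rewrite fuv; last by apply/dyadic_itvE; rewrite lexx ltW ?wv_lt_wr.
by rewrite /wr; field; rewrite !expr2_neq0.
Qed.

Lemma L_cat f u v w : L f u v -> L f (u ++ w) (v ++ w).
Proof.
move=> fuv x /dyadic_itvE /andP[ux xu]; rewrite fuv.
  by rewrite !wv_cat !size_cat !exprD; field; rewrite !expr2_neq0.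
by apply/dyadic_itvE; rewrite (le_trans (wv_cat_ge _ u w))// (le_trans xu)// wr_cat_le.
Qed.

Lemma L_rcons f u v b : L f u v -> L f (rcons u b) (rcons v b).
Proof. by rewrite -!cats1; exact: L_cat. Qed.

Lemma L_wmid f u v : L f u v -> f (wmid u) = wmid v.
Proof. by move=> /(@L_rcons _ _ _ true)/L_wv. Qed.

Lemma L_id u : L (1%g : F) u u.
Proof.
by move=> x _; rewrite divff ?expr2_neq0 // mul1r addrC subrK.
Qed.

Lemma L_itv f u v x : L f u v -> wv u <= x <= wr u -> wv v <= f x <= wr v.
Proof. by move=> fuv; rewrite -(L_wv fuv) -(L_wr fuv) !thompson_le. Qed.

Lemma L_mul f g u v w : L f v w -> L g u v -> L (f * g)%g u w.
Proof.
move=> fvw guv x ux; rewrite thompson_mulEx fvw; last exact: L_itv guv _.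
by rewrite guv //; field; rewrite !expr2_neq0.
Qed.

Lemma L_inv f u v : L f u v -> L f^-1%g v u.
Proof.
move=> fuv x vx.
have ux : wv u <= thompson_fun f^-1%g x <= wr u.
  by rewrite thompson_inv_ge thompson_inv_le (L_wv fuv) (L_wr fuv).
have := fuv _ ux; rewrite thompson_invVK => {2}->.
by field; rewrite !expr2_neq0.
Qed.

Lemma L_join f u v :
  L f (rcons u false) (rcons v false) -> L f (rcons u true) (rcons v true) ->
  L f u v.
Proof.
move=> f0 f1 x /dyadic_itvE /andP[ux xu].
have [xm|mx] := leP x (wmid u).
  rewrite f0; last by apply/dyadic_itvE; rewrite wv_rcons0 wr_rcons0 ux.
  by rewrite !wv_rcons0 !size_rcons !exprS; field; rewrite !expr2_neq0.
rewrite f1; last by apply/dyadic_itvE; rewrite wr_rcons1 xu ltW.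
by rewrite -!/(wmid _) !wmidE !size_rcons !exprS; field; rewrite !expr2_neq0.
Qed.

Lemma L_fun f u v v' : L f u v -> L f u v' -> v = v'.
Proof.
move=> fv fv'; apply: (@cell_inj R).
  by rewrite -(L_wv fv) (L_wv fv').
by rewrite -(L_wr fv) (L_wr fv').
Qed.

Lemma L_fixP f u : L f u u <-> forall x, wv u <= x <= wr u -> f x = x.
Proof.
split=> [fu x ux|fu x /fu ->]; last by rewrite divff ?expr2_neq0 // mul1r addrC subrK.
by rewrite fu // divff ?expr2_neq0 // mul1r addrC subrK.
Qed.

(** A dyadic point of level n is not interior to a cell of level n or more. *)
Lemma wmid_interior u y : wv u < wmid y < (wr u : R) -> (size u <= size y)%N.
Proof.
elim: u y => // a u IHu [|b y].
  have -> : wmid [::] = 1 / 2 :> R by rewrite /wmid /= addr0.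
  rewrite wv_cons wr_cons; have := wr_le1 R u; have := wv_ge0 R u.
  by case: a => /= h1 h2 h3; exfalso; lra.
rewrite wmid_cons wv_cons wr_cons /= ltnS => h; apply: IHu.
have := wmid_in01 R y; have := wr_le1 R u; have := wv_ge0 R u.
by case: a h; case: b => /= h h1 h2 h3; lra.
Qed.

Lemma wv_nat w : exists j : nat, wv w = j%:R / 2 ^+ size w.
Proof.
elim: w => [|b w [j IHw]]; first by exists 0%N; rewrite mul0r.
exists (b * 2 ^ size w + j)%N; rewrite wv_cons IHw natrD natrM natrX exprS.
by field; rewrite expr2_neq0.
Qed.

Lemma dyadic01_wmid x : dyadic01 x -> exists y, x = wmid y.
Proof.
move=> [[k [n ->]]] /andP[x0 x1].
have k0 : 0 < k by move: x0; rewrite pmulr_lgt0 ?invr_gt0 ?exprn_gt0 // ltr0z.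
case: k k0 x0 x1 => // k k0 x0 x1.
have [|v sv Ev] := @word_of_nat R n k.
  by move: x1; rewrite ltr_pdivrMr ?exprn_gt0 // mul1r -natrX ltr_nat.
have [E|[y [m E]]] := word_left_cases v.
  by move: x0; rewrite -Ev E wv_nseq0 ltxx.
by exists y; rewrite -Ev E wv_left.
Qed.

Lemma wmid_dyadic01 y : dyadic01 (wmid y : R).
Proof.
split; last exact: wmid_in01.
by have [j Ej] := wv_nat (rcons y true); exists j%:Z, (size (rcons y true)).
Qed.

(** A cell that is long enough contains no breakpoint in its interior. On it, f is
    [x => 2 ^ m * x + d] with d dyadic, so that all its long subcells are mapped
    onto intervals [[K / 2 ^ s, (K + 1) / 2 ^ s]]. *)
Lemma thompson_deep f u : deep (fun u => exists v, L f u v) u.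
Proof.
suff deep0 : deep (fun u => exists v, L f u v) [::].
  by have [N PN] := deep0; exists N => w Nw; apply: (PN (u ++ w)); rewrite size_cat; lia.
have ft := thompsonP f; case: (ft) => _ _ _ [B Bd Baff].
have [N0 N0P] : exists N, forall c, c \in B -> forall u, (N <= size u)%N ->
    ~ (wv u < c < wr u).
  elim: B Bd {Baff} => [|c B IHB] Bd; first by exists 0%N.
  have [|N NP] := IHB; first by move=> c' c'B; apply: Bd; rewrite inE c'B orbT.
  have [y cy] := dyadic01_wmid (Bd _ (mem_head _ _)).
  exists (maxn N (size y).+1) => c'; rewrite inE => /predU1P[->|/NP h] w; rewrite geq_max => /andP[Nw yw].
    by rewrite cy => /wmid_interior; rewrite leqNgt yw.
  exact: h.
apply: (@deep_ind (deep (fun u => exists v, L f u v))); last first.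
  by move=> w; exact: deep_split.
exists N0 => u0; rewrite cat0s => Nu.
have [m fm] : exists m : int, forall x, wv u0 <= x <= wr u0 -> f x = f (wv u0) + 2 ^ m * (x - wv u0).
  apply: Baff; [exact: wv_ge0|exact: wv_lt_wr|exact: wr_le1|].
  by move=> c cB; exact: N0P.
have [k [n fk]] : dyadic (f (wv u0)).
  apply: dyadic_fun => //; first by rewrite wv_ge0 (le_trans (ltW (wv_lt_wr R u0))) ?wr_le1.
  by have [j Ej] := wv_nat u0; exists j%:Z, (size u0).
(* this depth makes s at least the level n of f (wv u0) *)
exists (n + `|m|)%N => w Nw.
pose s := `|(size u0 + size w)%:Z - m|%N.
have sE : s%:Z = (size u0 + size w)%:Z - m by rewrite /s; lia.
have ns : (n <= s)%N by lia.
have mE : 2 ^ m = 2 ^+ size u0 * 2 ^+ size w / 2 ^+ s :> R.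
  have -> : m = (size u0 + size w)%:Z - s%:Z by lia.
  by rewrite expfzDr // -exprnN -exprnP exprD.
have [j Ej] := wv_nat w.
have uw_in x : wv (u0 ++ w) <= x <= wr (u0 ++ w) -> wv u0 <= x <= wr u0.
  by move=> /andP[h1 h2]; rewrite (le_trans (wv_cat_ge _ u0 w))// (le_trans h2)// wr_cat_le.
have uwlt := wv_lt_wr R (u0 ++ w).
pose K : int := k * 2 ^+ (s - n) + j%:Z.
have fE : f (wv (u0 ++ w)) = K%:~R / 2 ^+ s.
  rewrite fm; last by apply: uw_in; rewrite lexx ltW.
  rewrite fk mE wv_cat Ej /K rmorphD rmorphM /= rmorphXn /=.
  have -> : 2 ^+ s = 2 ^+ (s - n) * 2 ^+ n :> R by rewrite -exprD subnK.
  by rewrite -pmulrn; field; rewrite !expr2_neq0.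
clearbody K.
have fE' : f (wr (u0 ++ w)) = (K + 1)%:~R / 2 ^+ s.
  have -> : f (wr (u0 ++ w)) = f (wv (u0 ++ w)) + 2 ^ m * 2 ^- size (u0 ++ w).
    rewrite (fm (wr _)); last by apply: uw_in; rewrite lexx ltW.
    rewrite (fm (wv (u0 ++ w))); last by apply: uw_in; rewrite lexx ltW.
    by rewrite /wr; ring.
  rewrite fE mE size_cat exprD intrD.
  by field; rewrite !expr2_neq0.
have K0 : 0 <= K.
  have : 0 <= f (wv (u0 ++ w)) by rewrite -(is_thompson0 ft) thompson_le wv_ge0.
  by rewrite fE pmulr_lge0 ?invr_gt0 ?exprn_gt0 // ler0z.
have K1 : K + 1 <= (2 ^ s)%N.
  have : f (wr (u0 ++ w)) <= 1 by rewrite -(is_thompson1 ft) thompson_le wr_le1.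
  by rewrite fE' ler_pdivrMr ?exprn_gt0 // mul1r -natrX -(ler_int R).
case: (K) K0 K1 fE => // K' _ K1 fE.
have [|v sv Ev] := @word_of_nat R s K'; first by move: K1; lia.
exists v => x /uw_in xin.
have fwv : f (wv (u0 ++ w)) = wv v by rewrite fE Ev.
rewrite -fwv (fm x) // (fm (wv (u0 ++ w))); last by apply: uw_in; rewrite lexx ltW.
by rewrite mE sv size_cat exprD; field; rewrite !expr2_neq0.
Qed.

End Linear.


(** * Reflection of the unit interval; first linear pieces *)

Section Flip.
Variable R : realType.
Implicit Types (u v w y p q : seq bool) (f g h : thompsonF R) (x t : R).

Notation wv := (word_val R).
Notation L f u v := (maps_linearly (thompson_fun f) u v).
Notation F := (thompsonF R).

Lemma is_thompson_flip (f : R -> R) : is_thompson f -> is_thompson (fun x => 1 - f (1 - x)).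
Proof.
move=> ft; case: (ft) => fid finc fim [B Bd Baff]; split.
- by move=> x x01; rewrite fid; [ring|move=> h; apply: x01; lra].
- by move=> x y x0 xy y1; rewrite ltrD2l ltrN2; apply: finc; lra.
- apply/seteqP; split=> [_ [x /= + <-]|x /=]; rewrite !in_itv /= => x01.
    have := @is_thompson_in01 _ f (1 - x) ft; lra.
  have [|z z01 fz] := @is_thompson_pre _ f (1 - x) ft; first lra.
  by exists (1 - z); rewrite /= ?in_itv /= ?subKr ?fz ?subKr //; lra.
exists (map (fun c => 1 - c) B) => [_ /mapP[c /Bd [dc c01] ->]|a b a0 ab b1 noB].
  split; last lra.
  by apply: dyadicD; [exists 1, 0%N; rewrite expr0 divr1|exact: dyadicN].
have h0 : 0 <= 1 - b by lra.
have h1 : 1 - b < 1 - a by lra.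
have h2 : 1 - a <= 1 by lra.
have [c cB cab|m fm] := Baff _ _ h0 h1 h2.
  by apply: (noB (1 - c)); [exact: map_f|lra].
exists m => x axb; rewrite fm; last lra.
by rewrite (fm (1 - a)); [ring|lra].
Qed.

(** Conjugation by [x => 1 - x]; it transfers statements about the right of a
    point to its left. *)
Definition flip f : F := thompson_of (is_thompson_flip (thompsonP f)).

Lemma flipE f x : flip f x = 1 - f (1 - x).
Proof. by []. Qed.

Lemma flipK : involutive flip.
Proof. by move=> f; apply: thompson_eqP => x; rewrite !flipE !subKr. Qed.

Lemma flip_mul f g : flip (f * g)%g = (flip f * flip g)%g.
Proof. by apply: thompson_eqP => x; rewrite thompson_mulEx !flipE subKr. Qed.

Lemma flip1 : flip 1%g = 1%g.
Proof. by apply: thompson_eqP => x; rewrite flipE subKr. Qed.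

Lemma flip_inv f : flip f^-1%g = (flip f)^-1%g.
Proof. by apply: (mulgI (flip f)); rewrite mulgV -flip_mul mulgV flip1. Qed.

Definition mirror u := map negb u.

Lemma mirrorK : involutive mirror.
Proof. exact/mapK/negbK. Qed.

Lemma mirror_cat u w : mirror (u ++ w) = mirror u ++ mirror w.
Proof. exact: map_cat. Qed.

Lemma mirror_nseq n b : mirror (nseq n b) = nseq n (~~ b).
Proof. exact: map_nseq. Qed.

Lemma size_mirror u : size (mirror u) = size u.
Proof. exact: size_map. Qed.

Lemma wv_mirror u : wv (mirror u) = 1 - wr u.
Proof.
elim: u => [|b u IHu]; first by rewrite /wr /= expr0 invr1 add0r subrr.
by rewrite wr_cons [mirror _]/= wv_cons -/(mirror u) IHu; case: b => /=; lra.
Qed.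

Lemma wr_mirror u : wr (mirror u) = 1 - wv u.
Proof. by rewrite -{2}(mirrorK u) wv_mirror; lra. Qed.

Lemma wmid_mirror u : wmid (mirror u) = 1 - wmid u :> R.
Proof. by rewrite !wmidE wv_mirror size_mirror /wr; lra. Qed.

Lemma inner_mirror u : inner (mirror u) = inner u.
Proof.
have h b v : (b \in mirror v) = (~~ b \in v) by rewrite -{1}[b]negbK mem_map //; exact: negb_inj.
by rewrite /inner !h andbC.
Qed.

Lemma L_mirror f u v : L f u v -> L (flip f) (mirror u) (mirror v).
Proof.
move=> fuv x /dyadic_itvE; rewrite wv_mirror wr_mirror => ux.
rewrite flipE fuv; last by apply/dyadic_itvE; lra.
rewrite wv_mirror !size_mirror /wr.
by field; rewrite !expr2_neq0.
Qed.

End Flip.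

Section Pieces.
Variable R : realType.
Implicit Types (u v w y p q : seq bool) (f g h : thompsonF R) (x t : R).

Notation wv := (word_val R).
Notation L f u v := (maps_linearly (thompson_fun f) u v).

Definition supp_in (a b : R) f := forall x, x <= a \/ b <= x -> f x = x.

(** As f fixes the left end of [u], it maps the first cell on which it is linear
    to a cell with the same left end; if these are equal, go on to the next. *)
Lemma first_piece f u : f (wv u) = wv u ->
  L f u u \/ exists w v, [/\ L f (u ++ w) v, wv v = wv (u ++ w), u ++ w <> v &
    forall x, wv u <= x <= wv (u ++ w) -> f x = x].
Proof.
pose P u := f (wv u) = wv u ->
  L f u u \/ exists w v, [/\ L f (u ++ w) v, wv v = wv (u ++ w), u ++ w <> v &
    forall x, wv u <= x <= wv (u ++ w) -> f x = x].
apply: (@deep_ind P) => [|{}u'].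
  have [N PN] := thompson_deep f u; exists N => w /PN[v fv] fw.
  have [E|uv] := eqVneq (u ++ w) v; first by left; rewrite {2}E.
  right; exists [::], v; rewrite cats0 -(L_wv fv) fw.
  by split => // [|x]; [apply/eqP|move=> /le_anti <-].
set u1 := u ++ u' => P0 P1 fu.
case: P0 => [|f0|[w [v [fv Ev ne fid]]]]; first by rewrite wv_rcons0.
  case: P1 => [|f1|[w [v [fv Ev ne fid]]]]; first by move/L_wr: f0; rewrite wr_rcons0.
    by left; exact: L_join.
  right; exists (true :: w), v; rewrite -cat_rcons; split => // x /andP[ux xu].
  have [xm|mx] := leP x (wmid u1).
    by apply: (L_fixP f (rcons u1 false)).1; rewrite // wv_rcons0 wr_rcons0 ux.
  by apply: fid; rewrite xu ltW.
right; exists (false :: w), v; rewrite -cat_rcons; split => // x ux.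
by apply: fid; rewrite wv_rcons0.
Qed.

Lemma L_fix_cell f u v : L f u v -> f (wv u) = wv u -> f (wr u) = wr u -> u = v.
Proof.
by move=> fuv Ev Er; apply: (@cell_inj R); rewrite -?(L_wv fuv) -?(L_wr fuv).
Qed.

(** The images v and v' of two halves are adjacent cells; a left half and a right
    half that are adjacent belong to the same cell, so f is linear on the union. *)
Lemma linear_of_siblings f u :
  (forall w v v', L f (rcons (u ++ w) false) v -> L f (rcons (u ++ w) true) v' ->
     exists q q', v = rcons q false /\ v' = rcons q' true) ->
  exists v, L f u v.
Proof.
move=> sib; apply: (@deep_ind (fun u => exists v, L f u v)); first exact: thompson_deep.
move=> w [v f0] [v' f1]; have [q [q' [vE v'E]]] := sib _ _ _ f0 f1.
move: f0 f1; rewrite vE v'E => f0 f1; exists q; apply: L_join => //.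
have := L_wr f0; have := L_wv f1; rewrite wr_rcons0 -/(wmid (u ++ w)) => ->.
by rewrite wr_rcons0 => /wmid_inj <-.
Qed.

End Pieces.


(** * Subgroups *)

Section SubgroupLattice.
Variable G : groupType.
Implicit Types (K : set G) (x y z g : G).

Lemma subgroup_intro K : K 1%g ->
  (forall x y, K x -> K y -> K (x * y)%g) -> (forall x, K x -> K x^-1%g) -> is_subgroup K.
Proof.
move=> K1 KM KV; split; first exact/mem_set.
by move=> f g /set_mem Kf /set_mem Kg; apply/mem_set; exact/KM/KV.
Qed.

Lemma subgroup1 K : is_subgroup K -> K 1%g.
Proof. by case=> /set_mem. Qed.

Lemma subgroupM K x y : is_subgroup K -> K x -> K y -> K (x * y)%g.
Proof. by move=> sgK Kx Ky; apply/set_mem/(group_closedM sgK); apply/mem_set. Qed.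

Lemma subgroupV K x : is_subgroup K -> K x -> K x^-1%g.
Proof. by move=> sgK Kx; apply/set_mem/(group_closedV sgK); apply/mem_set. Qed.

Lemma subgroupX K (sgK : is_subgroup K) x n : K x -> K (x ^+ n)%g.
Proof.
by move=> Kx; elim: n => [|n IHn]; rewrite ?expg0 ?expgS; [exact: subgroup1|exact: subgroupM].
Qed.

Lemma smallest_subgroup (X : set G) : is_subgroup (smallest (@is_subgroup G) X).
Proof.
apply: subgroup_intro => [K [sgK _]|x y Kx Ky K [sgK XK]|x Kx K [sgK XK]].
- exact: subgroup1.
- by apply: subgroupM => //; [exact: Kx|exact: Ky].
- by apply: subgroupV => //; exact: Kx.
Qed.

Lemma smallest_normal (X : set G) : (forall z g, X z -> X (z ^ g)%g) ->
  forall z g, smallest (@is_subgroup G) X z -> smallest (@is_subgroup G) X (z ^ g)%g.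
Proof.
move=> Xn z g; pose S := smallest (@is_subgroup G) X; pose T := [set y | S (y ^ g)%g].
suff ST : S `<=` T by exact: ST.
apply: smallest_sub => [|y Xy]; last by apply: sub_gen_smallest; exact: Xn.
have sgS := smallest_subgroup X.
apply: subgroup_intro => [|x y|x]; rewrite /T /=.
- by rewrite conj1g; exact: subgroup1.
- by rewrite conjMg; exact: subgroupM.
- by rewrite conjVg; exact: subgroupV.
Qed.

(** This is the centralizer of x modulo K; it reduces the proof that [x, y] lies
    in K for all y to generators y. *)
Lemma centralizer_mod_subgroup K x : is_subgroup K ->
  (forall z g, K z -> K (z ^ g)%g) -> is_subgroup [set y | K [~ x, y]%g].
Proof.
move=> sgK nK; apply: subgroup_intro => [|y z /= Ky Kz|y /= Ky] /=.
- by rewrite commg1; exact: subgroup1.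
- have -> : [~ x, y * z]%g = ([~ x, z] * [~ x, y] ^ z)%g.
    by rewrite /commg /conjg !invgM !mulgA !mulgK.
  by apply: subgroupM => //; exact: nK.
have -> : [~ x, y^-1]%g = ([~ x, y]^-1 ^ y^-1)%g.
  by rewrite invgR /commg /conjg !invgK !mulgA mulgV mul1g.
by apply: nK; exact: subgroupV.
Qed.

End SubgroupLattice.



(** * Attraction and compression *)

Section Reals.
Variable R : realType.

Lemma exists_half_pow_lt (e : R) : 0 < e -> exists n, 2 ^- n < e.
Proof.
move=> e0; pose n := (Num.trunc e^-1).+1; exists n.
rewrite invf_plt ?posrE ?exprn_gt0 //.
apply: lt_le_trans (truncnS_gt _) _.
by rewrite -natrX ler_nat ltnW // ltn_expl.
Qed.

(** The supremum s of the points reached from a is reached, by the local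
    hypothesis at s, and so is a point beyond s if s < b. *)
Lemma interval_chain (E : R -> R -> Prop) (a b : R) : a <= b ->
  (forall t, E t t) -> (forall r s t, r <= s -> s <= t -> E r s -> E s t -> E r t) ->
  (forall t, a <= t <= b -> exists2 e, 0 < e &
     forall r s, t - e < r -> r <= s -> s < t + e -> E r s) ->
  E a b.
Proof.
move=> ab Er Et Eloc; pose S := [set t : R | a <= t <= b /\ E a t].
have Sa : S a by split; rewrite ?lexx.
have Sb : ubound S b by move=> t [/andP[]].
have hsS : has_sup S by split; [exists a|exists b].
pose s := sup S.
have hubS : has_ubound S by exists b.
have as_ : a <= s by exact: ub_le_sup hubS _ Sa.
have sb : s <= b by apply: ge_sup; first by exists a.
have [|e e0 loc] := Eloc s; first by rewrite as_.
have [t [/andP[at_ tb] Eat] st] := sup_adherent e0 hsS.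
have ts : t <= s by apply: (ub_le_sup hubS); split; rewrite ?at_.
pose t' := Num.min b (s + e / 2).
have st' : s <= t' by rewrite /t' le_min sb /=; lra.
have t'e : t' < s + e by rewrite /t' gt_min; apply/orP; right; lra.
have Eat' : E a t' by apply: (Et _ t) => //; [exact: le_trans st'|apply: loc => //; exact: le_trans st'].
have : t' <= s.
  apply: (ub_le_sup hubS).
  by split=> //; rewrite (le_trans as_ st') /t' ge_min lexx.
rewrite /t' ge_min => /orP[bs|]; last by move=> h; exfalso; lra.
by move: Eat'; rewrite /t' min_l //; lra.
Qed.

Lemma cell_of n (x : R) : 0 <= x <= 1 -> exists2 u, size u = n & word_val R u <= x <= wr u.
Proof.
elim: n x => [|n IHn] x x01.
  by exists [::] => //; rewrite /wr /= expr0 invr1 add0r.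
have [x2|x2] := leP x (1 / 2).
  have [|u su ux] := IHn (2 * x); first lra.
  by exists (false :: u); rewrite /= ?su // wr_cons /=; lra.
have [|u su ux] := IHn (2 * x - 1); first lra.
by exists (true :: u); rewrite /= ?su // wr_cons /=; lra.
Qed.

Lemma inner_cell_of (x : R) : 0 < x < 1 ->
  exists n, forall u, (n <= size u)%N -> word_val R u <= x <= wr u -> inner u.
Proof.
move=> x01; have [|n nP] := @exists_half_pow_lt (Num.min x (1 - x)); first by rewrite lt_min; lra.
move: nP; rewrite lt_min => /andP[nx nx'].
exists n => u nu ux; have un : 2 ^- size u <= 2 ^- n :> R.
  by rewrite lef_pV2 ?posrE ?exprn_gt0 // ler_weXn2l // ler1n.
by apply: (@inner_of R); rewrite /wr in ux *; lra.
Qed.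

End Reals.

Section Group.
Variable R : realType.
Implicit Types (u v w y p q c : seq bool) (f g h k : thompsonF R) (x t : R).

Notation wv := (word_val R).
Notation L f u v := (maps_linearly (thompson_fun f) u v).

Variable H : set (thompsonF R).
Hypothesis sgH : is_subgroup H.

Definition same_cell u v := exists2 h, H h & L h u v.

Lemma same_refl u : same_cell u u.
Proof. by exists 1%g; [exact: subgroup1|exact: L_id]. Qed.

Lemma same_sym u v : same_cell u v -> same_cell v u.
Proof. by move=> [h Hh huv]; exists h^-1%g; [exact: subgroupV|exact: L_inv]. Qed.

Lemma same_trans v u w : same_cell u v -> same_cell v w -> same_cell u w.
Proof.
by move=> [h Hh huv] [g Hg gvw]; exists (g * h)%g; [exact: subgroupM|exact: L_mul gvw huv].
Qed.

Lemma same_cat u v w : same_cell u v -> same_cell (u ++ w) (v ++ w).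
Proof. by move=> [h Hh huv]; exists h => //; exact: L_cat. Qed.

(** Unlike [same_cell], this relation passes from the two halves of a cell to the
    cell, as is needed for foldings. *)
Definition deep_same u v :=
  exists N, forall w, (N <= size w)%N -> same_cell (u ++ w) (v ++ w).

(** The group F has this property with w empty. The refinement is unavoidable
    here: it is all that a core can see. *)
Definition cell_transitive := forall u v, inner u -> inner v -> deep_same u v.

Hypothesis ctH : cell_transitive.

(** The cell c01 lies in the interior of c, whence the strict inequalities. *)
Lemma move_into x c : 0 < x < 1 -> inner c -> exists2 g, H g & wv c < g x < wr c.
Proof.
move=> x01 ic; have [n nP] := inner_cell_of x01.
have [|u su ux] := @cell_of R n x; first lra.
have iu : inner u by apply: nP; rewrite ?su.
have [N NP] := ctH iu (inner_cat [:: false; true] ic).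
have u0 := wlen_gt0 R (size u).
pose x' := 2 ^+ size u * (x - wv u).
have xE : x = wv u + 2 ^- size u * x' by rewrite /x' mulrA mulVf ?expr2_neq0 // mul1r; ring.
have [|w sw wx'] := @cell_of R N x'.
  rewrite /wr in ux; apply/andP; split; rewrite -(ler_pM2l u0); lra.
have [|g Hg gw] := NP w; first by rewrite sw.
exists g => //; have xw : wv (u ++ w) <= x <= wr (u ++ w).
  by rewrite wv_cat wr_cat xE !lerD2l !(ler_pM2l u0).
have := L_itv gw xw; have := wv_cat_ge R (c ++ [:: false; true]) w.
have := wr_cat_le R (c ++ [:: false; true]) w.
rewrite (wv_cat _ c) (wr_cat _ c) /wr /= !exprS expr0.
have := wlen_gt0 R (size c); lra.
Qed.

Definition compresses c a b := exists g, [/\ H g, wv c < g a & g b < wr c].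

Lemma compresses_sub c a b a' b' : a <= a' -> b' <= b -> compresses c a b -> compresses c a' b'.
Proof.
move=> aa' bb' [g [Hg ga gb]]; exists g; split => //.
  by apply: lt_le_trans ga _; rewrite thompson_le.
by apply: le_lt_trans gb; rewrite thompson_le.
Qed.

Lemma compresses_move c h a b : H h -> compresses c (h a) (h b) <-> compresses c a b.
Proof.
move=> Hh; split=> [[g [Hg ga gb]]|[g [Hg ga gb]]].
  by exists (g * h)%g; split; first exact: subgroupM.
by exists (g * h^-1)%g; split; rewrite ?thompson_mulEx ?thompson_invK //; apply: subgroupM => //; exact: subgroupV.
Qed.

Lemma compresses_near c x : 0 < x < 1 -> inner c ->
  exists2 e, 0 < e & compresses c (x - e) (x + e).
Proof.
move=> x01 ic; have [g Hg /andP[cg gc]] := move_into x01 ic.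
pose a := thompson_fun g^-1%g (wv c); pose b := thompson_fun g^-1%g (wr c).
have ax : a < x by rewrite thompson_inv_lt.
have xb : x < b by rewrite thompson_inv_gt.
exists (Num.min (x - a) (b - x) / 2); first by rewrite divr_gt0 // lt_min !subr_gt0 ax.
have m1 : Num.min (x - a) (b - x) <= x - a by rewrite ge_min lexx.
have m2 : Num.min (x - a) (b - x) <= b - x by rewrite ge_min lexx orbT.
exists g; split=> //; first by rewrite -thompson_inv_lt -/a; lra.
by rewrite -thompson_inv_gt -/b; lra.
Qed.

(** In the rest of the section, [u] is the last linear piece of k that is not
    fixed, and k expands it, away from its right end. *)
Variable k : thompsonF R.
Hypothesis Hk : H k.
Variables (u v : seq bool).
Hypotheses (kuv : L k u v) (suv : (size v < size u)%N) (u_gt0 : 0 < wv u)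
  (u_lt1 : wr u < 1 :> R) (uv_end : wr u = wr v :> R) (k_right : forall x, wr u <= x -> k x = x).

(** Otherwise k at least doubles the distance to [wr u] again and again. *)
Lemma pull_left r s : wv u <= r -> r < s -> s < wr u ->
  exists n, (thompson_fun (k ^+ n)%g s) <= r.
Proof.
move=> ur rs sd; apply: contrapT => noN.
have gt_r n : r < thompson_fun (k ^+ n)%g s.
  by rewrite ltNge; apply/negP => h; apply: noN; exists n.
have kd n : thompson_fun (k ^+ n)%g (wr u) = wr u.
  by elim: n => [|n IHn]; rewrite ?expg0 // expgS thompson_mulEx IHn k_right.
have lt_d n : thompson_fun (k ^+ n)%g s < wr u by rewrite -(kd n) thompson_lt.
have expand n : 2 ^+ n * (wr u - s) <= wr u - thompson_fun (k ^+ n)%g s.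
  elim: n => [|n IHn]; first by rewrite expg0 expr0 mul1r.
  rewrite expgS thompson_mulEx; set t := thompson_fun _ _ in IHn *.
  have ut : wv u <= t <= wr u by rewrite (le_trans ur) ?ltW //= ?gt_r ?lt_d.
  have -> : wr u - k t = 2 ^+ size u / 2 ^+ size v * (wr u - t).
    by rewrite kuv // [X in X - _]uv_end /wr; field; rewrite !expr2_neq0.
  have le2 : 2 <= 2 ^+ size u / 2 ^+ size v :> R.
    rewrite ler_pdivlMr ?exprn_gt0 // -exprS ler_eXn2l ?ltr1n ?exprn_gt0 ?ltr0n //.
  rewrite exprS -mulrA; apply: ler_pM => //; last by rewrite mulr_ge0 ?exprn_ge0 // subr_ge0 ltW.
have sd0 : 0 < wr u - s by rewrite subr_gt0.
have [|n] := @exists_half_pow_lt R ((wr u - s) / (wr u - r)); first by rewrite divr_gt0 // subr_gt0 (lt_trans rs).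
rewrite ltr_pdivlMr ?subr_gt0 ?(lt_trans rs) // mulrC ltr_pdivrMr ?exprn_gt0 //.
have := expand n; have := gt_r n; rewrite mulrC; lra.
Qed.

(** Compressibility of intervals, as a relation between left ends that is
    transitive and invariant under H: it need only be checked locally. *)
Definition extends_left c r s := forall b, s <= b -> compresses c s b -> compresses c r b.

(** A power of k fixes b and moves s to the left of r, if b is beyond the end
    of [u]; otherwise b can be replaced by a point beyond that end. *)
Lemma extends_left_near_end c r s : inner c ->
  wv u <= r -> r <= s -> s < wr u -> extends_left c r s.
Proof.
move=> ic ur; rewrite le_eqVlt => /predU1P[-> _ b _ //|rs] sd b sb comp_sb.
have pull t b' : wv u <= r -> r < t -> t < wr u -> wr u <= b' ->
    compresses c t b' -> compresses c r b'.
  move=> _ rt td db' comp; have [n nP] := pull_left ur rt td.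
  have kb : thompson_fun (k ^+ n)%g b' = b'.
    by elim: n {nP} => [|n IHn]; rewrite ?expg0 // expgS thompson_mulEx IHn k_right.
  have /(compresses_move c t b' (subgroupX sgH n Hk)).2 := comp.
  by rewrite kb; apply: compresses_sub.
have [db|bd] := leP (wr u) b; first by apply: (pull s b ur rs sd db).
have d01 : 0 < (wr u : R) < 1 by rewrite u_lt1 (lt_trans u_gt0) ?wv_lt_wr.
have [e e0 comp_d] := compresses_near d01 ic.
apply: (@compresses_sub c r (wr u)); rewrite ?lexx ?ltW //.
pose t := Num.max s (wr u - e).
apply: (pull t); rewrite ?lexx //; first by rewrite lt_max rs.
  by rewrite gt_max sd /=; lra.
apply: compresses_sub comp_d; last by lra.
by rewrite le_max lexx orbT.
Qed.

(** By transitivity every point of ]0, 1[ can be moved into [u], where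
    [extends_left_near_end] applies; the relation then spreads to [[a, b]]. *)
Lemma compresses_all c a b : inner c -> inner u -> 0 < a -> a <= b -> b < 1 -> compresses c a b.
Proof.
move=> ic iu a0 ab b1.
have [e e0 comp_b] : exists2 e, 0 < e & compresses c (b - e) (b + e).
  by apply: compresses_near => //; rewrite (lt_le_trans a0).
suff E_ab : extends_left c a b by apply: E_ab => //; apply: compresses_sub comp_b; lra.
apply: interval_chain ab _ _ _.
- by move=> t b' _.
- move=> r s t rs st Ers Est b' tb' comp.
  by apply: Ers; [exact: le_trans tb'|exact: Est].
move=> t /andP[at_ tb].
have t01 : 0 < t < 1 by rewrite (lt_le_trans a0) //= (le_lt_trans tb).
have [e' e'0 [g [Hg ug gu]]] := compresses_near t01 iu.
exists e' => // r s er rs se b' sb' /(compresses_move c s b' Hg) comp.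
apply/(compresses_move c r b' Hg); apply: (extends_left_near_end ic _ _ _ _ comp); rewrite ?thompson_le //.
  by rewrite (le_trans (ltW ug)) // thompson_le ltW.
by apply: lt_trans gu; rewrite thompson_lt.
Qed.

End Group.


(** * Germs at dyadic points *)

Section Germs.
Variable R : realType.
Implicit Types (u v w y z p q c : seq bool) (f g h k : thompsonF R) (x t : R).

Notation wv := (word_val R).
Notation L f u v := (maps_linearly (thompson_fun f) u v).

(** The cells that shrink from the left, respectively from the right, to the
    dyadic point [wmid y]. Germs there are read off from their indices. *)
Definition lcell y n := y ++ false :: nseq n true.
Definition rcell y n := y ++ true :: nseq n false.

Lemma lcellD y n i : lcell y (n + i) = lcell y n ++ nseq i true.
Proof. by rewrite /lcell nseqD -catA. Qed.

Lemma rcellD y n i : rcell y (n + i) = rcell y n ++ nseq i false.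
Proof. by rewrite /rcell nseqD -catA. Qed.

Lemma lcell_cat u y n : u ++ lcell y n = lcell (u ++ y) n.
Proof. by rewrite /lcell catA. Qed.

Lemma rcell_cat u y n : u ++ rcell y n = rcell (u ++ y) n.
Proof. by rewrite /rcell catA. Qed.

Lemma lcell0 y : lcell y 0 = rcons y false.
Proof. by rewrite /lcell cats1. Qed.

Lemma rcell0 y : rcell y 0 = rcons y true.
Proof. by rewrite /rcell cats1. Qed.

Lemma inner_lcell y n : inner (lcell y n.+1).
Proof. by rewrite inner_catr. Qed.

Lemma inner_rcell y n : inner (rcell y n.+1).
Proof. by rewrite inner_catr. Qed.

Lemma wr_lcell y n : wr (lcell y n) = wmid y :> R.
Proof. exact: wr_right. Qed.

Lemma wv_rcell y n : wv (rcell y n) = wmid y.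
Proof. exact: wv_left. Qed.

Lemma mirror_rcell y n : mirror (rcell y n) = lcell (mirror y) n.
Proof. by rewrite /rcell mirror_cat /= -/(mirror (nseq n false)) mirror_nseq. Qed.

Lemma mirror_lcell y n : mirror (lcell y n) = rcell (mirror y) n.
Proof. by rewrite /lcell mirror_cat /= -/(mirror (nseq n true)) mirror_nseq. Qed.

Lemma L_lcellD f y z n m i : L f (lcell y n) (lcell z m) -> L f (lcell y (n + i)) (lcell z (m + i)).
Proof. by rewrite !lcellD; exact: L_cat. Qed.

Lemma L_rcellD f y z n m i : L f (rcell y n) (rcell z m) -> L f (rcell y (n + i)) (rcell z (m + i)).
Proof. by rewrite !rcellD; exact: L_cat. Qed.

Lemma germ_left f y z : f (wmid y) = wmid z -> exists n m, L f (lcell y n) (lcell z m).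
Proof.
move=> fyz; have [N NP] := thompson_deep f (lcell y 0).
have [|v] := NP (nseq N true); first by rewrite size_nseq.
rewrite -lcellD => fv; have := L_wr fv; rewrite wr_lcell fyz => /esym/wr_right_inv[m E].
by exists (0 + N)%N, m; rewrite /lcell -E.
Qed.

Lemma germ_right f y z : f (wmid y) = wmid z -> exists n m, L f (rcell y n) (rcell z m).
Proof.
move=> fyz; have [N NP] := thompson_deep f (rcell y 0).
have [|v] := NP (nseq N false); first by rewrite size_nseq.
rewrite -rcellD => fv; have := L_wv fv; rewrite wv_rcell fyz => /esym/wv_left_inv[m E].
by exists (0 + N)%N, m; rewrite /rcell -E.
Qed.

Lemma L_rcell_wmid f y z n m : L f (rcell y n) (rcell z m) -> f (wmid y) = wmid z.
Proof. by move/L_wv; rewrite !wv_rcell. Qed.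

Lemma L_lcell_wmid f y z n m : L f (lcell y n) (lcell z m) -> f (wmid y) = wmid z.
Proof. by move/L_wr; rewrite !wr_lcell. Qed.

Variable H : set (thompsonF R).
Hypothesis sgH : is_subgroup H.

(** These are the slopes 1 and 2 of the second condition of the theorem. *)
Definition right_germ_at y := exists h M N,
  [/\ H h, L h (lcell y M) (lcell y M) & L h (rcell y N.+1) (rcell y N)].

Hypothesis ctH : cell_transitive H.

(** Conjugate by an element of H that moves [wmid y] to [wmid z]: conjugation by
    a linear germ does not change slopes. *)
Lemma right_germ_everywhere y z : right_germ_at y -> right_germ_at z.
Proof.
move=> [h [M [N [Hh hl hr]]]].
have [n nP] := ctH (inner_rcell y 0) (inner_rcell z 0).
have [|g Hg] := nP (nseq n false); first by rewrite size_nseq.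
rewrite -!rcellD => gr.
have [a [b gl]] := germ_left (L_rcell_wmid gr).
exists (g * h * g^-1)%g, (b + M)%N, (1 + n + N)%N; split.
- by apply: subgroupM => //; [exact: subgroupM|exact: subgroupV].
- have gl' := L_lcellD (i := M) gl.
  apply: L_mul (L_inv gl'); apply: (L_mul gl').
  by rewrite addnC; exact: L_lcellD.
have gr' := L_rcellD (i := N) gr.
apply: (L_mul (v := rcell y (1 + n + N).+1)); last first.
  by rewrite -!addnS; apply: L_inv; exact: L_rcellD.
apply: (L_mul gr'); rewrite -addSn [(1 + n + N)%N]addnC [((1 + n).+1 + N)%N]addnC addnS -addSn.
exact: L_rcellD.
Qed.

Lemma right_germ_power y i : right_germ_at y -> exists h M N,
  [/\ H h, L h (lcell y M) (lcell y M) & L h (rcell y (N + i)) (rcell y N)].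
Proof.
move=> [h [M [N [Hh hl hr]]]]; exists (h ^+ i)%g, M, N; split; first exact: subgroupX.
  by elim: i => [|i IHi]; rewrite ?expg0 ?expgS; [exact: L_id|exact: L_mul hl IHi].
elim: i => [|i IHi]; first by rewrite addn0 expg0; exact: L_id.
rewrite expgSr; apply: (L_mul IHi); rewrite addnS -addSn; exact: L_rcellD.
Qed.

(** Transitivity gives g in H that fixes the point and has slope 2 on the left; its
    slope on the right is corrected with powers of the given germ. *)
Lemma left_germ y : right_germ_at y -> exists h M N,
  [/\ H h, L h (lcell y M.+1) (lcell y M) & L h (rcell y N) (rcell y N)].
Proof.
move=> ry; have [n nP] := ctH (inner_lcell y 1) (inner_lcell y 0).
have [|g Hg] := nP (nseq n true); first by rewrite size_nseq.
rewrite -!lcellD => gl.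
have [a [b gr]] := germ_right (L_lcell_wmid gl).
have [h [M [N [Hh hl hr]]]] := right_germ_power a ry.
have [h' [M' [N' [Hh' hl' hr']]]] := right_germ_power b ry.
(* On the right, g maps cell a to cell b; h' and h restore the index a. *)
have gl' := L_lcellD (i := M + M') gl; have gr' := L_rcellD (i := N + N') gr.
exists (h^-1 * (h' * g))%g, (1 + n + (M + M'))%N, (a + (N + N'))%N; split.
- by apply: subgroupM; [|exact: subgroupV|exact: subgroupM].
- apply: (L_mul (v := lcell y (1 + n + (M + M')))).
    apply: L_inv; have -> : (1 + n + (M + M') = M + (1 + n + M'))%N by lia.
    exact: L_lcellD.
  apply: L_mul gl'; have -> : (1 + n + (M + M') = M' + (1 + n + M))%N by lia.
  exact: L_lcellD.
apply: (L_mul (v := rcell y (N + N'))).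
  apply: L_inv; have -> : (a + (N + N') = N + a + N')%N by lia.
  exact: L_rcellD.
apply: L_mul gr'; have -> : (b + (N + N') = N' + b + N)%N by lia.
rewrite [in X in L _ _ X]addnC; exact: L_rcellD.
Qed.

End Germs.


(** * Elements of small support *)

Section SmallSupport.
Variable R : realType.
Implicit Types (u v w y z p q c : seq bool) (f g h k : thompsonF R) (x t : R).

Notation wv := (word_val R).
Notation L f u v := (maps_linearly (thompson_fun f) u v).

Lemma germ_end f b : exists n m, L f (nseq n b) (nseq m b).
Proof.
have [N NP] := thompson_deep f [::].
have [|v fv] := NP (nseq N b); first by rewrite size_nseq.
exists N, (size v); rewrite cat0s in fv; case: b fv => fv.
  by have := L_wr fv; rewrite wr_nseq1 (thompson_out f) ?lexx; [move=> /esym/wr1_inv <-|right].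
by have := L_wv fv; rewrite wv_nseq0 (thompson_out f) ?lexx; [move=> /esym/wv0_inv <-|left].
Qed.

Lemma L_nseqD f b n m i : L f (nseq n b) (nseq m b) -> L f (nseq (n + i) b) (nseq (m + i) b).
Proof. by rewrite !nseqD; exact: L_cat. Qed.

(** The germs of F at 0, or at 1, are linear and therefore commute. *)
Lemma commutator_end h g b : exists n, L (h * g * h^-1 * g^-1)%g (nseq n b) (nseq n b).
Proof.
have [p [q gpq]] := germ_end g b; have [r [s hrs]] := germ_end h b.
exists (q + (r + s))%N.
apply: (L_mul (v := nseq (p + (r + s)) b)); last exact/L_inv/L_nseqD.
apply: (L_mul (v := nseq (p + (r + r)) b)); last first.
  apply: L_inv; have -> : (p + (r + r) = r + (p + r))%N by lia.
  have -> : (p + (r + s) = s + (p + r))%N by lia.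
  exact: L_nseqD.
apply: (L_mul (v := nseq (q + (r + r)) b)); last exact: L_nseqD.
have -> : (q + (r + r) = r + (q + r))%N by lia.
have -> : (q + (r + s) = s + (q + r))%N by lia.
exact: L_nseqD.
Qed.

Lemma L_nseq_fix f b n i : L f (nseq n b) (nseq n b) -> (n <= i)%N -> L f (nseq i b) (nseq i b).
Proof. by move=> fn /subnKC <-; exact: L_nseqD. Qed.

Lemma supp_in_conj (a b : R) f g : supp_in a b f -> supp_in (g a) (g b) (g * f * g^-1)%g.
Proof.
move=> fab x xab; rewrite !thompson_mulEx fab ?thompson_invVK //.
by rewrite thompson_inv_le thompson_inv_ge.
Qed.

Lemma supp_inW (a b a' b' : R) f : a' <= a -> b <= b' -> supp_in a b f -> supp_in a' b' f.
Proof.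
by move=> aa bb fab x [xa|bx]; apply: fab; [left; exact: le_trans aa|right; exact: le_trans bx].
Qed.

Lemma L_first_last f u v : L f u v -> u <> v -> (wv u = wv v \/ wr u = wr v :> R) -> size u != size v.
Proof.
move=> _ uv E; apply/eqP => suv; apply: uv; case: E => E; first exact: wv_inj E.
by apply: (@wv_inj R) => //; move: E; rewrite /wr suv => /addIr.
Qed.

(** Compactness of the support in ]0, 1[, in terms of germs. *)
Definition compact f := exists n,
  L f (nseq n false) (nseq n false) /\ L f (nseq n true) (nseq n true).

(** One more letter keeps the two end cells apart. *)
Lemma compact_supp f : compact f -> exists a b : R, [/\ 0 < a, a <= b, b < 1 & supp_in a b f].
Proof.
move=> [n [f0 f1]]; pose a : R := wr (nseq n.+1 false); pose b : R := wv (nseq n.+1 true).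
have aE : a = 2 ^- n.+1 by rewrite /a /wr wv_nseq0 size_nseq add0r.
have bE : b = 1 - 2 ^- n.+1 by have := wr_nseq1 R n.+1; rewrite /wr size_nseq -/b; lra.
have half : 2 ^- n.+1 <= 1 / 2 :> R.
  by rewrite exprS invfM mul1r ler_piMr // invf_le1 ?exprn_gt0 // exprn_ege1 // ler1n.
have a0 := wlen_gt0 R n.+1.
exists a, b; split; [lra|lra|lra|move=> t [ta|bt]].
  have [t0|t0] := leP t 0; first by apply: thompson_out; left.
  apply: (L_fixP f (nseq n.+1 false)).1; first exact: L_nseq_fix f0 _.
  by rewrite wv_nseq0 ltW.
have [t1|t1] := leP 1 t; first by apply: thompson_out; right.
apply: (L_fixP f (nseq n.+1 true)).1; first exact: L_nseq_fix f1 _.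
by rewrite wr_nseq1 -/b bt ltW.
Qed.

Variable H : set (thompsonF R).
Hypothesis sgH : is_subgroup H.
Hypothesis ctH : cell_transitive H.

(** Let h have the germ of [right_germ_at] at [wmid y]. The commutator with an
    element g of H that moves this fixed point of h to a nearby point not fixed
    by h is not trivial. *)
Lemma compact_element y : right_germ_at H y -> exists k,
  [/\ H k, (exists x, k x <> x) & compact k].
Proof.
move=> [h [M [N [Hh hl hr]]]]; pose z := rcell y N.+1.
have [n nP] := ctH (inner_rcell y 0) (inner_rcell z 0).
have [|g Hg] := nP (nseq n false); first by rewrite size_nseq.
rewrite -!rcellD => /L_rcell_wmid gyz.
have [n0 k0] := commutator_end h g false; have [n1 k1] := commutator_end h g true.
exists (h * g * h^-1 * g^-1)%g; split.
- by do !apply: subgroupM => //; exact: subgroupV.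
- have gz : thompson_fun g^-1%g (wmid z) = wmid y by rewrite -gyz thompson_invK.
  have hy : thompson_fun h^-1%g (wmid y) = wmid y by rewrite -{1}(L_lcell_wmid hl) thompson_invK.
  exists (wmid z); rewrite !thompson_mulEx gz hy gyz.
  rewrite (L_wmid hr) => /wmid_inj /(congr1 size).
  by rewrite !size_cat /= !size_nseq; lia.
- exists (maxn n0 n1); split; first exact: L_nseq_fix k0 (leq_maxl _ _).
  exact: L_nseq_fix k1 (leq_maxr _ _).
Qed.

(** This is [first_piece] for the reflection of k. *)
Lemma last_piece k : (exists x, k x <> x) -> compact k ->
  exists u v, [/\ L k u v, wr u = wr v :> R, u <> v, wr u < 1 :> R &
    forall x, wr u <= x -> k x = x].
Proof.
move=> [x0 kx0] [n [_ kn]]; have [|kid|[w [v [kwv Ev wv_ne kid]]]] := @first_piece R (flip k) [::].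
- by apply: thompson_out; left.
- case: kx0; have [x01|x01] := boolP (0 <= x0 <= 1); last first.
    by case: (thompsonP k) => -> //; exact/negP.
  have /L_fixP -> // : L k [::] [::].
    by have := L_mirror kid; rewrite flipK.
  by rewrite /wr /= expr0 invr1 add0r.
have kmw := L_mirror kwv; rewrite flipK cat0s in kmw kid Ev wv_ne.
exists (mirror w), (mirror v); split => //.
- by rewrite !wr_mirror Ev.
- by move=> E; apply: wv_ne; rewrite -[w]mirrorK E mirrorK.
- rewrite wr_mirror ltrBlDr ltrDl lt_neqAle wv_ge0 andbT; apply/eqP => w0.
  have wE := wv0_inv (esym w0); have vE := wv0_inv (etrans Ev (esym w0)).
  apply: wv_ne; have kw : L k (nseq (size w) true) (nseq (size v) true).
    by move: kmw; rewrite {1}wE {1}vE !mirror_nseq.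
  have := L_fun (L_nseqD (i := size w) kn); rewrite addnC.
  move=> /(_ _ (L_nseqD (i := n) kw)) /(congr1 size); rewrite !size_nseq => E.
  by rewrite wE vE; congr nseq; lia.
move=> x; rewrite wr_mirror => wx; have [x1|x1] := leP x 1; last by apply: thompson_out; right; exact: ltW.
have := kid (1 - x); rewrite flipE subKr /= => /(_ _) E.
by have : 1 - k x = 1 - x; [apply: E; lra|lra].
Qed.

(** The last piece of k is expanded either by k or by its inverse. *)
Lemma compress y c (a b : R) : right_germ_at H y -> inner c ->
  0 < a -> a <= b -> b < 1 -> compresses H c a b.
Proof.
move=> ry ic; have [k [Hk kne kc]] := compact_element ry.
have [u [v [kuv uv_end uv u1 k_right]]] := last_piece kne kc.
have suv := L_first_last kuv uv (or_intror uv_end).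
have k_pos x : 0 < x -> 0 < k x.
  by move=> x0; rewrite -{1}(thompson_out k (x := 0)) ?thompson_lt //; left.
have u0 : 0 < wv u.
  rewrite lt_neqAle wv_ge0 andbT; apply/eqP => u0; apply: uv; apply: (@cell_inj R) => //.
  by rewrite -(L_wv kuv) -u0 thompson_out //; left.
have v0 : 0 < wv v by rewrite -(L_wv kuv) k_pos.
move: suv; rewrite neq_ltn => /orP[suv|suv]; last first.
  exact: (compresses_all sgH ctH Hk kuv suv u0 u1 uv_end k_right ic (inner_of u0 u1)).
have v1 : wr v < 1 :> R by rewrite -uv_end.
apply: (compresses_all sgH ctH (subgroupV sgH Hk) (L_inv kuv) suv v0 v1 (esym uv_end) _ ic (inner_of v0 v1)).
by move=> x; rewrite -uv_end => ux; rewrite -{1}(k_right x ux) thompson_invK.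
Qed.

(** Conjugate a compactly supported element by a compression of its support. *)
Lemma small_element y c : right_germ_at H y -> inner c ->
  exists k, [/\ H k, exists x, k x <> x & supp_in (wv c) (wr c) k].
Proof.
move=> ry ic; have [k [Hk [x kx] /compact_supp[a [b [a0 ab b1 kab]]]]] := compact_element ry.
have [g [Hg ga gb]] := compress ry ic a0 ab b1.
exists (g * k * g^-1)%g; split.
- by apply: subgroupM => //; [exact: subgroupM|exact: subgroupV].
- exists (g x); rewrite !thompson_mulEx thompson_invK => /thompson_inj; exact: kx.
- apply: (@supp_inW (g a) (g b)); [exact: ltW|exact: ltW|]. exact: supp_in_conj.
Qed.

End SmallSupport.


(** * A self-similar cell *)

Section SelfSimilar.
Variable R : realType.
Implicit Types (u v w y z p q c e rho : seq bool) (f g h k : thompsonF R) (x t : R).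

Notation wv := (word_val R).
Notation L f u v := (maps_linearly (thompson_fun f) u v).

Variable H : set (thompsonF R).
Hypothesis sgH : is_subgroup H.
Hypothesis ctH : cell_transitive H.
Variable y0 : seq bool.
Hypothesis rgH : right_germ_at H y0.

Lemma supp_in_ends f u : supp_in (wv u) (wr u) f -> f (wv u) = wv u /\ f (wr u) = wr u.
Proof. by move=> fu; split; apply: fu; [left|right]. Qed.

Lemma image_below f rho w v : supp_in (wv rho) (wr rho) f -> L f (rho ++ w) v ->
  exists2 v', v = rho ++ v' & v' = [::] -> w = [::].
Proof.
move=> fsupp fv; have [fl fr] := supp_in_ends fsupp.
have [||v' vE] := @sub_cell R rho v.
- by rewrite -(L_wv fv) -{1}fl thompson_le wv_cat_ge.
- by rewrite -(L_wr fv) -{1}fr thompson_le wr_cat_le.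
exists v' => // v'0; move: fv; rewrite vE v'0 cats0 => fv.
have E : rho ++ w = rho.
  by apply: (@cell_inj R); apply: (@thompson_inj _ f); rewrite ?fl ?fr ?(L_wv fv) ?(L_wr fv).
by move/(congr1 size): E; rewrite size_cat; case: w {fv} => //= b w; lia.
Qed.

(** Such an element is linear on the whole cell and fixes its ends. This is the
    source of both contradictions that make H large on small cells. *)
Lemma trivial_of_siblings f rho : supp_in (wv rho) (wr rho) f ->
  (forall w v v', L f (rcons (rho ++ w) false) v -> L f (rcons (rho ++ w) true) v' ->
     exists q q', v = rcons q false /\ v' = rcons q' true) ->
  forall x, f x = x.
Proof.
move=> fsupp sib x; have [v fv] := linear_of_siblings sib.
have [fl fr] := supp_in_ends fsupp.
have E := L_fix_cell fv fl fr; rewrite -E in fv.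
have [xl|lx] := leP x (wv rho); first by apply: fsupp; left.
have [rx|xr] := leP (wr rho) x; first by apply: fsupp; right.
by apply: (L_fixP f rho).1; rewrite ?ltW.
Qed.

Definition finite_memory rho N := forall w z, size z = N ->
  same_cell H (rho ++ w ++ z) (rho ++ z).

(** Transitivity, for the finitely many pairs rho, rho0 and rho, rho1, allows one
    to delete the letters after rho one by one, as long as N letters remain. *)
Lemma finite_memory_exists : exists rho N, inner rho /\ finite_memory rho N.
Proof.
pose rho := [:: false; true]; have irho b : inner (rho ++ b) by exact: inner_cat.
have [N0 N0P] := ctH (irho [:: false]) (irho [::]).
have [N1 N1P] := ctH (irho [:: true]) (irho [::]).
exists rho, (maxn N0 N1); split => // w z sz; elim: w => [|b w IHw]; first exact: same_refl.
apply: (same_trans sgH _ IHw); rewrite -[X in same_cell _ _ X]/((rho ++ [::]) ++ (w ++ z)).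
rewrite cat_cons -cat_rcons -cats1.
by case: b; [apply: N1P|apply: N0P]; rewrite size_cat sz; lia.
Qed.

(** If H can map a left half to a right half below rho, then it can also change
    the first of the N + 1 remembered letters, and below rho0 it need not be
    remembered. Otherwise, [trivial_of_siblings] contradicts [small_element]. *)
Lemma finite_memory_pred rho N : inner rho -> finite_memory rho N.+1 ->
  exists2 rho', inner rho' & finite_memory rho' N.
Proof.
move=> irho fm.
have [[w [z [h Hh hwz]]]|no_swap] :=
  pselect (exists w z, same_cell H (rho ++ rcons w false) (rho ++ rcons z true)).
- exists (rcons rho false); first by rewrite -cats1; exact: inner_cat.
  have half b z' : size z' = N -> same_cell H (rho ++ b :: z') (rho ++ false :: z').
    move=> sz; case: b; last exact: same_refl.
    have fm' v b : same_cell H (rho ++ rcons v b ++ z') (rho ++ b :: z').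
      by rewrite cat_rcons; apply: fm; rewrite /= sz.
    apply: same_trans (same_sym sgH (fm' z true)) _ => //.
    apply: (same_trans sgH _ (fm' w false)); rewrite !catA; apply: same_cat.
    by apply: same_sym => //; exists h.
  move=> v z' sz; rewrite !cat_rcons.
  case/lastP: v => [|v b]; first exact: same_refl.
  apply: (same_trans sgH _ (half b z' sz)).
  by rewrite cat_rcons -cat_cons; apply: fm; rewrite /= sz.
have [k [Hk [x kx] ksupp]] := small_element sgH ctH rgH irho.
case: kx; apply: (trivial_of_siblings ksupp) => w v v'; rewrite !rcons_cat => k0 k1.
have [v1 vE v1N] := image_below ksupp k0; have [v1' v'E v1'N] := image_below ksupp k1.
case/lastP: v1 v1N vE => [/(_ erefl)|q b _ vE]; first by case: (w).
case/lastP: v1' v1'N v'E => [/(_ erefl)|q' b' _ v'E]; first by case: (w).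
exists (rho ++ q), (rho ++ q'); rewrite !rcons_cat vE v'E; split; congr (_ ++ rcons _ _).
  by case: b vE k0 => // -> k0; case: no_swap; exists w, q, k.
case: b' v'E k1 => // -> k1; case: no_swap; exists q', w.
by apply: same_sym => //; exists k.
Qed.

Lemma self_similar_cell : exists2 rho, inner rho & forall w, same_cell H (rho ++ w) rho.
Proof.
have [rho [N [irho fm]]] := finite_memory_exists.
elim: N rho irho fm => [|N IHN] rho irho fm.
  by exists rho => // w; have := fm w [::] erefl; rewrite !cats0.
by have [rho' irho' fm'] := finite_memory_pred irho fm; exact: IHN fm'.
Qed.

End SelfSimilar.


(** * Change of scale at dyadic points *)

Section Scaling.
Variable R : realType.
Implicit Types (u v w y z p q c e : seq bool) (f g h k : thompsonF R) (x t : R).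

Notation wv := (word_val R).
Notation L f u v := (maps_linearly (thompson_fun f) u v).

Variable H : set (thompsonF R).
Hypothesis sgH : is_subgroup H.
Hypothesis ctH : cell_transitive H.
Variable y0 : seq bool.
Hypothesis rgH : right_germ_at H y0.
Variable rho : seq bool.
Hypothesis irho : inner rho.
Hypothesis self_sim : forall w, same_cell H (rho ++ w) rho.

Lemma same_below w z : same_cell H (rho ++ w) (rho ++ z).
Proof. by apply: (same_trans sgH (self_sim w)); apply: same_sym. Qed.

(** The slopes, as the differences of indices, that H realizes on the right of a
    dyadic point below rho; no condition is put on the slope on the left. By
    self-similarity the choice of that point does not matter. The indices and not
    only their difference are recorded, because they say how large the linear
    piece is. *)
Definition bond n n' := exists h M M',
  [/\ H h, L h (lcell rho M) (lcell rho M') & L h (rcell rho n) (rcell rho n')].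

Lemma bond_of h w w' M M' n n' : H h ->
  L h (lcell (rho ++ w) M) (lcell (rho ++ w') M') ->
  L h (rcell (rho ++ w) n) (rcell (rho ++ w') n') -> bond n n'.
Proof.
move=> Hh hl hr; have [g Hg gw] := same_sym sgH (self_sim w).
have [g' Hg' gw'] := self_sim w'.
exists (g' * (h * g))%g, M, M'; split; first by apply: subgroupM => //; exact: subgroupM.
  by apply: L_mul (L_cat gw') _; apply: L_mul hl _; exact: L_cat.
by apply: L_mul (L_cat gw') _; apply: L_mul hr _; exact: L_cat.
Qed.

Lemma bond_at n n' w : bond n n' -> exists h M M',
  [/\ H h, L h (lcell (rho ++ w) M) (lcell (rho ++ w) M') &
    L h (rcell (rho ++ w) n) (rcell (rho ++ w) n')].
Proof.
move=> [h [M [M' [Hh hl hr]]]]; have [g Hg gw] := self_sim w.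
have gw' := L_inv gw.
exists (g^-1 * (h * g))%g, M, M'; split.
- by apply: subgroupM; [|exact: subgroupV|exact: subgroupM].
- by apply: L_mul (L_cat gw') _; apply: L_mul hl _; exact: L_cat.
by apply: L_mul (L_cat gw') _; apply: L_mul hr _; exact: L_cat.
Qed.

Lemma bond_sym n n' : bond n n' -> bond n' n.
Proof.
move=> [h [M [M' [Hh hl hr]]]]; exists h^-1%g, M', M.
by split; [exact: subgroupV|exact: L_inv|exact: L_inv].
Qed.

Lemma bond_trans n' n n'' : bond n n' -> bond n' n'' -> bond n n''.
Proof.
move=> [h [M [M' [Hh hl hr]]]] [g [N [N' [Hg gl gr]]]].
exists (g * h)%g, (M + N)%N, (N' + M')%N; split; first exact: subgroupM.
  apply: (L_mul (v := lcell rho (N + M'))); first exact: L_lcellD.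
  by rewrite [(N + M')%N]addnC; exact: L_lcellD.
exact: L_mul gr hr.
Qed.

Lemma bondD n n' i : bond n n' -> bond (n + i) (n' + i).
Proof. by move=> [h [M [M' [Hh hl hr]]]]; exists h, M, M'; split => //; exact: L_rcellD. Qed.

Lemma bond_refl n : bond n n.
Proof. by exists 1%g, 0%N, 0%N; split; [exact: subgroup1|exact: L_id|exact: L_id]. Qed.

(** This comes from the germs of [right_germ_at], whose size is unknown. *)
Lemma bond_large : exists J, forall n, (J <= n)%N -> bond n n.+1.
Proof.
have [h [M [N [Hh hl hr]]]] := right_germ_everywhere sgH ctH rho rgH.
exists N => n /subnKC <-; rewrite -addSn; apply/bondD/bond_sym.
by exists h, M, M.
Qed.

(** Suppose that only 0 is bonded to 0. Let k in H be supported in [rho] and map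
    two halves to v and v', which meet at some dyadic point. The right half has
    index 0 there, hence so does v', which thus ends with 1. If v ended with 1
    too, it would have index 0 at its left end, while the left half has positive
    index at its own. So k is trivial by [trivial_of_siblings], in contradiction
    with [small_element]. *)
Lemma bond_zero : exists i, bond 0 i.+1.
Proof.
apply: contrapT => no_bond.
have no_bond0 n : bond 0 n -> n = 0%N.
  by case: n => // n b; case: no_bond; exists n.
have [k [Hk [x kx] ksupp]] := small_element sgH ctH rgH irho.
have [kl kr] := supp_in_ends ksupp.
case: kx; apply: (trivial_of_siblings ksupp) => w v v' k0 k1.
have [v1 vE v1N] : exists2 v1, v = rho ++ v1 & v1 = [::] -> rcons w false = [::].
  by apply: (image_below ksupp); rewrite -rcons_cat.
have [v1' v'E v1'N] : exists2 v1', v' = rho ++ v1' & v1' = [::] -> rcons w true = [::].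
  by apply: (image_below ksupp); rewrite -rcons_cat.
have k_mid : wr v = wv v' :> R by rewrite -(L_wr k0) -(L_wv k1) wr_rcons0.
have mid_in : wv rho < (wr v : R) < wr rho.
  rewrite -(L_wr k0) wr_rcons0 -{1}kl -kr !thompson_lt.
  rewrite (le_lt_trans (wv_cat_ge R rho w) (wv_lt_wmid R _)) /=.
  exact: lt_le_trans (wmid_lt_wr R _) (wr_cat_le R rho w).
have [e' [n' v1'E]] : exists e n, v1' = rcell e n.
  case: (word_left_cases v1') => [E|[e [n E]]]; last by exists e, n.
  by move: mid_in; rewrite k_mid v'E E wv_cat wv_nseq0 mulr0 addr0 ltxx.
have [e [m v1E]] : exists e m, v1 = lcell e m.
  case: (word_right_cases v1) => [E|[e [n E]]]; last by exists e, n.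
  by move: mid_in; rewrite vE E wr_cat wr_nseq1 mulr1 ltxx andbF.
rewrite v1E lcell_cat in vE; rewrite v1'E rcell_cat in v'E.
have eE : rho ++ e = rho ++ e'.
  by apply: (@wmid_inj R); rewrite -(wr_lcell _ _ m) -(wv_rcell _ _ n') -vE -v'E.
have n'0 : n' = 0%N.
  apply: no_bond0; apply: (bond_of (w := w) (w' := e') (M := 0) (M' := m) Hk).
    by rewrite lcell0 -eE -vE.
  by rewrite rcell0 -v'E.
case: m v1E vE => [|m] v1E vE.
  by exists (rho ++ e), (rho ++ e'); rewrite vE v'E n'0 lcell0 rcell0.
(* v ends with 1: at the left ends of w0 and v, k relates n.+1 to 0 *)
have vE' : v = rcell (rho ++ lcell e m) 0.
  by rewrite vE rcell0 lcell_cat -[m.+1]addn1 lcellD cats1.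
have [e2 [n wE]] : exists e2 n, rcons w false = rcell e2 n.+1.
  case: (word_left_cases (rcons w false)) => [E|[e2 [n E]]].
    have : wv v = wv rho.
      by rewrite -(L_wv k0) rcons_cat E wv_cat wv_nseq0 mulr0 addr0.
    rewrite vE' wv_rcell => E'; have := wv_lt_wmid R (rho ++ lcell e m).
    by rewrite E' ltNge wv_cat_ge.
  case: n E => [|n] E; last by exists e2, n.
  by move: E; rewrite -[RHS]/(rcell e2 0) rcell0 => /rcons_inj[].
move: k0; rewrite rcons_cat wE rcell_cat vE' => k0.
have [a [b k_left]] := germ_left (L_rcell_wmid k0).
by have /no_bond0 := bond_sym (bond_of Hk k_left k0).
Qed.

(** Downward induction on the bound of [bond_large]: the bond between 0 and some
    i.+1 links J to i.+1 + J, which is linked to J.+1. *)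
Lemma bond_all n : bond 0 n.
Proof.
have [i bi] := bond_zero; have [J JP] := bond_large.
suff bS : forall m, bond m m.+1.
  by elim: n => [|n IHn]; [exact: bond_refl|exact: bond_trans IHn (bS n)].
elim: J JP => [|J IHJ] JP; first by move=> m; exact: JP.
apply: IHJ => m; rewrite leq_eqVlt => /predU1P[<-|]; last exact: JP.
have bJ j : bond J.+1 (J.+1 + j).
  elim: j => [|j IHj]; first by rewrite addn0; exact: bond_refl.
  by rewrite addnS; apply: bond_trans IHj _; apply: JP; lia.
apply: bond_trans (bond_sym (bJ i)).
by have := bondD J bi; rewrite add0n; have -> : (i.+1 + J = J.+1 + i)%N by lia.
Qed.

(** The first moved piece of a small element gives such an element at some
    dyadic point below rho and some scale; H moves the point to any other one
    by self-similarity, and the scale to the whole right half by [bond_all].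
    These motions are not controlled on the left of the point, but conjugates of
    the identity are the identity. *)
Lemma right_contraction w : exists h j, [/\ H h,
  forall x, x <= wmid (rho ++ w) -> h x = x &
  L h (rcell (rho ++ w) 0) (rcell (rho ++ w) j.+1)].
Proof.
pose c := rho ++ [:: false; true]; have ic : inner c by exact: inner_cat.
have [k [Hk [x kx] ksupp]] := small_element sgH ctH rgH ic.
have [kl kr] := supp_in_ends ksupp.
have [e [n [m [nm kid kr']]]] : exists e n m, [/\ n <> m,
    forall x, x <= wmid (rho ++ e) -> k x = x & L k (rcell (rho ++ e) n) (rcell (rho ++ e) m)].
  case: (first_piece kl) => [kc|[z [v [kz zv z_v kid]]]].
    case: kx; have [xc|cx] := leP x (wv c); first by apply: ksupp; left.
    have [cx'|xc'] := leP (wr c) x; first by apply: ksupp; right.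
    by apply: (L_fixP k c).1; rewrite ?ltW.
  have [e [n cz]] : exists e n, c ++ z = rcell (rho ++ e) n.
    rewrite /c -catA; case: (word_left_cases ([:: false; true] ++ z)) => [//|[e [n ->]]].
    by exists e, n; rewrite -rcell_cat.
  rewrite cz in kz zv z_v kid; rewrite wv_rcell in zv kid.
  have [m vE] := wv_left_inv zv; change (v = rcell (rho ++ e) m) in vE.
  exists e, n, m; rewrite -vE; split => //; first by move=> E; apply: z_v; rewrite vE E.
  move=> t te; have [tc|ct] := leP t (wv c); first by apply: ksupp; left.
  by apply: kid; rewrite te ltW.
wlog lt_nm : k Hk n m nm kid kr' {kx ksupp kl kr} / (n < m)%N => [wlg|].
  have [|mn] := ltnP n m; first exact: (wlg k Hk n m).
  apply: (wlg k^-1%g (subgroupV sgH Hk) m n); last by lia.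
  - by move=> E; exact: nm.
  - by move=> t te; rewrite -{1}(kid t te) thompson_invK.
  - exact: L_inv.
have [g Hg gw] := same_below e w.
have [s [M [M' [Hs sl sr]]]] := bond_at w (bond_all n).
exists (s^-1 * (g * (k * (g^-1 * s))))%g, (m - n).-1; split.
- by do ?[exact: subgroupV|apply: subgroupM => //].
- move=> t tw; rewrite !thompson_mulEx kid ?thompson_invVK ?thompson_invK //.
  by rewrite thompson_inv_le (L_wmid gw) -(L_rcell_wmid sr) thompson_le.
have gw' i : L g (rcell (rho ++ e) i) (rcell (rho ++ w) i) by exact: L_cat.
apply: L_mul (L_mul (gw' m) (L_mul kr' (L_mul (L_inv (gw' n)) sr))).
apply: L_inv; have := L_rcellD (i := (m - n).-1.+1) sr; rewrite add0n.
by have -> : (n + (m - n).-1.+1 = m)%N by lia.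
Qed.

End Scaling.


(** * Gluing linear pieces *)

Section Flipped.
Variable R : realType.
Implicit Types (u v w y z c e : seq bool) (f g h k p s : thompsonF R) (x t : R).

Notation wv := (word_val R).
Notation L f u v := (maps_linearly (thompson_fun f) u v).

Definition flipped (H : set (thompsonF R)) : set (thompsonF R) := [set f | H (flip f)].

Variable H : set (thompsonF R).
Hypothesis sgH : is_subgroup H.

Lemma flipped_subgroup : is_subgroup (flipped H).
Proof.
apply: subgroup_intro; rewrite /flipped /=.
- by rewrite flip1; exact: subgroup1.
- by move=> f g Hf Hg; rewrite flip_mul; exact: subgroupM.
- by move=> f Hf; rewrite flip_inv; exact: subgroupV.
Qed.

Lemma L_mirrored f u v : L f (mirror u) (mirror v) -> L (flip f) u v.
Proof. by move/L_mirror; rewrite !mirrorK. Qed.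

Lemma flipped_same_cell u v : same_cell H u v -> same_cell (flipped H) (mirror u) (mirror v).
Proof.
move=> [h Hh huv]; exists (flip h); first by rewrite /flipped /= flipK.
exact: L_mirror.
Qed.

Hypothesis ctH : cell_transitive H.

Lemma flipped_transitive : cell_transitive (flipped H).
Proof.
move=> u v; rewrite -(inner_mirror u) -(inner_mirror v) => iu iv.
have [N NP] := ctH iu iv; exists N => w Nw.
have := NP (mirror w); rewrite size_mirror -!mirror_cat => /(_ Nw)/flipped_same_cell.
by rewrite !mirrorK.
Qed.

Lemma flipped_right_germ y : right_germ_at H y -> right_germ_at (flipped H) (mirror y).
Proof.
move=> /(left_germ sgH ctH)[h [M [N [Hh hl hr]]]]; exists (flip h), N, M; split.
- by rewrite /flipped /= flipK.
- by rewrite -!mirror_rcell; exact: L_mirror.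
- by rewrite -!mirror_lcell; exact: L_mirror.
Qed.

End Flipped.

Section Gluing.
Variable R : realType.
Implicit Types (u v w y z c e : seq bool) (f g h k p s : thompsonF R) (x t : R).

Notation wv := (word_val R).
Notation L f u v := (maps_linearly (thompson_fun f) u v).

Variable H : set (thompsonF R).
Hypothesis sgH : is_subgroup H.
Hypothesis ctH : cell_transitive H.
Variable y0 : seq bool.
Hypothesis rgH : right_germ_at H y0.
Variable rho : seq bool.
Hypothesis irho : inner rho.
Hypothesis self_sim : forall w, same_cell H (rho ++ w) rho.

Lemma left_contraction w : exists h j, [/\ H h,
  forall x, wmid (rho ++ w) <= x -> h x = x &
  L h (lcell (rho ++ w) 0) (lcell (rho ++ w) j.+1)].
Proof.
have sim w' : same_cell (flipped H) (mirror rho ++ w') (mirror rho).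
  by have /flipped_same_cell := self_sim (mirror w'); rewrite mirror_cat mirrorK.
have imrho : inner (mirror rho) by rewrite inner_mirror.
have [h [j [Hh hid hc]]] := right_contraction (flipped_subgroup sgH)
  (flipped_transitive ctH) (flipped_right_germ sgH ctH rgH) imrho sim (mirror w).
exists (flip h), j; split => //.
  move=> x wx; rewrite flipE hid ?subKr // -mirror_cat wmid_mirror; lra.
by apply: L_mirrored; rewrite !mirror_lcell mirror_cat.
Qed.

Lemma L_lcell_pow h y j n : L h (lcell y 0) (lcell y j) -> L (h ^+ n)%g (lcell y 0) (lcell y (j * n)).
Proof.
move=> hj; elim: n => [|n IHn]; first by rewrite muln0 expg0; exact: L_id.
rewrite expgS mulnS; apply: L_mul IHn; exact: L_lcellD hj.
Qed.

Lemma L_rcell_pow h y j n : L h (rcell y 0) (rcell y j) -> L (h ^+ n)%g (rcell y 0) (rcell y (j * n)).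
Proof.
move=> hj; elim: n => [|n IHn]; first by rewrite muln0 expg0; exact: L_id.
rewrite expgS mulnS; apply: L_mul IHn; exact: L_rcellD hj.
Qed.

Lemma fix_pow h x n : h x = x -> thompson_fun (h ^+ n)%g x = x.
Proof.
by move=> hx; elim: n => [|n IHn]; rewrite ?expg0 // expgS thompson_mulEx IHn.
Qed.

Lemma wv_lcell_close y t : t < wmid y -> exists M, t <= wv (lcell y M).
Proof.
move=> ty; have [|n nP] := @exists_half_pow_lt R (wmid y - t); first by rewrite subr_gt0.
exists n; have := wr_lcell R y n; rewrite /wr size_cat /= size_nseq => E.
have le : 2 ^- (size y + n.+1) <= 2 ^- n :> R.
  by rewrite lef_pV2 ?posrE ?exprn_gt0 // ler_weXn2l ?ler1n //; lia.
lra.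
Qed.

Lemma wv_lcell_le y n m : (n <= m)%N -> wv (lcell y n) <= wv (lcell y m).
Proof. by move=> /subnKC <-; rewrite lcellD; exact: wv_cat_ge. Qed.

(** A left contraction attracts the left half of [rho w] to the midpoint. If the left
    end d of [rho w] is not that of [rho], then by induction on w the left end of
    [rho] is first pushed close to d, so close that the left contraction carries
    it beyond d. *)
Lemma gather_left w M : exists p, [/\ H p,
  forall x, wmid (rho ++ w) <= x -> p x = x & wv (lcell (rho ++ w) M) <= p (wv rho)].
Proof.
have [n] := ubnP (size w); elim: n w M => // n IHn w M; rewrite ltnS => wn.
have [h [j [Hh hid hl]]] := left_contraction w.
have hM := L_lcell_pow M hl.
have leM : wv (lcell (rho ++ w) M) <= wv (lcell (rho ++ w) (j.+1 * M)).
  by apply: wv_lcell_le; rewrite leq_pmull.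
have wv0 : wv (lcell (rho ++ w) 0) = wv (rho ++ w) by rewrite lcell0 wv_rcons0.
case: (word_left_cases w) => [wE|[e [i wE]]].
  exists (h ^+ M)%g; split; first exact: subgroupX.
    by move=> x wx; apply/fix_pow/hid.
  have -> : wv rho = wv (lcell (rho ++ w) 0).
    by rewrite wv0 wE wv_cat wv_nseq0 mulr0 addr0.
  by rewrite (L_wv hM).
have dE : wv (rho ++ w) = wmid (rho ++ e) by rewrite wE -/(rcell e i) rcell_cat wv_rcell.
pose d : R := wv (rho ++ w).
have hd : d < h d.
  rewrite /d -wv0 (L_wv hl); set a : R := wv (lcell _ j.+1).
  rewrite wv0 /a -[j.+1]add0n lcellD lcell0 [X in _ < X]wv_cat wv_rcons0 ltrDl mulr_gt0 ?wlen_gt0 //=.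
  by have := wv_ge0 R (nseq j true); rewrite -/(nseq j true); lra.
have [M' M'P] : exists M', thompson_fun h^-1%g d <= wv (lcell (rho ++ e) M').
  by apply: wv_lcell_close; rewrite -dE thompson_inv_lt.
have [|p [Hp pid pl]] := IHn e M'.
  by apply: leq_trans wn; rewrite wE size_cat /= size_nseq; lia.
exists (h ^+ M * (h * p))%g; split.
- by apply: subgroupM; [|exact: subgroupX|exact: subgroupM].
- move=> x wx; have dx : wmid (rho ++ e) <= x by rewrite -dE (le_trans _ wx) // ltW ?wv_lt_wmid.
  by rewrite !thompson_mulEx pid // hid //; apply/fix_pow/hid.
apply: le_trans leM _; rewrite -(L_wv hM) !thompson_mulEx thompson_le wv0 -/d.
by rewrite -thompson_inv_le; exact: le_trans pl.
Qed.

(** Let z in H have slope 1 on the left of c and 2 on its right, close to c.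
    Conjugation by an element p that gathers the left part of [rho] near c makes
    z the identity on that whole part. Conjugation by right contractions, which
    fix that part, extends the linear piece of z to the whole right half. *)
Lemma right_shift w n : exists s, [/\ H s,
  forall x, wv rho <= x <= wmid (rho ++ w) -> s x = x &
  L s (rcell (rho ++ w) 0) (rcell (rho ++ w) n)].
Proof.
have [z [M [N [Hz zl zr]]]] := right_germ_everywhere sgH ctH (rho ++ w) rgH.
have [p [Hp pid pl]] := gather_left w M.
have [q [j [Hq qid qr]]] := right_contraction sgH ctH rgH irho self_sim w.
pose zp : thompsonF R := (p^-1 * (z * p))%g.
have Hzp : H zp by apply: subgroupM; [|exact: subgroupV|exact: subgroupM].
have zp_id x : wv rho <= x <= wmid (rho ++ w) -> zp x = x.
  move=> /andP[lx xw]; rewrite !thompson_mulEx.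
  have -> : z (p x) = p x; last exact: thompson_invK.
  apply: (L_fixP z _).1; first exact: zl.
  rewrite (le_trans pl) ?thompson_le //= wr_lcell.
  by rewrite -(pid (wmid (rho ++ w))) ?thompson_le.
have p_rcell i : L p (rcell (rho ++ w) i) (rcell (rho ++ w) i).
  by apply/L_fixP => x /andP[wx _]; apply: pid; move: wx; rewrite wv_rcell.
have zpr : L zp (rcell (rho ++ w) N.+1) (rcell (rho ++ w) N).
  by apply: L_mul (L_inv (p_rcell N)) _; exact: L_mul zr (p_rcell _).
have qN := L_rcell_pow N qr.
have NjE : (j.+1 * N = N + j * N)%N by rewrite mulSn.
(* conjugating by q moves the expansion of z to the whole right half *)
pose s : thompsonF R := ((q ^+ N)^-1 * (zp^-1 * q ^+ N))%g.
have HqN : H (q ^+ N)%g by exact: subgroupX.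
have Hs : H s by apply: subgroupM => //; [exact: subgroupV|apply: subgroupM => //; exact: subgroupV].
have s_id x : wv rho <= x <= wmid (rho ++ w) -> s x = x.
  move=> lx; have qx : thompson_fun (q ^+ N)%g x = x by apply/fix_pow/qid; case/andP: lx.
  by rewrite !thompson_mulEx qx -{1}(zp_id x lx) thompson_invK -{1}qx thompson_invK.
have sr : L s (rcell (rho ++ w) 0) (rcell (rho ++ w) 1).
  apply: L_mul (L_inv _) (L_mul (L_inv _) qN).
    by have := L_rcellD (i := 1) qN; rewrite add0n; exact.
  by rewrite NjE addn1 -addSn; exact: L_rcellD.
exists (s ^+ n)%g; split; first exact: subgroupX.
  by move=> x lx; apply/fix_pow/s_id.
by have := L_rcell_pow n sr; rewrite mul1n.
Qed.

(** Suppose that h in H agrees with f up to the left end d of a piece [u] on which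
    f is linear. On the right of d, h is only known near d; shifts at d and at
    f d bring the germ of h to the scale and slope of f on all of [u] without
    affecting what is on the left. The statement [extends u] is set up so that it
    passes from the two halves of a cell to the cell. *)
Lemma glue f : supp_in (wv rho) (wr rho) f ->
  exists2 h, H h & forall x, wv rho <= x <= wr rho -> h x = f x.
Proof.
move=> fsupp; have [fl fr] := supp_in_ends fsupp.
pose extends u := forall w, u = rho ++ w -> forall h, H h ->
  (forall x, wv rho <= x <= wv u -> h x = f x) ->
  exists2 h', H h' & forall x, wv rho <= x <= wr u -> h' x = f x.
suff : extends rho.
  move=> /(_ [::] (esym (cats0 _)) 1%g (subgroup1 sgH)) []; last by move=> h; exists h.
  by move=> x /le_anti <-.
apply: (@deep_ind extends) => [|w].
  have [N NP] := thompson_deep f rho; exists N => w /NP[v fv] w' _ h Hh h_agree.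
  have [v' vE _] := image_below fsupp fv; rewrite {v}vE in fv.
  case: (word_left_cases w) => [wE|[e [i wE]]].
    have [g Hg gw] := same_below sgH self_sim w v'.
    exists g => // x; have -> : wv rho = wv (rho ++ w) by rewrite wE wv_cat wv_nseq0 mulr0 addr0.
    by move=> wx; rewrite gw // fv.
  rewrite -/(rcell e i) in wE; rewrite wE rcell_cat in fv h_agree *.
  rewrite wv_rcell in h_agree; have d_gt : wv rho < wmid (rho ++ e).
    exact: le_lt_trans (wv_cat_ge R rho e) (wv_lt_wmid R _).
  have hd : h (wmid (rho ++ e)) = f (wmid (rho ++ e)) by apply: h_agree; rewrite lexx ltW.
  have [e' [i' vE]] : exists e' i', v' = rcell e' i'.
    case: (word_left_cases v') => [E|[e' [i' E]]]; last by exists e', i'.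
    have := L_wv fv; rewrite wv_rcell E wv_cat wv_nseq0 mulr0 addr0 -{1}fl.
    by move=> /thompson_inj d_l; move: d_gt; rewrite d_l ltxx.
  rewrite vE rcell_cat in fv; have fd := L_rcell_wmid fv.
  have [m [m' hm]] := germ_right (etrans hd fd).
  have hm1 := L_rcellD (i := i + i') hm.
  have [s [Hs s_id sr]] := right_shift e (m + i').
  have [s' [Hs' s'_id s'r]] := right_shift e' (m' + i).
  exists (s'^-1 * (h * s))%g; first by do ?[exact: subgroupV|apply: subgroupM => //].
  move=> x /andP[lx xr]; have [xd|dx] := leP x (wmid (rho ++ e)).
    rewrite !thompson_mulEx s_id ?lx // h_agree ?lx //.
    rewrite -{1}(s'_id (f x)) ?thompson_invK //.
    by rewrite -{1}fl -fd !thompson_le lx.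
  have gL : L (s'^-1 * (h * s))%g (rcell (rho ++ e) i) (rcell (rho ++ e') i').
    apply: L_mul (L_inv (L_rcellD (i := i') s'r)) (L_mul _ (L_rcellD (i := i) sr)).
    have -> : (m + i' + i = m + (i + i'))%N by lia.
    by have -> : (m' + i + i' = m' + (i + i'))%N by lia.
  by rewrite gL ?fv //; apply/dyadic_itvE; rewrite wv_rcell xr ltW.
rewrite !rcons_cat => ext0 ext1 w' _ h Hh h_agree.
have [|h1 Hh1 h1_agree] := ext0 _ erefl h Hh.
  by move=> x; rewrite -rcons_cat wv_rcons0; exact: h_agree.
have [|h2 Hh2 h2_agree] := ext1 _ erefl h1 Hh1.
  by move=> x; rewrite -rcons_cat -/(wmid (rho ++ w)) -wr_rcons0 rcons_cat; exact: h1_agree.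
by exists h2 => // x; rewrite -(wr_rcons1 R (rho ++ w)) rcons_cat; exact: h2_agree.
Qed.

End Gluing.


(** * Commutators of compactly supported elements *)

Lemma commutator_absorb (G : groupType) (f f' y : G) : (f' * y = y * f')%g ->
  (f * f' * f^-1 * f'^-1 = f * y * (f' * (f * y)^-1 * f'^-1))%g.
Proof. by move=> yf'; rewrite invgM !mulgA -(mulgA f y f') -yf' !mulgA mulgK. Qed.

Section LocalCommutators.
Variable R : realType.
Implicit Types (u v w y z c e : seq bool) (f g h k p q s : thompsonF R) (x t : R).

Notation wv := (word_val R).
Notation L f u v := (maps_linearly (thompson_fun f) u v).

Lemma supp_compact (a b : R) f : 0 < a -> b < 1 -> supp_in a b f -> compact f.
Proof.
move=> a0 b1 fab; have [|n] := @exists_half_pow_lt R (Num.min a (1 - b)).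
  by rewrite lt_min a0 subr_gt0.
rewrite lt_min => /andP[na nb]; exists n; split; apply/L_fixP => x.
  by rewrite wv_nseq0 /wr wv_nseq0 size_nseq add0r => xn; apply: fab; left; lra.
have := wr_nseq1 R n; rewrite /wr size_nseq => E xn; apply: fab; right; lra.
Qed.

Lemma supp_in_inv (a b : R) f : supp_in a b f -> supp_in a b f^-1%g.
Proof. by move=> fab x xab; rewrite -{1}(fab x xab) thompson_invK. Qed.

Lemma supp_in_mul (a b : R) f g : supp_in a b f -> supp_in a b g -> supp_in a b (f * g)%g.
Proof. by move=> fab gab x xab; rewrite thompson_mulEx gab ?fab. Qed.

Lemma supp_in_bounds (a b x : R) f : a <= b -> supp_in a b f -> a <= x <= b -> a <= f x <= b.
Proof.
move=> ab fab; have fa : f a = a by apply: fab; left.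
by have fb : f b = b by [apply: fab; right]; move=> ?; rewrite -{1}fa -{1}fb !thompson_le.
Qed.

Lemma disjoint_commute (a b : R) f g : a <= b -> supp_in a b f ->
  (forall x, a <= x <= b -> g x = x) -> (f * g = g * f)%g.
Proof.
move=> ab fab gfix; apply: thompson_eqP => x; rewrite !thompson_mulEx.
have ga : g a = a by apply: gfix; rewrite lexx.
have gb : g b = b by apply: gfix; rewrite lexx ab.
have [ax|xa] := leP a x; last first.
  have gx : g x <= a by rewrite -ga thompson_le ltW.
  by rewrite (fab x); [rewrite fab //; left|left; exact: ltW].
have [xb|bx] := leP x b; last first.
  have gx : b <= g x by rewrite -gb thompson_le ltW.
  by rewrite (fab x); [rewrite fab //; right|right; exact: ltW].
by rewrite (gfix x) ?ax // gfix // supp_in_bounds ?ax.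
Qed.

(** The quotient of h and f is the identity on the support of k. *)
Lemma conj_agree (a b : R) f h k : a <= b -> supp_in a b k ->
  (forall x, a <= x <= b -> h x = f x) -> (h * k * h^-1 = f * k * f^-1)%g.
Proof.
move=> ab kab hf; have hfk : (f^-1 * h * k = k * (f^-1 * h))%g.
  apply/esym/(disjoint_commute ab kab) => x xab.
  by rewrite thompson_mulEx hf // thompson_invK.
apply: (mulgI f^-1%g); apply: (mulIg h); rewrite -!mulgA mulVg mulg1.
by rewrite !mulgA mulVg mul1g hfk -!mulgA.
Qed.

Variable H : set (thompsonF R).
Hypothesis sgH : is_subgroup H.

(** As maps are composed from right to left, this variant is easier to follow
    than [[~ f, g]], which is [f^-1 * g^-1 * f * g]. *)
Definition comm f g := (f * g * f^-1 * g^-1)%g.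

Section Self.
Hypothesis ctH : cell_transitive H.
Variable y0 : seq bool.
Hypothesis rgH : right_germ_at H y0.

(** Let q in H be supported in [rho] and move z off itself. By [glue], f agrees on
    the support of q with some h in H, so [f, q] = [h, q] is in H. It is f times
    an element supported in q z, which commutes with f'; so its commutator with
    f' is [f, f']. It is in H, as f' also agrees with an element of H on [rho]. *)
Lemma small_commutators : exists2 z, inner z & forall f f',
  supp_in (wv z) (wr z) f -> supp_in (wv z) (wr z) f' -> H (comm f f').
Proof.
have [rho irho sim] := self_similar_cell sgH ctH rgH.
have glue_rho := glue sgH ctH rgH irho sim.
have rho_le : wv rho <= wr rho by rewrite ltW ?wv_lt_wr.
have [q [u [v [Hq qsupp quv uv suv]]]] : exists q u v, [/\ H q, supp_in (wv rho) (wr rho) q,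
    L q (rho ++ u) v, wv v = wv (rho ++ u) & (size (rho ++ u) < size v)%N].
  have [k [Hk [x kx] ksupp]] := small_element sgH ctH rgH irho.
  have [kl kr] := supp_in_ends ksupp.
  case: (first_piece kl) => [kc|[w [v [kw wE wv_ne _]]]].
    case: kx; have [xc|cx] := leP x (wv rho); first by apply: ksupp; left.
    have [cx'|xc'] := leP (wr rho) x; first by apply: ksupp; right.
    by apply: (L_fixP k rho).1; rewrite ?ltW.
  have [v' vE _] := image_below ksupp kw.
  have := L_first_last kw wv_ne (or_introl (esym wE)); rewrite neq_ltn => /orP[lt|lt].
    by exists k, w, v.
  exists k^-1%g, v', (rho ++ w); rewrite -vE; split => //; first exact: subgroupV.
    exact: supp_in_inv.
  exact: L_inv.
pose z := rcons (rho ++ u) true; have zE : z = rho ++ rcons u true by rewrite /z rcons_cat.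
exists z => [|f f' fz f'z]; first by rewrite zE inner_cat.
have z_le : wv z <= wr z by rewrite ltW ?wv_lt_wr.
have z_rho g : supp_in (wv z) (wr z) g -> supp_in (wv rho) (wr rho) g.
  by apply: supp_inW; rewrite zE ?wv_cat_ge ?wr_cat_le.
have qz : q (wr z) <= wv z.
  rewrite (L_wr (L_rcons (b := true) quv)) wr_rcons1 /z -/(wmid _) wmidE /wr uv lerD2l.
  rewrite -invfM -exprSr lef_pV2 ?posrE ?exprn_gt0 // ler_weXn2l ?ler1n //.
have [h Hh hf] := glue_rho f (z_rho _ fz); have [h' Hh' hf'] := glue_rho f' (z_rho _ f'z).
pose y : thompsonF R := (q * f^-1 * q^-1)%g.
have ysupp : supp_in (q (wv z)) (q (wr z)) y by exact/supp_in_conj/supp_in_inv.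
have yf' : (f' * y = y * f')%g.
  apply: (disjoint_commute z_le f'z) => x /andP[zx _].
  by apply: ysupp; right; exact: le_trans zx.
pose a : thompsonF R := comm f q.
have aE : a = (f * y)%g by rewrite /a /comm /y !mulgA.
have Ha : H a.
  rewrite /a /comm -(conj_agree rho_le qsupp hf).
  by do ?[exact: subgroupV|apply: subgroupM => //].
have asupp : supp_in (wv rho) (wr rho) a.
  have fr := z_rho _ fz.
  by do ?[exact: supp_in_inv|apply: supp_in_mul => //].
have -> : comm f f' = (a * (f' * a^-1 * f'^-1))%g.
  by rewrite aE; exact: commutator_absorb.
rewrite -(conj_agree rho_le (supp_in_inv asupp) hf').
by do ?[exact: subgroupV|apply: subgroupM => //].
Qed.

(** Compressions bring the supports of f and f' into the cell of [small_commutators]. *)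
Lemma compact_commutators f f' : compact f -> compact f' -> H (comm f f').
Proof.
move=> /compact_supp[a [b [a0 ab b1 fab]]] /compact_supp[a' [b' [a'0 a'b' b'1 f'ab]]].
have [z iz zP] := small_commutators.
have [|||g [Hg ga gb]] := @compress _ _ sgH ctH _ _ (Num.min a a') (Num.max b b') rgH iz.
- by rewrite lt_min a0.
- by rewrite ge_min le_max ab.
- by rewrite gt_max b1.
have in_z k (c d : R) : Num.min a a' <= c -> d <= Num.max b b' -> supp_in c d k ->
    supp_in (wv z) (wr z) (g * k * g^-1)%g.
  move=> c_ge d_le kcd; apply: (@supp_inW _ (g c) (g d)); last exact: supp_in_conj.
    by apply: ltW; apply: lt_le_trans ga _; rewrite thompson_le.
  by apply: ltW; apply: le_lt_trans gb; rewrite thompson_le.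
have := zP _ _ (in_z f a b _ _ fab) (in_z f' a' b' _ _ f'ab).
rewrite !ge_min !le_max !lexx !orbT => /(_ isT isT isT isT) Hgg.
have -> : comm f f' = (g^-1 * comm (g * f * g^-1) (g * f' * g^-1) * g)%g.
  by rewrite /comm !invgM !invgK -!mulgA !mulKg mulVg mulg1.
by apply: subgroupM => //; apply: subgroupM => //; exact: subgroupV.
Qed.

End Self.
End LocalCommutators.


(** * Standard elements of F *)

Section Generators.
Variable R : realType.
Implicit Types (u v w y z c e : seq bool) (f g h k p q s : thompsonF R) (x t : R).

Notation wv := (word_val R).
Notation L f u v := (maps_linearly (thompson_fun f) u v).

(** The usual generators of F. *)
Definition fun_A x : R :=
  if (x <= 0) || (1 <= x) then x else if x <= 1 / 4 then 2 * x
  else if x <= 1 / 2 then x + 1 / 4 else (x + 1) / 2.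

Definition fun_B x : R :=
  if (x <= 1 / 2) || (1 <= x) then x else if x <= 5 / 8 then 2 * x - 1 / 2
  else if x <= 3 / 4 then x + 1 / 8 else (x + 1) / 2.

Lemma fun_A_out x : ~ (0 <= x <= 1) -> fun_A x = x.
Proof.
rewrite /fun_A => x01; case: (leP x 0) => //= x0; case: (leP 1 x) => //= x1.
by case: x01; rewrite !ltW.
Qed.

Lemma fun_A1 x : 0 <= x <= 1 / 4 -> fun_A x = 2 * x.
Proof.
rewrite /fun_A => /andP[]; rewrite le_eqVlt => /predU1P[<- _|x0 x4]; first by rewrite lexx /=; ring.
by rewrite leNgt x0 /= x4; case: (leP 1 x) => //=; lra.
Qed.

Lemma fun_A2 x : 1 / 4 <= x <= 1 / 2 -> fun_A x = x + 1 / 4.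
Proof.
rewrite /fun_A => /andP[]; rewrite le_eqVlt => /predU1P[<- _|x4 x2].
  by rewrite -/(fun_A _) fun_A1; lra.
rewrite x2; case: (leP x 0) => /= h; first lra.
by case: (leP 1 x) => /= h'; [lra|case: leP; lra].
Qed.

Lemma fun_A3 x : 1 / 2 <= x <= 1 -> fun_A x = (x + 1) / 2.
Proof.
rewrite /fun_A => /andP[]; rewrite le_eqVlt => /predU1P[<- _|x2].
  by rewrite -/(fun_A _) fun_A2; lra.
rewrite le_eqVlt => /predU1P[->|x1]; first by rewrite lexx orbT; lra.
have -> : (x <= 0) = false by apply/negbTE; rewrite -ltNge; lra.
have -> : (1 <= x) = false by apply/negbTE; rewrite -ltNge; lra.
have -> : (x <= 1 / 4) = false by apply/negbTE; rewrite -ltNge; lra.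
by have -> : (x <= 1 / 2) = false by apply/negbTE; rewrite -ltNge; lra.
Qed.

Lemma fun_B0 x : x <= 1 / 2 -> fun_B x = x.
Proof. by rewrite /fun_B => ->. Qed.

Lemma fun_B_out x : ~ (0 <= x <= 1) -> fun_B x = x.
Proof.
rewrite /fun_B => x01; case: (leP x (1 / 2)) => //= x0; case: (leP 1 x) => //= x1.
by case: x01; rewrite (ltW x1) andbT; lra.
Qed.

Lemma fun_B1 x : 1 / 2 <= x <= 5 / 8 -> fun_B x = 2 * x - 1 / 2.
Proof.
rewrite /fun_B => /andP[]; rewrite le_eqVlt => /predU1P[<- _|x0 x4]; first by rewrite lexx /=; lra.
by rewrite leNgt x0 /= x4; case: (leP 1 x) => //=; lra.
Qed.

Lemma fun_B2 x : 5 / 8 <= x <= 3 / 4 -> fun_B x = x + 1 / 8.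
Proof.
rewrite /fun_B => /andP[]; rewrite le_eqVlt => /predU1P[<- _|x4 x2].
  by rewrite -/(fun_B _) fun_B1; lra.
rewrite x2; case: (leP x (1 / 2)) => /= h; first lra.
by case: (leP 1 x) => /= h'; [lra|case: leP; lra].
Qed.

Lemma fun_B3 x : 3 / 4 <= x <= 1 -> fun_B x = (x + 1) / 2.
Proof.
rewrite /fun_B => /andP[]; rewrite le_eqVlt => /predU1P[<- _|x2].
  by rewrite -/(fun_B _) fun_B2; lra.
rewrite le_eqVlt => /predU1P[->|x1]; first by rewrite lexx orbT; lra.
have -> : (x <= 1 / 2) = false by apply/negbTE; rewrite -ltNge; lra.
have -> : (1 <= x) = false by apply/negbTE; rewrite -ltNge; lra.
have -> : (x <= 5 / 8) = false by apply/negbTE; rewrite -ltNge; lra.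
by have -> : (x <= 3 / 4) = false by apply/negbTE; rewrite -ltNge; lra.
Qed.

Lemma dyadic_frac (k : int) n x : x = k%:~R / 2 ^+ n -> 0 < x < 1 -> dyadic01 x.
Proof. by move=> ->; split=> //; exists k, n. Qed.

Lemma is_thompson_A : is_thompson fun_A.
Proof.
have fE x : 0 <= x <= 1 -> [\/ (0 <= x <= 1 / 4 /\ fun_A x = 2 * x), (1 / 4 <= x <= 1 / 2 /\ fun_A x = x + 1 / 4) | (1 / 2 <= x <= 1 /\ fun_A x = (x + 1) / 2)].
  move=> x01; have [lx0|lx0] := leP x (1 / 4); first by apply: Or31; split; [lra|rewrite fun_A1 //; lra].
  have [lx1|lx1] := leP x (1 / 2); first by apply: Or32; split; [lra|rewrite fun_A2 //; lra].
  by apply: Or33; split; [lra|rewrite fun_A3 //; lra].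
split; first exact: fun_A_out.
- move=> x y x0 xy y1; have x01 : 0 <= x <= 1 by lra.
  have y01 : 0 <= y <= 1 by lra.
  by case: (fE x x01) => -[? ->]; case: (fE y y01) => -[? ->]; lra.
- apply/seteqP; split=> [_ [x /= + <-]|y /=]; rewrite !in_itv /= => x01.
    by case: (fE x x01) => -[? ->]; lra.
  have [ly0|ly0] := leP y (1 / 2).
    by exists (y / 2); [rewrite /= in_itv /=; lra|rewrite fun_A1; lra].
  have [ly1|ly1] := leP y (3 / 4).
    by exists (y - 1 / 4); [rewrite /= in_itv /=; lra|rewrite fun_A2; lra].
  by exists (2 * y - 1); [rewrite /= in_itv /=; lra|rewrite fun_A3; lra].
exists [:: 1 / 4; 1 / 2].
  move=> c; rewrite !inE => /orP[]/eqP->.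
  - by apply: (@dyadic_frac 1 2); lra.
  - by apply: (@dyadic_frac 1 1); lra.
move=> a b a0 ab b1 noB.
have h0 : ~ (a < 1 / 4 < b) by apply: noB; rewrite !inE eqxx ?orbT.
have h1 : ~ (a < 1 / 2 < b) by apply: noB; rewrite !inE eqxx ?orbT.
have [la0|la0] := ltP a (1 / 4).
  have lb0 : b <= 1 / 4 by rewrite leNgt; apply/negP => h; apply: h0; rewrite la0.
  exists (1) => x xab; rewrite expr1z (@fun_A1 x) ?(@fun_A1 a); lra.
have [la1|la1] := ltP a (1 / 2).
  have lb1 : b <= 1 / 2 by rewrite leNgt; apply/negP => h; apply: h1; rewrite la1.
  exists (0) => x xab; rewrite expr0z (@fun_A2 x) ?(@fun_A2 a); lra.
exists (-1) => x xab; rewrite exprN1 (@fun_A3 x) ?(@fun_A3 a); lra.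
Qed.

Lemma is_thompson_B : is_thompson fun_B.
Proof.
have fE x : 0 <= x <= 1 -> [\/ (0 <= x <= 1 / 2 /\ fun_B x = x), (1 / 2 <= x <= 5 / 8 /\ fun_B x = 2 * x - 1 / 2), (5 / 8 <= x <= 3 / 4 /\ fun_B x = x + 1 / 8) | (3 / 4 <= x <= 1 /\ fun_B x = (x + 1) / 2)].
  move=> x01; have [lx0|lx0] := leP x (1 / 2); first by apply: Or41; split; [lra|rewrite fun_B0 //; lra].
  have [lx1|lx1] := leP x (5 / 8); first by apply: Or42; split; [lra|rewrite fun_B1 //; lra].
  have [lx2|lx2] := leP x (3 / 4); first by apply: Or43; split; [lra|rewrite fun_B2 //; lra].
  by apply: Or44; split; [lra|rewrite fun_B3 //; lra].
split; first exact: fun_B_out.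
- move=> x y x0 xy y1; have x01 : 0 <= x <= 1 by lra.
  have y01 : 0 <= y <= 1 by lra.
  by case: (fE x x01) => -[? ->]; case: (fE y y01) => -[? ->]; lra.
- apply/seteqP; split=> [_ [x /= + <-]|y /=]; rewrite !in_itv /= => x01.
    by case: (fE x x01) => -[? ->]; lra.
  have [ly0|ly0] := leP y (1 / 2).
    by exists (y); [rewrite /= in_itv /=; lra|rewrite fun_B0; lra].
  have [ly1|ly1] := leP y (3 / 4).
    by exists (y / 2 + 1 / 4); [rewrite /= in_itv /=; lra|rewrite fun_B1; lra].
  have [ly2|ly2] := leP y (7 / 8).
    by exists (y - 1 / 8); [rewrite /= in_itv /=; lra|rewrite fun_B2; lra].
  by exists (2 * y - 1); [rewrite /= in_itv /=; lra|rewrite fun_B3; lra].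
exists [:: 1 / 2; 5 / 8; 3 / 4].
  move=> c; rewrite !inE => /or3P[]/eqP->.
  - by apply: (@dyadic_frac 1 1); lra.
  - by apply: (@dyadic_frac 5 3); lra.
  - by apply: (@dyadic_frac 3 2); lra.
move=> a b a0 ab b1 noB.
have h0 : ~ (a < 1 / 2 < b) by apply: noB; rewrite !inE eqxx ?orbT.
have h1 : ~ (a < 5 / 8 < b) by apply: noB; rewrite !inE eqxx ?orbT.
have h2 : ~ (a < 3 / 4 < b) by apply: noB; rewrite !inE eqxx ?orbT.
have [la0|la0] := ltP a (1 / 2).
  have lb0 : b <= 1 / 2 by rewrite leNgt; apply/negP => h; apply: h0; rewrite la0.
  exists (0) => x xab; rewrite expr0z (@fun_B0 x) ?(@fun_B0 a); lra.
have [la1|la1] := ltP a (5 / 8).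
  have lb1 : b <= 5 / 8 by rewrite leNgt; apply/negP => h; apply: h1; rewrite la1.
  exists (1) => x xab; rewrite expr1z (@fun_B1 x) ?(@fun_B1 a); lra.
have [la2|la2] := ltP a (3 / 4).
  have lb2 : b <= 3 / 4 by rewrite leNgt; apply/negP => h; apply: h2; rewrite la2.
  exists (0) => x xab; rewrite expr0z (@fun_B2 x) ?(@fun_B2 a); lra.
exists (-1) => x xab; rewrite exprN1 (@fun_B3 x) ?(@fun_B3 a); lra.
Qed.

Definition el_A : thompsonF R := thompson_of is_thompson_A.
Definition el_B : thompsonF R := thompson_of is_thompson_B.

Lemma el_AE x : el_A x = fun_A x.
Proof. by []. Qed.

Lemma el_BE x : el_B x = fun_B x.
Proof. by []. Qed.

Lemma L_of_formula f u v (r s : R) : 2 ^+ size u / 2 ^+ size v = r ->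
  wv v - r * wv u = s -> (forall x, wv u <= x <= wr u -> f x = r * x + s) -> L f u v.
Proof. by move=> <- <- fE x ux; rewrite fE //; ring. Qed.

Ltac formula r s fE :=
  apply: (@L_of_formula _ _ _ r s); [by rewrite /=; field|by rewrite /=; field|
    rewrite /wr /= !exprS expr0 => x xu; rewrite ?el_AE ?el_BE fE; lra].

Lemma el_A00 : L el_A [:: false; false] [:: false].
Proof. formula (2 : R) (0 : R) fun_A1. Qed.

Lemma el_A01 : L el_A [:: false; true] [:: true; false].
Proof. formula (1 : R) (1 / 4 : R) fun_A2. Qed.

Lemma el_A1 : L el_A [:: true] [:: true; true].
Proof. formula (1 / 2 : R) (1 / 2 : R) fun_A3. Qed.

Lemma el_B0 : L el_B [:: false] [:: false].
Proof. formula (1 : R) (0 : R) fun_B0. Qed.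

Lemma el_B100 : L el_B [:: true; false; false] [:: true; false].
Proof. formula (2 : R) (- 1 / 2 : R) fun_B1. Qed.

Lemma el_B101 : L el_B [:: true; false; true] [:: true; true; false].
Proof. formula (1 : R) (1 / 8 : R) fun_B2. Qed.

Lemma el_B11 : L el_B [:: true; true] [:: true; true; true].
Proof. formula (1 / 2 : R) (1 / 2 : R) fun_B3. Qed.

Definition el_C : thompsonF R := (el_B^-1 * el_A)%g.

Lemma el_C00 : L el_C [:: false; false] [:: false].
Proof. exact: L_mul (L_inv el_B0) el_A00. Qed.

Lemma el_C01 : L el_C [:: false; true] [:: true; false; false].
Proof. exact: L_mul (L_inv el_B100) el_A01. Qed.

Lemma el_C10 : L el_C [:: true; false] [:: true; false; true].
Proof. exact: L_mul (L_inv el_B101) (L_cat (w := [:: false]) el_A1). Qed.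

Lemma el_C11 : L el_C [:: true; true] [:: true; true].
Proof. exact: L_mul (L_inv el_B11) (L_cat (w := [:: true]) el_A1). Qed.

End Generators.


(** * Generation of the derived subgroup *)

Section Derived.
Variable R : realType.
Implicit Types (f g h k s : thompsonF R) (x t : R).

Notation wv := (word_val R).
Notation L f u v := (maps_linearly (thompson_fun f) u v).
Notation A := (el_A R).
Notation B := (el_B R).
Notation C := (el_C R).

(** They generate the germs of F at 0 and at 1, and are supported in [0^(n+1)] and
    [1^(n+1)]; conjugation by powers of A moves them closer to the ends. *)
Definition end0 n : thompsonF R := ((A ^+ n)^-1 * ((A^-1 * (C * A)) * A ^+ n))%g.
Definition end1 n : thompsonF R := (A ^+ n * (B * (A ^+ n)^-1))%g.

Lemma el_A_pow0 n : L (A ^+ n)%g (nseq n.+1 false) (nseq 1 false).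
Proof.
elim: n => [|n IHn]; first by rewrite expg0; exact: L_id.
rewrite expgS; apply: (L_mul (v := nseq 2 false)); first exact: el_A00.
by have := L_cat (w := nseq 1 false) IHn; rewrite -!nseqD addn1.
Qed.

Lemma el_A_pow1 n : L (A ^+ n)%g (nseq 1 true) (nseq n.+1 true).
Proof.
elim: n => [|n IHn]; first by rewrite expg0; exact: L_id.
rewrite expgS; apply: L_mul IHn; exact: (L_cat (w := nseq n true) (@el_A1 R)).
Qed.

Lemma end0_id n x : wr (nseq n.+1 false) <= x -> end0 n x = x.
Proof.
move=> nx; have Ax : 1 / 2 <= thompson_fun (A ^+ n)%g x.
  have <- : wr (nseq 1 false) = 1 / 2 :> R by rewrite /wr /=; lra.
  by rewrite -(L_wr (@el_A_pow0 n)) thompson_le.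
rewrite /end0 thompson_mulEx (thompson_mulEx _ (A ^+ n)%g).
suff -> : thompson_fun (A^-1 * (C * A))%g (thompson_fun (A ^+ n)%g x) = thompson_fun (A ^+ n)%g x.
  exact: thompson_invK.
move: (thompson_fun (A ^+ n)%g x) Ax => t t2.
have [t1|t1] := leP 1 t; first by apply: thompson_out; right.
apply: (L_fixP _ [:: true]).1; last by rewrite /wr /=; lra.
exact: L_mul (L_inv (@el_A1 R)) (L_mul (@el_C11 R) (@el_A1 R)).
Qed.

Lemma end1_id n x : x <= wv (nseq n.+1 true) -> end1 n x = x.
Proof.
move=> nx; have Ax : thompson_fun (A ^+ n)^-1%g x <= 1 / 2.
  have <- : wv (nseq 1 true) = 1 / 2 :> R by rewrite /=; lra.
  by rewrite thompson_inv_le (L_wv (@el_A_pow1 n)).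
rewrite /end1 !thompson_mulEx.
suff -> : B (thompson_fun (A ^+ n)^-1%g x) = thompson_fun (A ^+ n)^-1%g x.
  exact: thompson_invVK.
by rewrite el_BE fun_B0.
Qed.

Lemma end0_germ n i : L (end0 n) (nseq (n + i).+3 false) (nseq (n + i).+2 false).
Proof.
have A0 j : L (A ^+ n)%g (nseq (n.+1 + j) false) (nseq (1 + j) false).
  by rewrite !nseqD; exact: L_cat (@el_A_pow0 n).
apply: (L_mul (v := nseq (1 + i.+1) false)).
  by have := L_inv (A0 i.+1); have -> : (n.+1 + i.+1 = (n + i).+2)%N by lia.
apply: (L_mul (v := nseq (1 + i.+2) false)); last first.
  by have := A0 i.+2; have -> : (n.+1 + i.+2 = (n + i).+3)%N by lia.
apply: (L_mul (L_inv (L_cat (w := nseq i false) (@el_A00 R)))).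
apply: (L_mul (v := nseq 2 false ++ nseq i false)); first exact: L_cat (@el_C00 R).
exact: (L_cat (w := nseq i.+1 false) (@el_A00 R)).
Qed.

Lemma end1_germ n i : L (end1 n) (nseq (n + i).+2 true) (nseq (n + i).+3 true).
Proof.
have A1 j : L (A ^+ n)%g (nseq (1 + j) true) (nseq (n.+1 + j) true).
  by rewrite !nseqD; exact: L_cat (@el_A_pow1 n).
apply: (L_mul (v := nseq (1 + i.+2) true)).
  by have := A1 i.+2; have -> : (n.+1 + i.+2 = (n + i).+3)%N by lia.
apply: (L_mul (v := nseq (1 + i.+1) true)); first exact: (L_cat (w := nseq i true) (@el_B11 R)).
by have := L_inv (A1 i.+1); have -> : (n.+1 + i.+1 = (n + i).+2)%N by lia.
Qed.

Lemma end0_pow n j : L (end0 n ^+ j)%g (nseq (j + n.+2) false) (nseq n.+2 false).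
Proof.
elim: j => [|j IHj]; first by rewrite expg0; exact: L_id.
rewrite expgSr; apply: (L_mul IHj); have := @end0_germ n j.
have -> : (j.+1 + n.+2 = (n + j).+3)%N by lia.
by have -> : (j + n.+2 = (n + j).+2)%N by lia.
Qed.

Lemma end1_pow n j : L (end1 n ^+ j)%g (nseq n.+2 true) (nseq (j + n.+2) true).
Proof.
elim: j => [|j IHj]; first by rewrite expg0; exact: L_id.
rewrite expgS; apply: L_mul IHj; have := @end1_germ n j.
have -> : (j.+1 + n.+2 = (n + j).+3)%N by lia.
by have -> : (j + n.+2 = (n + j).+2)%N by lia.
Qed.

Lemma fix_inv f x : f x = x -> thompson_fun f^-1%g x = x.
Proof. by move=> fx; rewrite -{1}fx thompson_invK. Qed.

(** Powers of [end0 n] and [end1 n] cancel the germs of f at 0 and at 1. *)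
Lemma compact_correction f n : exists s, [/\ compact (s * f)%g,
  forall x, wr (nseq n.+1 false) <= x <= wv (nseq n.+1 true) -> s x = x &
  forall K, is_subgroup K -> K (end0 n) -> K (end1 n) -> K s].
Proof.
have [p [p' fp]] := germ_end f false; have [q [q' fq]] := germ_end f true.
pose s0 : thompsonF R := ((end0 n ^+ p)^-1 * end0 n ^+ p')%g.
pose s1 : thompsonF R := (end1 n ^+ q * (end1 n ^+ q')^-1)%g.
have half0 : wr (nseq n.+1 false) <= 1 / 2 :> R.
  rewrite /wr wv_nseq0 size_nseq add0r exprS invfM mul1r ler_piMr // invf_le1 ?exprn_gt0 //.
  by rewrite exprn_ege1 // ler1n.
have half1 : 1 / 2 <= wv (nseq n.+1 true).
  by rewrite -[nseq _ _]/(true :: nseq n true) wv_cons /=; have := wv_ge0 R (nseq n true); lra.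
have s0_id x : wr (nseq n.+1 false) <= x -> s0 x = x.
  move=> nx; rewrite /s0 thompson_mulEx (fix_pow _ (end0_id nx)).
  exact/fix_inv/fix_pow/end0_id.
have s1_id x : x <= wv (nseq n.+1 true) -> s1 x = x.
  move=> nx; rewrite /s1 thompson_mulEx (fix_inv (fix_pow _ (end1_id nx))).
  exact/fix_pow/end1_id.
have ends m : (0 < m)%N -> 2 ^- m <= 1 / 2 :> R.
  by case: m => // m _; rewrite exprS invfM mul1r ler_piMr // invf_le1 ?exprn_gt0 // exprn_ege1 // ler1n.
have s1_left m : (0 < m)%N -> L s1 (nseq m false) (nseq m false).
  move=> m0; apply/L_fixP => x; rewrite wv_nseq0 => /andP[_ xm]; apply: s1_id.
  apply: le_trans xm (le_trans _ half1).
  by rewrite /wr wv_nseq0 size_nseq add0r ends.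
have s0_right m : (0 < m)%N -> L s0 (nseq m true) (nseq m true).
  move=> m0; apply/L_fixP => x; rewrite wr_nseq1 => /andP[mx _]; apply: s0_id.
  apply: le_trans half0 (le_trans _ mx); have := wr_nseq1 R m; rewrite /wr size_nseq.
  have := ends m m0; lra.
exists (s0 * s1)%g; split.
- exists (p + n.+2 + (q + n.+2))%N; split.
    apply: L_nseqD; apply: (L_mul (v := nseq (p' + n.+2) false)); last exact: L_nseqD.
    apply: (L_mul (v := nseq (p' + n.+2) false)); last by apply: s1_left; lia.
    exact: L_mul (L_inv (@end0_pow n p)) (@end0_pow n p').
  rewrite addnC; apply: L_nseqD; apply: (L_mul (v := nseq (q' + n.+2) true)); last exact: L_nseqD.
  apply: (L_mul (v := nseq (q + n.+2) true)); first by apply: s0_right; lia.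
  exact: L_mul (@end1_pow n q) (L_inv (@end1_pow n q')).
- by move=> x /andP[nx xn]; rewrite thompson_mulEx s1_id // s0_id.
move=> K sgK K0 K1; apply: subgroupM => //; apply: subgroupM => //.
- by apply: subgroupV => //; exact: subgroupX.
- exact: subgroupX.
- exact: subgroupX.
by apply: subgroupV => //; exact: subgroupX.
Qed.

Lemma compact_conj f g : compact f -> compact (f ^ g)%g.
Proof.
move=> /compact_supp[a [b [a0 ab b1 fab]]].
have := supp_in_conj (g := g^-1%g) fab; rewrite invgK -mulgA.
apply: supp_compact.
  by rewrite -(thompson_out g^-1%g (x := 0)) ?thompson_lt //; left.
by rewrite -[X in _ < X](thompson_out g^-1%g (x := 1)) ?thompson_lt //; right.
Qed.

(** Let K be generated by these commutators; K is normal. A compactly supported f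
    is central modulo K: any g differs from a compactly supported element by
    some s which is trivial on the support of f. Moreover F is generated by the
    compactly supported elements and the commuting elements [end0 0], [end1 0],
    so F / K is abelian. *)
Lemma derived_compact (H : set (thompsonF R)) : is_subgroup H ->
  (forall f g, compact f -> compact g -> H [~ f, g]%g) ->
  @derived_subgroup (thompsonF R) `<=` H.
Proof.
move=> sgH compH.
pose X := [set z | exists f g : thompsonF R, [/\ compact f, compact g & z = [~ f, g]%g]].
pose K := smallest (@is_subgroup (thompsonF R)) X.
have sgK : is_subgroup K := smallest_subgroup X.
have nK : forall k g, K k -> K (k ^ g)%g.
  apply: smallest_normal => z g [f1 [f2 [c1 c2 ->]]].
  by exists (f1 ^ g)%g, (f2 ^ g)%g; rewrite conjRg; split => //; exact: compact_conj.
have KH : K `<=` H by apply: smallest_sub => // z [f [g [cf cg ->]]]; exact: compH.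
have K_sym f g : K [~ f, g]%g -> K [~ g, f]%g.
  by move=> Kfg; rewrite -invgR; exact: subgroupV sgK Kfg.
have K_commute f g : (f * g = g * f)%g -> K [~ f, g]%g.
  by move=> /commgP/eqP->; exact: subgroup1 sgK.
have K_compact f g : compact f -> K [~ f, g]%g.
  move=> cf; have [a [b [a0 ab b1 fab]]] := compact_supp cf.
  have [|n] := @exists_half_pow_lt R (Num.min a (1 - b)); first by rewrite lt_min a0 subr_gt0.
  rewrite lt_min => /andP[na nb].
  have nn : 2 ^- n.+1 <= 2 ^- n :> R by rewrite lef_pV2 ?posrE ?exprn_gt0 // ler_weXn2l ?ler1n.
  have [s [csg s_id _]] := compact_correction g n.
  have fs : (f * s = s * f)%g.
    apply: (disjoint_commute ab fab) => x /andP[ax xb]; apply: s_id.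
    have := wr_nseq1 R n.+1; rewrite /wr wv_nseq0 !size_nseq; lra.
  have -> : [~ f, g]%g = [~ f, s * g]%g.
    by rewrite /commg /conjg invgM (mulgA f) fs !mulgA mulgVK.
  by apply: sub_gen_smallest; exists f, (s * g)%g.
have gen (S : set (thompsonF R)) : is_subgroup S -> (forall f, compact f -> S f) ->
    S (end0 0) -> S (end1 0) -> forall g, S g.
  move=> sgS Sc S0 S1 g; have [s [csg _ sS]] := compact_correction g 0.
  have -> : g = (s^-1 * (s * g))%g by rewrite mulKg.
  by apply: subgroupM => //; [apply: subgroupV => //; exact: sS|exact: Sc].
have end01 : (end0 0 * end1 0 = end1 0 * end0 0)%g.
  have supp0 : supp_in 0 (1 / 2) (end0 0).
    move=> x [x0|x2]; first by apply: thompson_out; left.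
    by apply: end0_id; rewrite /wr /=; lra.
  apply: (disjoint_commute _ supp0) => [|x /andP[_ x2]]; first lra.
  by apply: end1_id; rewrite /=; lra.
have K0 g : K [~ end0 0, g]%g.
  apply: (gen _ (centralizer_mod_subgroup (end0 0) sgK nK)) => //=.
  - move=> f cf; apply: K_sym; exact: K_compact.
  - exact: K_commute.
  - exact: K_commute.
have K1 g : K [~ end1 0, g]%g.
  apply: (gen _ (centralizer_mod_subgroup (end1 0) sgK nK)) => //=.
  - move=> f cf; apply: K_sym; exact: K_compact.
  - by apply: K_commute; rewrite end01.
  - exact: K_commute.
apply: smallest_sub => // z [x [y ->]]; apply: KH.
apply: (gen _ (centralizer_mod_subgroup x sgK nK)) => /= [f cf||]; apply: K_sym.
- exact: K_compact.
- exact: K0.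
- exact: K1.
Qed.

End Derived.


(** * Slopes and germs *)

Section Slopes.
Variable R : realType.
Implicit Types (u v w y z c e : seq bool) (f g h k p q s : thompsonF R) (x t a : R).

Notation wv := (word_val R).
Notation L f u v := (maps_linearly (thompson_fun f) u v).

Lemma contains_derived (H : set (thompsonF R)) y : is_subgroup H ->
  cell_transitive H -> right_germ_at H y -> @derived_subgroup (thompsonF R) `<=` H.
Proof.
move=> sgH ctH rgH; apply: derived_compact => // f g cf cg.
have compact_inv f' : compact f' -> compact f'^-1%g.
  by move=> [n [f0 f1]]; exists n; split; exact: L_inv.
have := compact_commutators sgH ctH rgH (compact_inv _ cf) (compact_inv _ cg).
by rewrite /comm /commg /conjg !invgK !mulgA.
Qed.

Lemma right_slope_linear (f : R -> R) a (r d : R) : 0 < d ->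
  (forall x, a <= x <= a + d -> f x = f a + r * (x - a)) -> right_slope f a r.
Proof.
move=> d0 fE; apply: cvg_near_cst; near=> x.
have ax : a < x by near: x; exact: nbhs_right_gt.
have xd : x <= a + d by near: x; apply: nbhs_right_le; rewrite ltrDl.
rewrite (fE x) /=; last by rewrite (ltW ax) xd.
by rewrite [f a + _]addrC addrK mulfK // subr_eq0 gt_eqF.
Unshelve. all: by end_near. Qed.

Lemma left_slope_linear (f : R -> R) a (r d : R) : 0 < d ->
  (forall x, a - d <= x <= a -> f x = f a + r * (x - a)) -> left_slope f a r.
Proof.
move=> d0 fE; apply: cvg_near_cst; near=> x.
have ax : x < a by near: x; exact: nbhs_left_lt.
have xd : a - d <= x by near: x; apply: nbhs_left_ge; rewrite ltrBlDr ltrDl.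
rewrite (fE x) /=; last by rewrite xd (ltW ax).
by rewrite [f a + _]addrC addrK mulfK // subr_eq0 lt_eqF.
Unshelve. all: by end_near. Qed.

Lemma right_slope_unique (f : R -> R) a (r r' : R) : right_slope f a r -> right_slope f a r' -> r = r'.
Proof. by move=> h h'; exact: (cvg_unique _ h h'). Qed.

Lemma left_slope_unique (f : R -> R) a (r r' : R) : left_slope f a r -> left_slope f a r' -> r = r'.
Proof. by move=> h h'; exact: (cvg_unique _ h h'). Qed.

Lemma L_right_slope f y n m : L f (rcell y n) (rcell y m) -> right_slope f (wmid y) (2 ^+ n / 2 ^+ m).
Proof.
move=> fr; apply: (right_slope_linear (wlen_gt0 R (size (rcell y n)))) => x xy.
rewrite (L_rcell_wmid fr) fr; last by rewrite /Defs.dyadic_itv /= wv_rcell.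
rewrite !wv_rcell !size_cat /= !size_nseq !exprD !exprS.
by field; rewrite !expr2_neq0.
Qed.

Lemma L_left_slope f y n m : L f (lcell y n) (lcell y m) -> left_slope f (wmid y) (2 ^+ n / 2 ^+ m).
Proof.
move=> fl; apply: (left_slope_linear (wlen_gt0 R (size (lcell y n)))) => x xy.
have E : wv (lcell y n) = wmid y - 2 ^- size (lcell y n) by have := wr_lcell R y n; rewrite /wr; lra.
have E' : wv (lcell y m) = wmid y - 2 ^- size (lcell y m) by have := wr_lcell R y m; rewrite /wr; lra.
rewrite (L_lcell_wmid fl) fl; last by rewrite /Defs.dyadic_itv /= E subrK.
rewrite E E' !size_cat /= !size_nseq !exprD !exprS.
by field; rewrite !expr2_neq0.
Qed.

Lemma right_germ_of_slopes (H : set (thompsonF R)) h a : H h -> dyadic01 a -> h a = a ->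
  left_slope h a 1 -> right_slope h a 2 -> exists y, right_germ_at H y.
Proof.
move=> Hh /dyadic01_wmid[y ->] hy hl hr; exists y.
have [n [m hnm]] := germ_left hy; have [n' [m' hnm']] := germ_right hy.
have /(congr1 ( *%R^~ (2 ^+ m))) := left_slope_unique hl (L_left_slope hnm).
rewrite mul1r mulfVK ?expr2_neq0 // => E.
have mn : n = m.
  apply/eqP; have : (2 ^ m == 2 ^ n :> nat)%N by rewrite -(eqr_nat R) !natrX E.
  by rewrite eqn_exp2l // eq_sym.
have /(congr1 ( *%R^~ (2 ^+ m'))) := right_slope_unique hr (L_right_slope hnm').
rewrite mulfVK ?expr2_neq0 // -exprS => E'.
have n'm' : n' = m'.+1.
  apply/eqP; have : (2 ^ m'.+1 == 2 ^ n' :> nat)%N by rewrite -(eqr_nat R) !natrX E'.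
  by rewrite eqn_exp2l // eq_sym.
by exists h, m, m'; rewrite mn in hnm; rewrite n'm' in hnm'.
Qed.

Lemma slopes_of_right_germ (H : set (thompsonF R)) h y n m : H h ->
  L h (lcell y m) (lcell y m) -> L h (rcell y n.+1) (rcell y n) ->
  exists a, [/\ dyadic01 a, h a = a, left_slope h a 1 & right_slope h a 2].
Proof.
move=> Hh hl hr; exists (wmid y); split; first exact: wmid_dyadic01.
- exact: L_lcell_wmid hl.
- by have := L_left_slope hl; rewrite divff ?expr2_neq0.
by have := L_right_slope hr; rewrite exprS mulfK ?expr2_neq0.
Qed.

End Slopes.


(** * Cells and germs of the derived subgroup *)

Section CellMoves.
Variable R : realType.
Implicit Types (u v w y z c e : seq bool) (f g h k p q s : thompsonF R) (x t a : R).

Notation L f u v := (maps_linearly (thompson_fun f) u v).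
Notation B := (el_B R).
Notation C := (el_C R).

(** Every inner word is brought to 10 by B, C and their inverses, which shorten it
    or change its first letters; each of them is the identity on an inner cell e,
    namely 01 or 110. The latter is what allows one to pass to commutators. *)
Lemma inner_word_moves (Q : seq bool -> Prop) : Q [:: true; false] ->
  (forall g e u u', inner e -> L g e e -> inner u -> L g u u' -> Q u' -> Q u) ->
  forall u, inner u -> Q u.
Proof.
move=> Q10 step.
have fixB : L B [:: false; true] [:: false; true] := L_cat (w := [:: true]) (@el_B0 R).
have fixC : L C [:: true; true; false] [:: true; true; false] := L_cat (w := [:: false]) (@el_C11 R).
have iB : inner [:: false; true] by [].
have iC : inner [:: true; true; false] by [].
have stepB u u' w : inner (u ++ w) -> L B u u' -> Q (u' ++ w) -> Q (u ++ w).
  by move=> iu Buu; apply: (step B _ _ _ iB fixB iu); exact: L_cat.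
have stepBV u u' w : inner (u' ++ w) -> L B u u' -> Q (u ++ w) -> Q (u' ++ w).
  by move=> iu Buu; apply: (step B^-1%g _ _ _ iB (L_inv fixB) iu); apply: L_inv; exact: L_cat.
have stepC u u' w : inner (u ++ w) -> L C u u' -> Q (u' ++ w) -> Q (u ++ w).
  by move=> iu Cuu; apply: (step C _ _ _ iC fixC iu); exact: L_cat.
have stepCV u u' w : inner (u' ++ w) -> L C u u' -> Q (u ++ w) -> Q (u' ++ w).
  by move=> iu Cuu; apply: (step C^-1%g _ _ _ iC (L_inv fixC) iu); apply: L_inv; exact: L_cat.
move=> u; have [n] := ubnP (size u); elim: n u => // n IHn.
have Q1 u : (size u < n)%N -> inner (true :: u) -> Q (true :: u).
  case: u => [|[] u] //.
    case: u => [|[] w] // un iu.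
      apply: (stepBV [:: true; true] [:: true; true; true] w iu (@el_B11 R)); apply: IHn; first by move: un => /=; lia.
      by move: iu; rewrite /inner !inE.
    apply: (stepBV [:: true; false; true] [:: true; true; false] w iu (@el_B101 R)); apply: (stepCV [:: true; false] [:: true; false; true] w) => //; first exact: el_C10.
    by apply: IHn => //; move: un => /=; lia.
  case: u => [|[] w] // un iu.
    apply: (stepCV [:: true; false] [:: true; false; true] w iu (@el_C10 R)); apply: IHn => //; move: un => /=; lia.
  apply: (stepB [:: true; false; false] [:: true; false] w iu (@el_B100 R)); apply: IHn => //; move: un => /=; lia.
case=> [|[] u] //; rewrite ltnS => un iu; first exact: Q1.
case: u un iu => [|[] w] // un iu.
  apply: (stepC [:: false; true] [:: true; false; false] w iu (@el_C01 R)); apply: (stepB [:: true; false; false] [:: true; false] w) => //; first exact: el_B100.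
  exact: Q1.
apply: (stepC [:: false; false] [:: false] w iu (@el_C00 R)); apply: IHn; first by move: un => /=; lia.
by move: iu; rewrite /inner !inE.
Qed.

Lemma inner_cells_F u v : inner u -> inner v -> exists f, L f u v.
Proof.
have to10 w : inner w -> exists f, L f w [:: true; false].
  apply: (@inner_word_moves (fun w => exists f, L f w [:: true; false])) => [|g e x x' _ _ _ gx [f fx']]; first by exists 1%g; exact: L_id.
  by exists (f * g)%g; exact: L_mul fx' gx.
move=> /to10[f fu] /to10[g gv]; exists (g^-1 * f)%g.
exact: L_mul (L_inv gv) fu.
Qed.

Lemma derived_is_subgroup : is_subgroup (@derived_subgroup (thompsonF R)).
Proof. exact: smallest_subgroup. Qed.

(** If g is the identity on [e] and y maps [e] onto [u], then y g^-1 y^-1 is the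
    identity on [u], so that g agrees on [u] with the commutator g (y g^-1 y^-1). *)
Lemma inner_cells_derived u v : inner u -> inner v ->
  exists2 f, @derived_subgroup (thompsonF R) f & L f u v.
Proof.
have sgD := derived_is_subgroup.
have to10 w : inner w -> exists2 f, @derived_subgroup (thompsonF R) f & L f w [:: true; false].
  apply: (@inner_word_moves (fun w => exists2 f, @derived_subgroup (thompsonF R) f &
    L f w [:: true; false])) => [|g e x x' ie gee ix gx [f Df fx']].
    by exists 1%g; [exact: subgroup1 sgD|exact: L_id].
  have [y ye] := inner_cells_F ie ix.
  exists (f * (g * (y * (g^-1 * y^-1))))%g; last first.
    apply: (L_mul fx'); apply: (L_mul gx); apply: (L_mul ye).
    exact: L_mul (L_inv gee) (L_inv ye).
  apply: (subgroupM sgD Df); apply: sub_gen_smallest; exists g^-1%g, y^-1%g.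
  by rewrite /commg /conjg !invgK !mulgA.
move=> /to10[f Df fu] /to10[g Dg gv]; exists (g^-1 * f)%g; last exact: L_mul (L_inv gv) fu.
by apply: (subgroupM sgD) Df; exact: subgroupV sgD Dg.
Qed.

(** The factor A B^-1 A^-1 is the identity on the left of A (1/2) = 3/4, so the
    commutator agrees with B near 1/2, where B has the slopes 1 and 2. *)
Lemma derived_right_germ : right_germ_at (@derived_subgroup (thompsonF R)) [::].
Proof.
pose A := el_A R; exists (B * (A * (B^-1 * A^-1)))%g, 0%N, 1%N.
have id_left : forall x, x <= 3 / 4 -> thompson_fun (A * (B^-1 * A^-1))%g x = x.
  move=> x x34; rewrite !thompson_mulEx.
  have -> : thompson_fun B^-1%g (thompson_fun A^-1%g x) = thompson_fun A^-1%g x.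
    apply: (fix_inv (f := B)); rewrite el_BE fun_B0 // thompson_inv_le el_AE fun_A2; lra.
  exact: thompson_invVK.
split.
- apply: sub_gen_smallest; exists B^-1%g, A^-1%g.
  by rewrite /commg /conjg !invgK !mulgA.
- apply: (L_mul (@el_B0 R)).
  by apply/L_fixP => x; rewrite /wr /= => xx; apply: id_left; lra.
apply: (L_mul (@el_B100 R)); apply/L_fixP => x; rewrite /wr /= => xx; apply: id_left.
by rewrite !exprS expr0 in xx; lra.
Qed.

End CellMoves.


(** * Trees, tilings and reduced tree pairs *)

Section Trees.
Variable R : realType.
Implicit Types (u v w p : seq bool) (s : seq (seq bool)) (T : btree) (f g h : thompsonF R) (a b m : R).

Notation wv := (word_val R).
Notation L f u v := (maps_linearly (thompson_fun f) u v).

(** This characterizes lists of leaves of trees ([tree_of_tiles]) and is visibly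
    preserved by maps that are linear on the tiles ([tiles_image]). *)
Fixpoint tiles a s b : Prop :=
  if s is v :: s' then wv v = a /\ tiles (wr v) s' b else a = b.

Lemma tiles_cat a s s' b : tiles a (s ++ s') b <-> exists2 m, tiles a s m & tiles m s' b.
Proof.
elim: s a => [|v s IHs] a /=; first by split=> [h|[m -> //]]; exists a.
split=> [[va /IHs[m h h']]|[m [va h] h']]; first by exists m.
by split=> //; apply/IHs; exists m.
Qed.

Lemma tiles_le a s b : tiles a s b -> a <= b.
Proof.
elim: s a => [|v s IHs] a /=; first by move=> ->.
by move=> [<- /IHs]; apply: le_trans; rewrite ltW ?wv_lt_wr.
Qed.

Lemma tiles_nil a s : tiles a s a -> s = [::].
Proof.
case: s => //= v s [<- /tiles_le]; by rewrite leNgt wv_lt_wr.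
Qed.

Lemma tiles_split a s b m : a <= m -> m <= b -> tiles a s b ->
  (forall v, v \in s -> ~ (wv v < m < wr v)) ->
  exists s0 s1, [/\ s = s0 ++ s1, tiles a s0 m & tiles m s1 b].
Proof.
elim: s a => [|v s IHs] a am mb /=.
  by move=> ab _; exists [::], [::]; split => //=; apply: le_anti; rewrite ?am ?ab ?mb // -ab am.
move=> [va tl] no; move: am; rewrite le_eqVlt => /predU1P[<-|am].
  by exists [::], (v :: s).
have vm : wr v <= m.
  by rewrite leNgt; apply/negP => mv; apply: (no v); rewrite ?mem_head // va am.
have [w ws|s0 [s1 [-> t0 t1]]] := IHs _ vm mb tl.
  by apply: no; rewrite inE ws orbT.
by exists (v :: s0), s1.
Qed.

Lemma tiles_leaves p T : tiles (wv p) (map (cat p) (leaves T)) (wr p).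
Proof.
elim: T p => [|l IHl r IHr] p /=; first by rewrite cats0.
rewrite map_cat -!map_comp; apply/tiles_cat; exists (wmid p).
  have := IHl (rcons p false); rewrite wv_rcons0 wr_rcons0.
  by congr tiles; apply: eq_map => w /=; rewrite cat_rcons.
have := IHr (rcons p true); rewrite wr_rcons1 -/(wmid p).
by congr tiles; apply: eq_map => w /=; rewrite cat_rcons.
Qed.

Lemma tiles_sub a s b v : tiles a s b -> v \in s -> a <= wv v /\ wr v <= b.
Proof.
move=> tl /path.splitPr vs; case: vs tl => s1 s2 /tiles_cat[m /tiles_le am [vm /tiles_le vb]].
by rewrite vm.
Qed.

Lemma tiles_self p s : tiles (wv p) s (wr p) -> p \in s -> s = [:: p].
Proof.
move=> tl /path.splitPr ps; case: ps tl => s1 s2 /tiles_cat[m t1 [pm t2]].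
by rewrite -pm in t1; rewrite (tiles_nil t1) (tiles_nil t2).
Qed.

(** Unless p is the only tile, no tile contains the midpoint of p in its interior,
    so the tiling splits there; the length of the tiles bounds the recursion. *)
Lemma tree_of_tiles p s : tiles (wv p) s (wr p) -> exists T, s = map (cat p) (leaves T).
Proof.
have [n] : exists n, forall v, v \in s -> (size v <= size p + n)%N.
  exists (foldr maxn 0 (map size s))%N => v vs; apply: leq_trans (leq_addl _ _).
  elim: s vs => //= v' s IHs; rewrite inE => /predU1P[->|/IHs h]; first exact: leq_maxl.
  exact: leq_trans (leq_maxr _ _).
elim: n p s => [|n IHn] p s sn tl.
  have [E|[v vs]] : s = [::] \/ exists v, v \in s by case: (s) => [|v s']; [left|right; exists v; rewrite mem_head].
    by move: tl; rewrite E /= => E'; have := wv_lt_wr R p; rewrite E' ltxx.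
  have [pv vp] := tiles_sub tl vs; have [w vE] := sub_cell pv vp.
  have w0 : w = [::] by move: (sn v vs); rewrite vE size_cat; case: (w) => //= ? ?; lia.
  rewrite w0 cats0 in vE; rewrite {v pv vp}vE in vs.
  by exists BLeaf; rewrite (tiles_self tl vs) /= cats0.
have [ps|p_s] := boolP (p \in s); first by exists BLeaf; rewrite (tiles_self tl ps) /= cats0.
have [v vs /wmid_interior vp|s0 [s1 [sE t0 t1]]] := tiles_split (ltW (wv_lt_wmid R p)) (ltW (wmid_lt_wr R p)) tl.
  have [pv pv'] := tiles_sub tl vs; have [w vE] := sub_cell pv pv'.
  have w0 : w = [::] by move: vp; rewrite vE size_cat; case: (w) => //= ? ?; lia.
  by move: p_s; rewrite -[p]cats0 -w0 -vE vs.
have [||T0 E0] := IHn (rcons p false) s0.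
- by move=> v vs; have := sn v; rewrite sE mem_cat vs size_rcons => /(_ isT); lia.
- by rewrite wv_rcons0 wr_rcons0.
have [||T1 E1] := IHn (rcons p true) s1.
- by move=> v vs; have := sn v; rewrite sE mem_cat vs orbT size_rcons => /(_ isT); lia.
- by rewrite wr_rcons1.
exists (BNode T0 T1); rewrite sE E0 E1 /= map_cat -!map_comp.
by congr (_ ++ _); apply: eq_map => w /=; rewrite cat_rcons.
Qed.

Lemma tree_of_tiles01 s : tiles 0 s 1 -> exists T, s = leaves T.
Proof.
have E1 : wr [::] = 1 :> R by rewrite /wr /= expr0 invr1 add0r.
rewrite -E1 => /(@tree_of_tiles [::])[T ->]; exists T.
by rewrite (eq_map (g := id)) ?map_id.
Qed.

Lemma tiles01_leaves T : tiles 0 (leaves T) 1.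
Proof.
have E1 : wr [::] = 1 :> R by rewrite /wr /= expr0 invr1 add0r.
by have := tiles_leaves [::] T; rewrite E1 (eq_map (g := id)) ?map_id.
Qed.

Definition linear_list f s s' := size s = size s' /\
  forall i, (i < size s)%N -> L f (nth [::] s i) (nth [::] s' i).

Lemma tiles_image f a s s' b : tiles a s b -> linear_list f s s' -> tiles (f a) s' (f b).
Proof.
elim: s s' a => [|v s IHs] [|v' s'] a //=; first by move=> ->.
  by move=> _ [].
by move=> _ [].
move=> [<- tl] [[ss] fs]; have fv := fs 0%N isT; rewrite /= in fv.
rewrite (L_wv fv); split => //; rewrite -(L_wr fv); apply: IHs => //.
by split=> // i si; exact: (fs i.+1 si).
Qed.

Fixpoint full_tree n := if n is n'.+1 then BNode (full_tree n') (full_tree n') else BLeaf.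

Lemma size_full_tree n u : u \in leaves (full_tree n) -> size u = n.
Proof.
elim: n u => [|n IHn] u /=; first by rewrite inE => /eqP->.
by rewrite mem_cat => /orP[]/mapP[v /IHn <- ->].
Qed.

Lemma linear_list_exists f s : (forall u, u \in s -> exists v, L f u v) ->
  exists s', linear_list f s s'.
Proof.
elim: s => [|u s IHs] h; first by exists [::].
have [v fv] := h u (mem_head _ _); have [|s' [ss fs]] := IHs.
  by move=> w ws; apply: h; rewrite inE ws orbT.
exists (v :: s'); split=> [/=|[|i] si]; rewrite ?ss //; exact: (fs i si).
Qed.

(** The elements of F are linear on the leaves of a deep full tree, and the images
    of these leaves tile the unit interval. *)
Lemma represents_exists f : exists d, represents d f.
Proof.
have [N NP] := thompson_deep f [::]; pose T := full_tree N.
have [|s' fs] := @linear_list_exists f (leaves T).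
  by move=> u /size_full_tree uN; have [|v fv] := NP u; rewrite ?uN //; exists v.
have := tiles_image (tiles01_leaves T) fs.
rewrite !thompson_out ?lexx; [|by right|by left].
by move=> /tree_of_tiles01[T' E]; exists (T, T'); rewrite E in fs.
Qed.

Definition merge_at s i u := take i s ++ u :: drop i.+2 s.

Lemma tiles_merge a s b i u : (i.+1 < size s)%N -> nth [::] s i = rcons u false ->
  nth [::] s i.+1 = rcons u true -> tiles a s b -> tiles a (merge_at s i u) b.
Proof.
move=> si Ei Ei1; rewrite -{1}(cat_take_drop i s) (drop_nth [::]) ?(ltnW si) // (drop_nth [::] si).
rewrite Ei Ei1 => /tiles_cat[m t [um [_ t']]]; apply/tiles_cat; exists m => //=.
by rewrite -um wv_rcons0; move: t'; rewrite wr_rcons1.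
Qed.

Lemma size_merge_at s i u : (i.+1 < size s)%N -> (size (merge_at s i u)).+1 = size s.
Proof. by move=> si; rewrite size_cat /= size_takel ?size_drop; lia. Qed.

Lemma nth_merge_at s i u j : (i.+1 < size s)%N -> nth [::] (merge_at s i u) j =
  if (j < i)%N then nth [::] s j else if j == i then u else nth [::] s j.+1.
Proof.
move=> si; rewrite nth_cat size_takel; last lia.
have [ji|ij|->] := ltngtP j i; first by rewrite nth_take.
  have -> : (j - i = (j - i).-1.+1)%N by lia.
  by rewrite /= nth_drop; congr nth; lia.
by rewrite subnn.
Qed.

(** If a pair is not reduced, erasing a common pair of sibling leaves gives a
    smaller pair, which represents the same map by [L_join]. *)
Lemma reduced_pair_exists f : exists d, is_reduced_pair d f.
Proof.
have [d rd] := represents_exists f.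
have [n] := ubnP (size (leaves d.1)); elim: n d rd => // n IHn d rd; rewrite ltnS => dn.
have [red|/contrapT[i [u [v [i1 i2 [u0 u1] [v0 v1]]]]]] := pselect (reduced d); first by exists d.
have [T1 E1] := tree_of_tiles01 (tiles_merge i1 u0 u1 (tiles01_leaves d.1)).
have [T2 E2] := tree_of_tiles01 (tiles_merge i2 v0 v1 (tiles01_leaves d.2)).
case: rd => sd fd; apply: (IHn (T1, T2)) => /=.
  split; rewrite /= -E1 -E2.
    by apply: succn_inj; rewrite !size_merge_at.
  move=> j; rewrite -ltnS size_merge_at // !nth_merge_at // => jd.
  case: ifP => [ji|_]; first by apply: fd; lia.
  case: eqP => [_|ij]; last by apply: fd; lia.
  by apply: L_join; rewrite -?u0 -?u1 -?v0 -?v1; apply: fd; lia.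
by rewrite -E1 -ltnS size_merge_at.
Qed.

End Trees.


(** * Words of edges and the core *)

Section Nodes.
Implicit Types (u v w p : seq bool) (T : btree) (s b : bool).

Lemma inner_cons T b u : (b :: u \in inner_nodes T) =
  if T is BNode l r then u \in inner_nodes (if b then r else l) else false.
Proof.
case: T => //= l r; rewrite inE mem_cat /=.
have cI b' : injective (cons b') by move=> ? ? [].
by case: b; rewrite (mem_map (cI _)); case: mapP => [[? _ []]|_] //; rewrite orbF.
Qed.

Lemma leaf_cons T b u : (b :: u \in leaves T) =
  if T is BNode l r then u \in leaves (if b then r else l) else false.
Proof.
case: T => //= l r; rewrite mem_cat.
have cI b' : injective (cons b') by move=> ? ? [].
by case: b; rewrite (mem_map (cI _)); case: mapP => [[? _ []]|_] //; rewrite orbF.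
Qed.

Lemma leaf_nil l r : ([::] \in leaves (BNode l r)) = false.
Proof. by apply/negP; rewrite /= mem_cat => /orP[]/mapP[]. Qed.

Lemma root_node T : [::] \in inner_nodes T \/ [::] \in leaves T.
Proof. by case: T => [|l r]; [right|left]; rewrite mem_head. Qed.

Lemma child_node T u b : u \in inner_nodes T ->
  rcons u b \in inner_nodes T \/ rcons u b \in leaves T.
Proof.
elim: u T => [|a u IHu] [|l r] //.
  by move=> _; rewrite /rcons inner_cons leaf_cons; exact: root_node.
by rewrite rcons_cons !inner_cons leaf_cons; exact: IHu.
Qed.

Lemma leaf_not_inner T u : u \in leaves T -> u \notin inner_nodes T.
Proof.
elim: u T => [|a u IHu] [|l r]; rewrite ?leaf_nil //.
by rewrite leaf_cons inner_cons; exact: IHu.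
Qed.

Lemma uniq_leaves T : uniq (leaves T).
Proof.
have cI b : injective (cons b) by move=> ? ? [].
elim: T => //= l IHl r IHr; rewrite cat_uniq !(map_inj_uniq (cI _)) IHl IHr andbT /=.
by apply/hasPn => _ /mapP[v _ ->]; apply/mapP => -[].
Qed.

(** Every leaf is reached from the root by passing to children. *)
Lemma leaf_ind T (P : seq bool -> Prop) : P [::] ->
  (forall u b, u \in inner_nodes T -> P u -> P (rcons u b)) ->
  forall u, u \in leaves T -> P u.
Proof.
elim: T P => [|l IHl r IHr] P P0 PS u; first by rewrite inE => /eqP->.
have P1 b : P [:: b] by apply: (PS [::]); rewrite // mem_head.
case: u => [|b u]; first by rewrite leaf_nil.
rewrite leaf_cons => ub; have Pb x a : x \in inner_nodes (if b then r else l) -> P (b :: x) -> P (b :: rcons x a).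
  by move=> xi; rewrite -rcons_cons; apply: PS; rewrite inner_cons.
by case: b P1 ub Pb => P1 ub Pb; [apply: (IHr (fun x => P (true :: x)))|apply: (IHl (fun x => P (false :: x)))].
Qed.

Lemma deep_leaves T (P : seq bool -> Prop) p : (forall u w, P u -> P (u ++ w)) ->
  (forall u, u \in leaves T -> P (p ++ u)) -> deep P p.
Proof.
move=> Pcat; elim: T p => [|l IHl r IHr] p PT.
  by exists 0%N => w _; apply: Pcat; rewrite -[p]cats0; apply: PT; rewrite mem_head.
apply: deep_split; [apply: IHl|apply: IHr] => u ul;
  by rewrite cat_rcons; apply: PT; rewrite leaf_cons.
Qed.

End Nodes.

Section Core.
Variable R : realType.
Implicit Types (u v w p : seq bool) (T : btree) (f g h : thompsonF R) (s b : bool).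
Notation L f u v := (maps_linearly (thompson_fun f) u v).
Variable H : set (thompsonF R).
Hypothesis sgH : is_subgroup H.

Lemma same_deep u v : same_cell H u v -> deep_same H u v.
Proof. by move=> uv; exists 0%N => w _; exact: same_cat. Qed.

Lemma deep_same_refl u : deep_same H u u.
Proof. by apply: same_deep; exact: same_refl. Qed.

Lemma deep_same_sym u v : deep_same H u v -> deep_same H v u.
Proof. by move=> [N h]; exists N => w /h; exact: same_sym. Qed.

Lemma deep_same_trans v u w : deep_same H u v -> deep_same H v w -> deep_same H u w.
Proof.
move=> [N h] [M k]; exists (maxn N M) => x; rewrite geq_max => /andP[/h ux /k xw].
exact: same_trans ux xw.
Qed.

Lemma deep_same_cat u v w : deep_same H u v -> deep_same H (u ++ w) (v ++ w).
Proof.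
by move=> [N h]; exists N => x Nx; rewrite -!catA; apply: h; rewrite size_cat; lia.
Qed.

Lemma deep_same_join u v : deep_same H (rcons u false) (rcons v false) ->
  deep_same H (rcons u true) (rcons v true) -> deep_same H u v.
Proof.
move=> [N h] [M k]; exists (maxn N M).+1 => -[|[] w] //=;
  rewrite ltnS geq_max => /andP[Nw Mw]; rewrite -!cat_rcons; [exact: k|exact: h].
Qed.

(** A leaf edge is a leaf of both trees; its address in the first one is chosen. *)
Definition diag_label d (e : diag_edge d) : seq bool :=
  match e with inl i => nth [::] (leaves d.1) i | inr c => (val c).2 end.

Lemma node_edge_inner d s u (su : u \in inner_nodes (side d s)) :
  node_edge d s u = inr (exist (fun x : bool * seq bool => x.2 \in inner_nodes (side d x.1)) (s, u) su).
Proof.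
by rewrite /node_edge insubT; congr inr; apply: val_inj.
Qed.

Lemma node_edge_leaf d s i : size (leaves d.1) = size (leaves d.2) ->
  (i < size (leaves d.1))%N ->
  node_edge d s (nth [::] (leaves (side d s)) i) = inl (inord i).
Proof.
move=> sd id; have si : (i < size (leaves (side d s)))%N by case: s; rewrite /side -?sd.
rewrite /node_edge insubF; last exact/negbTE/leaf_not_inner/mem_nth.
by rewrite index_uniq ?uniq_leaves.
Qed.

(** For the leaves of the second tree, whose label is a leaf of the first one, this
    holds because h maps one to the other. *)
Lemma label_node d h s u : H h -> represents d h ->
  u \in inner_nodes (side d s) \/ u \in leaves (side d s) ->
  deep_same H (diag_label (node_edge d s u)) u.
Proof.
move=> Hh [sd dh] [su|/(nthP [::])[i]].
  by rewrite (node_edge_inner su); exact: deep_same_refl.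
have -> : size (leaves (side d s)) = size (leaves d.1) by case: s; rewrite /side -?sd.
move=> id <-; rewrite node_edge_leaf //= inordK; last by rewrite /nleaves prednK //; lia.
case: s; rewrite /=; first exact: deep_same_refl.
by apply: same_deep; exists h => //; exact: dh.
Qed.

Let D := reduced_pairs H.
Let K := union (@gen_diagram D).
Let base := @core_base D.

(** The trivial pair that is added to the generators represents the identity. *)
Lemma generator_represents (d : set_type (generators D)) : exists2 h, H h & represents (val d) h.
Proof.
case: d => d /= /set_mem [->|[h Hh [_ dh]]]; last by exists h.
exists 1%g; first exact: subgroup1.
by split => // -[|i] //= _; exact: L_id.
Qed.

Definition edge_label (e : edge K) : seq bool := diag_label (tagged e).

Lemma label_bot (c : cell K) (b : bool) :
  deep_same H (edge_label (if b then rbot c else lbot c)) (rcons (edge_label (top c)) b).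
Proof.
have [h Hh dh] := generator_represents (tag c).
case: c dh => d [[s u] /= su] /= dh.
by case: b; apply: (label_node Hh dh); exact: child_node.
Qed.

(** By induction on the identifications. Identifying bottom edges uses that a
    linear map of a cell restricts to its halves; identifying top edges uses
    that any long subcell lies in one of the two halves. *)
Lemma label_eqv e e' : edge_eqv base e e' -> deep_same H (edge_label e) (edge_label e').
Proof.
have lbl_base e0 : base e0 -> deep_same H (edge_label e0) [::].
  move=> [d]; have [h Hh dh] := generator_represents d.
  by case=> ->; apply: (label_node Hh dh); exact: root_node.
elim=> {e e'} [e|e e' _|e e' e'' _ h _|e e' /lbl_base h /lbl_base h'|c c' _|c c' _|c c' _ h0 _ h1].
- exact: deep_same_refl.
- exact: deep_same_sym.
- exact: deep_same_trans.
- exact: deep_same_trans h (deep_same_sym h').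
- move=> h; apply: deep_same_trans (label_bot c false) _.
  apply: deep_same_trans _ (deep_same_sym (label_bot c' false)).
  by rewrite -!cats1; exact: deep_same_cat.
- move=> h; apply: deep_same_trans (label_bot c true) _.
  apply: deep_same_trans _ (deep_same_sym (label_bot c' true)).
  by rewrite -!cats1; exact: deep_same_cat.
- apply: deep_same_join.
    apply: deep_same_trans (deep_same_sym (label_bot c false)) _.
    exact: deep_same_trans h0 (label_bot c' false).
  apply: deep_same_trans (deep_same_sym (label_bot c true)) _.
  exact: deep_same_trans h1 (label_bot c' true).
Qed.

Lemma label_class e e' : edge_class base e = edge_class base e' -> deep_same H (edge_label e) (edge_label e').
Proof. by move=> /edge_classP; exact: label_eqv. Qed.

(** By induction from the root: cells of the diagram go to cells of the core, and
    both know the label of a child from that of its parent ([label_bot]). *)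
Lemma label_morphism d (phi : morphism (diagram d) (core D)) s :
  mor_edge phi (node_edge d s [::]) = core_edge D ->
  forall u, u \in leaves (side d s) ->
  forall e, edge_class base e = mor_edge phi (node_edge d s u) -> deep_same H (edge_label e) u.
Proof.
move=> root; apply: leaf_ind => [e|u b su IHu e].
  rewrite root => /label_class h; apply: deep_same_trans h _.
  have [h Hh dh] := generator_represents (exist (fun d => d \in generators D) _ (trivial_generator D)).
  by apply: (label_node Hh dh); exact: root_node.
move: IHu; rewrite (node_edge_inner su); set c : cell (diagram d) := (exist (fun x : bool * seq bool => x.2 \in inner_nodes (side d x.1)) (s, u) su) => IHu.
have {}IHu := IHu (top (repr (mor_cell phi c))) (esym (mor_top phi c)).
have -> : node_edge d s (rcons u b) = if b then rbot c else lbot c by case: b.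
have -> : mor_edge phi (if b then rbot c else lbot c) = edge_class base
    (if b then rbot (repr (mor_cell phi c)) else lbot (repr (mor_cell phi c))).
  by case: b; [exact: mor_rbot|exact: mor_lbot].
move=> /label_class h; apply: deep_same_trans h _; apply: deep_same_trans (label_bot _ b) _.
by rewrite -!cats1; exact: deep_same_cat.
Qed.

(** The i-th leaves of the two trees are the same edge, so both words are related
    to the label of its image in the core, hence to each other. All long words
    extend leaves of the first tree. *)
Lemma Cl_deep_same f u v : Cl H f -> L f u v -> deep_same H u v.
Proof.
move=> [d [_ [sd df]] [phi [p1 p2]]] fuv.
have leafP x : x \in leaves d.1 -> exists2 y, L f x y & deep_same H x y.
  move=> /(nthP [::])[i id <-]; exists (nth [::] (leaves d.2) i); first exact: df.
  pose e := repr (mor_edge phi (inl (inord i) : edge (diagram d))).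
  have eE : edge_class base e = mor_edge phi (inl (inord i) : edge (diagram d)) by exact: reprK.
  apply: (deep_same_trans (deep_same_sym (_ : deep_same H (edge_label e) _))).
    apply: (@label_morphism d phi true) => //; first exact: mem_nth.
    by rewrite eE (@node_edge_leaf d true).
  apply: (@label_morphism d phi false) => //; first by rewrite mem_nth //= -sd.
  by rewrite eE (@node_edge_leaf d false).
have [|N NP] := @deep_leaves d.1 (fun x => exists2 y, L f x y & deep_same H x y) [::] _ leafP.
  by move=> x w [y fxy xy]; exists (y ++ w); [exact: L_cat|exact: deep_same_cat].
suff h : deep (fun w => deep_same H (u ++ w) (v ++ w)) [::].
  rewrite -[u]cats0 -[v]cats0; apply: (deep_ind h) => w.
  by rewrite -!rcons_cat; exact: deep_same_join.
exists N => w Nw /=; have [|y fy uy] := NP (u ++ w); first by rewrite size_cat; lia.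
by rewrite (L_fun (L_cat fuv) fy).
Qed.

Lemma Cl_cell_transitive : @derived_subgroup (thompsonF R) `<=` Cl H -> cell_transitive H.
Proof.
move=> FH u v iu iv; have [f Df fuv] := inner_cells_derived R iu iv.
exact: Cl_deep_same (FH _ Df) fuv.
Qed.

Definition in_union_morphism (d : set_type (generators D)) : morphism (gen_diagram d) K :=
  @Morphism (gen_diagram d) K (existT _ d) (existT _ d) (existT _ d)
    (fun=> erefl) (fun=> erefl) (fun=> erefl) (fun=> erefl) (fun=> erefl).

Lemma sub_Cl : H `<=` Cl H.
Proof.
move=> f Hf; have [d rd] := reduced_pair_exists f; exists d => //.
have dD : d \in generators D by apply/mem_set; right; exists f.
pose d' : set_type (generators D) := exist _ d dD.
pose i := in_union_morphism d'; pose q := fold_morphism base.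
exists (@Morphism (diagram d) (core D) (mor_vertex q \o mor_vertex i)
  (mor_edge q \o mor_edge i) (mor_cell q \o mor_cell i)
  (fun e => mor_init q (mor_edge i e)) (fun e => mor_term q (mor_edge i e))
  (fun c => mor_top q (mor_cell i c)) (fun c => mor_lbot q (mor_cell i c))
  (fun c => mor_rbot q (mor_cell i c))).
split; apply/edge_classP/edge_base; first by exists d'; left.
- by exists (exist (fun d => d \in generators D) _ (trivial_generator D)); left.
- by exists d'; right.
- by exists (exist (fun d => d \in generators D) _ (trivial_generator D)); left.
Qed.

End Core.

Theorem theorem1p3 (R : realType) (H : set (thompsonF R))
    (subgroupH : is_subgroup H) :
  @derived_subgroup (thompsonF R) `<=` H <->
  (@derived_subgroup (thompsonF R) `<=` Cl H /\
   exists h : thompsonF R, H h /\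
     exists alpha : R,
       [/\ dyadic01 alpha, h alpha = alpha,
           left_slope h alpha 1 & right_slope h alpha 2]).
Proof.
split=> [FH|[FH [h [Hh [a [da ha hl hr]]]]]].
  split=> [f Ff|]; first exact/sub_Cl/FH.
  have [h [m [n [Hh h1 h2]]]] := derived_right_germ R; exists h; split; first exact: FH.
  exact: slopes_of_right_germ Hh h1 h2.
have [y rg] := right_germ_of_slopes Hh da ha hl hr.
exact: contains_derived (Cl_cell_transitive subgroupH FH) rg.
Qed.
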